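(* Let $W_C(x),W_G(x)\in\mathbb C^{p\times p}[x]$ be monic matrix polynomials of degrees $N_C,N_G$ with $\sigma(W_G(y))\cap\operatorname{supp}_y(u)=\varnothing$, and let $$\hat u_{x,y}=W_C(x)u_{x,y}(W_G(y))^{-1}+\sum_{a=1}^{q_G}\sum_{j=1}^{s_{G,a}}\sum_{m=0}^{\kappa^{(a)}_{G,j}-1}\frac{(-1)^m}{m!}W_C(x)\big(\xi^{[a]}_{j,m}\big)_x\otimes\delta^{(m)}(y-x_{G,a})\,l^{(a)}_{G,j}(y),$$ with $\big(\xi^{[a]}_{j,m}\big)_x\in\big((\mathbb C[x])'\big)^p$. Assume $u$ and $\hat u$ are quasidefinite. For $k\ge0$ put $M_k:=\boldsymbol{\mathcal J}_{G,C^{[1]}_k}-\langle P^{[1]}_k(x),(\xi)_x\rangle\mathcal W_G$. Then for every $n\ge N_G$ $$\hat P^{[1]}_n(x)W_C(x)=\Theta_*\begin{bmatrix}\boldsymbol{\mathcal J}_{C,P^{[1]}_{n-N_G}}&M_{n-N_G}&P^{[1]}_{n-N_G}(x)\\ \vdots&\vdots&\vdots\\ \boldsymbol{\mathcal J}_{C,P^{[1]}_{n+N_C}}&M_{n+N_C}&P^{[1]}_{n+N_C}(x)\end{bmatrix},$$ $$\hat H_n=\Theta_*\begin{bmatrix}\boldsymbol{\mathcal J}_{C,P^{[1]}_{n-N_G}}&M_{n-N_G}&H_{n-N_G}\\ \boldsymbol{\mathcal J}_{C,P^{[1]}_{n-N_G+1}}&M_{n-N_G+1}&0_p\\ \vdots&\vdots&\vdots\\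 \boldsymbol{\mathcal J}_{C,P^{[1]}_{n+N_C}}&M_{n+N_C}&0_p\end{bmatrix},$$ $$\big(\hat P^{[2]}_n(y)\big)^\top=-\Theta_*\begin{bmatrix}\boldsymbol{\mathcal J}_{C,P^{[1]}_{n-N_G}}&M_{n-N_G}&H_{n-N_G}\\ \boldsymbol{\mathcal J}_{C,P^{[1]}_{n-N_G+1}}&M_{n-N_G+1}&0_p\\ \vdots&\vdots&\vdots\\ \boldsymbol{\mathcal J}_{C,P^{[1]}_{n+N_C-1}}&M_{n+N_C-1}&0_p\\ W_G(y)\boldsymbol{\mathcal J}_{C,K_{n-1}}(y)&W_G(y)\big(\boldsymbol{\mathcal J}_{G,K^{(pc)}_{n-1}}(y)-\langle K_{n-1}(x,y),(\xi)_x\rangle\mathcal W_G\big)+\boldsymbol{\mathcal J}_{G,\mathcal V_G}(y)&0_p\end{bmatrix}.$$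
   Context: Notation. $p\ge1$ is fixed; $I_p,0_p$ are the $p\times p$ identity and zero matrices. Semi-infinite matrices are written in $p\times p$ blocks indexed by $0,1,2,\dots$; $A_{[n]}$ is the truncation to the first $n$ block rows and columns. $\chi(x)=[I_p,I_px,I_px^2,\dots]^\top$. The last quasideterminant of a block matrix with $A$ square nonsingular is $\Theta_*\begin{bmatrix}A&B\\ C&D\end{bmatrix}=D-CA^{-1}B$, with $D$ the last $p\times p$ block. Generalized kernels. $u=u_{x,y}$ is a $p\times p$ matrix of fast decreasing distributions in the real variables $(x,y)$ (distributions $w$ such that $(1+x^2+y^2)^{k/2}w$ is a bounded distribution for all $k$); the projections $\operatorname{supp}_x(u),\operatorname{supp}_y(u)$ of its support are assumed bounded. The sesquilinear form is $\big(\langle P(x),Q(y)\rangle_u\big)_{i,j}=\sum_{k,l}\langle (u_{x,y})_{k,l},P_{i,k}(x)Q_{j,l}(y)\rangle$, for matrix polynomials and for matrix functions smooth near the support. Gram matrix: $G_{k,l}=\langle I_px^k,I_py^l\rangle_u$. $u$ is quasidefinite if $\det G_{[k]}\ne0$ for all $k\ge1$; then $G=S_1^{-1}HS_2^{-\top}$ uniquely, with $S_1,S_2$ lower unitriangular by blocks and $H=\operatorname{diag}(H_0,H_1,\dots)$. $P^{[i]}(x)=S_i\chi(x)$ has blocks $P^{[i]}_n$ (monic, degree $n$, $\langle P^{[1]}_n,P^{[2]}_m\rangle_u=\delta_{n,m}H_n$). The objects $\hat P^{[1]}_n,\hat P^{[2]}_n,\hat H_n$ are those of $\hat u$. Second kind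 functions: $C^{[1]}_n(z)=\langle P^{[1]}_n(x),\frac{I_p}{z-y}\rangle_u$, $z\notin\operatorname{supp}_y(u)$. Kernels: $K_n(x,y)=\sum_{k=0}^n(P^{[2]}_k(y))^\top H_k^{-1}P^{[1]}_k(x)$, $K^{(pc)}_n(x,y)=\sum_{k=0}^n(P^{[2]}_k(y))^\top H_k^{-1}C^{[1]}_k(x)$. Spectral data of a monic matrix polynomial $W$ of degree $N$. $\sigma(W)=\{x_1,\dots,x_q\}$ is the zero set of $\det W$, $\alpha_a$ the multiplicity of $x_a$, $s_a=\dim\operatorname{Ker}W(x_a)$, $\kappa^{(a)}_1\le\dots\le\kappa^{(a)}_{s_a}$ the partial multiplicities at $x_a$ (so $\sum_j\kappa_j^{(a)}=\alpha_a$, $\sum_a\alpha_a=Np$). Canonical root polynomials are fixed: columns $r^{(a)}_j(x)=\sum_{l=0}^{\kappa^{(a)}_j-1}r^{(a)}_{j,l}(x-x_a)^l$ and rows $l^{(a)}_j(x)=\sum_{l=0}^{\kappa^{(a)}_j-1}l^{(a)}_{j,l}(x-x_a)^l$ such that $Wr^{(a)}_j$ and $l^{(a)}_jW$ vanish at $x_a$ to order at least $\kappa^{(a)}_j$, and the $r^{(a)}_{j,0}$ (resp. $l^{(a)}_{j,0}$), $j=1,\dots,s_a$, are linearly independent. $(f)^{(m)}_{x_a}$ is the $m$-th derivative at $x_a$. Root spectral jets: $\boldsymbol{\mathcal J}^{(i)}_f(x_a)=\big[(fr^{(a)}_i)_{x_a},\dots,\frac{(fr_i^{(a)})^{(\kappa_i^{(a)}-1)}_{x_a}}{(\kappa^{(a)}_i-1)!}\big]$,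 $\boldsymbol{\mathcal J}_f(x_a)=[\boldsymbol{\mathcal J}^{(1)}_f(x_a),\dots,\boldsymbol{\mathcal J}^{(s_a)}_f(x_a)]$, $\boldsymbol{\mathcal J}_f=[\boldsymbol{\mathcal J}_f(x_1),\dots,\boldsymbol{\mathcal J}_f(x_q)]\in\mathbb C^{p\times Np}$. For functions of $(x,y)$ jets are taken in $x$, with $y$ a parameter. The matrix $\mathcal W=\operatorname{diag}(\mathcal W^{(1)},\dots,\mathcal W^{(q)})\in\mathbb C^{Np\times Np}$, $\mathcal W^{(a)}=(\mathcal W^{(a)}_{i,j})_{i,j=1}^{s_a}$, has blocks $\mathcal W^{(a)}_{i,j}\in\mathbb C^{\kappa_i^{(a)}\times\kappa_j^{(a)}}$ whose entry in row $m+1$, column $c+1$ is $\frac1{(m+c+1)!}\big(l^{(a)}_iWr^{(a)}_j\big)^{(m+c+1)}_{x_a}$. Subscripts $C$ and $G$ indicate that the data are those of $W_C$ and $W_G$ respectively (so $\boldsymbol{\mathcal J}_{C,f}\in\mathbb C^{p\times N_Cp}$, $\boldsymbol{\mathcal J}_{G,f}\in\mathbb C^{p\times N_Gp}$). With $W_G(x)=\sum_{j=0}^{N_G}A_{G,j}x^j$, $\mathcal V_G(x,y)=\sum_{j=1}^{N_G}A_{G,j}\sum_{i=0}^{j-1}x^iy^{j-1-i}$. Masses. For a column $\xi$ of $p$ generalized functions, $\langle P(x),(\xi)_x\rangle\in\mathbb C^p$ has entries $\sum_k\langle\xi_k,P_{i,k}\rangle$. The form of $\hat u$ is $\langle P,Q\rangle_{\hat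 u}=\langle P(x)W_C(x),Q(y)(W_G(y))^{-\top}\rangle_u+\sum_{a,j,m}\langle P(x)W_C(x),(\xi^{[a]}_{j,m})_x\rangle\frac1{m!}\big(l^{(a)}_{G,j}(y)(Q(y))^\top\big)^{(m)}_{x_{G,a}}$. $\langle P(x),(\xi)_x\rangle\in\mathbb C^{p\times N_Gp}$ is the row of all columns $\langle P(x),(\xi^{[a]}_{j,m})_x\rangle$ ordered lexicographically in $(a,j,m)$.
   Formalization: The third formula (for P̂^{[2]}_n) is stated only for N_G ≥ 1: for N_G = 0 it fails (e.g. N_C = N_G = 0 gives û = u and the right-hand side is 0_p, while P̂^{[2]}_n is monic). The first two formulas keep N_G = 0. *)

(* Defs.v *)
(* The complex field is R[i], for R : realType. *)
From HB Require Import structures.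
From mathcomp Require Import all_boot all_order all_algebra.
From mathcomp Require Import complex.
From mathcomp Require Import all_classical all_reals all_analysis.

Set Implicit Arguments.
Unset Strict Implicit.
Unset Printing Implicit Defensive.

Import Order.TTheory GRing.Theory Num.Theory.
Import numFieldNormedType.Exports.

Local Open Scope classical_set_scope.
Local Open Scope ring_scope.
Local Open Scope complex_scope.

Section Distributions.
Variable R : realType.
Local Notation C := R[i].
Local Notation plane := (R * R)%type.
Implicit Types (f phi psi : plane -> C) (z : plane).

Definition direction (b : bool) : plane := if b then (0, 1) else (1, 0).

(* A word s of booleans encodes an iterated partial derivative:
   false stands for d/dx and true for d/dy. *)
Definition rpartial (s : seq bool) (g : plane -> R) : plane -> R :=
  foldr (fun b h => fun z => 'D_(direction b) h z) g s.

Definition cpartial (s : seq bool) f : plane -> C := fun z =>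
  rpartial s (fun t => complex.Re (f t)) z
    +i* rpartial s (fun t => complex.Im (f t)) z.

Definition rsmooth (g : plane -> R) : Prop :=
  forall s z, {for z, continuous (rpartial s g)} /\
    forall b, derivable (rpartial s g) z (direction b).

Definition csmooth f : Prop :=
  rsmooth (fun z => complex.Re (f z)) /\ rsmooth (fun z => complex.Im (f z)).

Definition vanishes_beyond (r : R) f : Prop :=
  forall z, r < `|z| -> f z = 0.

Definition test_function f : Prop :=
  csmooth f /\ exists r, vanishes_beyond r f.

(* An element of D'(R^2).  The carrier is total on plane -> C; only its values
   on test functions are constrained, and only these are ever used. *)
Record plane_distribution := PlaneDistribution {
  dapp :> (plane -> C) -> C;
  dlin : forall (c : C) phi psi, test_function phi -> test_function psi ->
    dapp (fun z => c * phi z + psi z) = c * dapp phi + dapp psi;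
  dcont : forall r : R, exists (m : nat) (c : R),
    forall phi, test_function phi -> vanishes_beyond r phi ->
    forall B : R,
      (forall s z, (size s <= m)%N -> Normc.normc (cpartial s phi z) <= B) ->
      Normc.normc (dapp phi) <= c * B }.

(* A functional is a bounded distribution (an element of Schwartz's space B')
   when it is continuous for the seminorms of D_{L^1}. *)
Definition bounded_distribution (w : (plane -> C) -> C) : Prop :=
  exists (m : nat) (c : R), forall phi, test_function phi ->
    ((Normc.normc (w phi))%:E <= c%:E *
      \sum_(i < m.+1) \sum_(s : i.-tuple bool)
        \int[(@lebesgue_measure R) \x (@lebesgue_measure R)]_z
          (Normc.normc (cpartial s phi z))%:E)%E.

Definition fast_decreasing (w : plane_distribution) : Prop :=
  forall k : nat, bounded_distribution (fun phi =>
    w (fun z => ((Num.sqrt (1 + z.1 ^+ 2 + z.2 ^+ 2)) ^+ k)%:C * phi z)).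

Definition dsupp (w : plane_distribution) : set plane :=
  [set z | ~ exists U : set plane, [/\ open U, U z &
     forall phi, test_function phi ->
       closure [set t | phi t != 0] `<=` U -> w phi = 0]].

(* Action of w on a function f which is smooth near the support of w: the
   common value of w at all test functions that coincide with f on a
   neighbourhood of this support (they exist when the support is bounded). *)
Definition dpair (w : plane_distribution) f : C :=
  xget 0 [set v | exists phi (U : set plane),
    [/\ test_function phi, open U, dsupp w `<=` U,
        forall z, U z -> phi z = f z & v = w phi]].

End Distributions.

Section MatrixPolynomials.
Variables (R : realType) (p : nat).
Local Notation C := R[i].
Implicit Types (W : 'M[{poly C}]_p).

Definition mxev m n (A : 'M[{poly C}]_(m, n)) (x : C) : 'M[C]_(m, n) :=
  \matrix_(i, j) (A i j).[x].

Definition mxcoef m n (A : 'M[{poly C}]_(m, n)) (k : nat) : 'M[C]_(m, n) :=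
  \matrix_(i, j) (A i j)`_k.

Definition mxderivn m n (A : 'M[{poly C}]_(m, n)) (k : nat) (x : C) :
    'M[C]_(m, n) :=
  \matrix_(i, j) (A i j)^`(k).[x].

Definition mxpoly_monic (N : nat) W : Prop :=
  mxcoef W N = 1%:M /\ forall k, (N < k)%N -> mxcoef W k = 0.

(* Local Smith form: near z0, W is equivalent to
   diag((x - z0)^kappa_1, ..., (x - z0)^kappa_s, 1, ..., 1). *)
Definition partial_multiplicities W (z0 : C) (kappa : seq nat) : Prop :=
  [/\ sorted leq kappa, all (leq 1) kappa,
      size kappa = \rank (kermx (mxev W z0)^T) &
      exists E F : 'M[{poly C}]_p,
        [/\ (\det E).[z0] != 0, (\det F).[z0] != 0 &
            W = E *m diag_mx (\row_(i < p) ('X - z0%:P) ^+ nth 0%N kappa i)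
                  *m F]].

(* Only the indices a < sd_q and j < size (sd_kappa a) are meaningful. *)
Record spectral_data := SpectralData {
  sd_q : nat;
  sd_x : nat -> C;
  sd_kappa : nat -> seq nat;
  sd_r : nat -> nat -> 'cV[{poly C}]_p;
  sd_l : nat -> nat -> 'rV[{poly C}]_p }.

Definition sd_s (D : spectral_data) (a : nat) : nat := size (sd_kappa D a).

Definition sd_kap (D : spectral_data) (a j : nat) : nat :=
  nth 0%N (sd_kappa D a) j.

Record is_spectral_data W (D : spectral_data) : Prop := {
  sd_x_inj : forall a b, (a < sd_q D)%N -> (b < sd_q D)%N ->
    sd_x D a = sd_x D b -> a = b;
  sd_xE : forall z, root (\det W) z <->
    exists2 a, (a < sd_q D)%N & z = sd_x D a;
  sd_kappaP : forall a, (a < sd_q D)%N ->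
    partial_multiplicities W (sd_x D a) (sd_kappa D a);
  sd_r_size : forall a j i, (a < sd_q D)%N -> (j < sd_s D a)%N ->
    (size (sd_r D a j i ord0) <= sd_kap D a j)%N;
  sd_l_size : forall a j i, (a < sd_q D)%N -> (j < sd_s D a)%N ->
    (size (sd_l D a j ord0 i) <= sd_kap D a j)%N;
  sd_r_root : forall a j i, (a < sd_q D)%N -> (j < sd_s D a)%N ->
    ('X - (sd_x D a)%:P) ^+ sd_kap D a j %| (W *m sd_r D a j) i ord0;
  sd_l_root : forall a j i, (a < sd_q D)%N -> (j < sd_s D a)%N ->
    ('X - (sd_x D a)%:P) ^+ sd_kap D a j %| (sd_l D a j *m W) ord0 i;
  sd_r_free : forall a, (a < sd_q D)%N ->
    row_free (\matrix_(j < sd_s D a, i < p)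
      (sd_r D a j i ord0).[sd_x D a]);
  sd_l_free : forall a, (a < sd_q D)%N ->
    row_free (\matrix_(j < sd_s D a, i < p)
      (sd_l D a j ord0 i).[sd_x D a]) }.

(* The triples (a, j, m), in lexicographic order; there are N p of them when D
   is the spectral data of a monic W of degree N. *)
Definition jet_index (D : spectral_data) : seq (nat * nat * nat) :=
  flatten [seq flatten [seq [seq (a, j, m) | m <- iota 0 (sd_kap D a j)]
                       | j <- iota 0 (sd_s D a)]
          | a <- iota 0 (sd_q D)].

Definition jet_nth (D : spectral_data) (c : nat) : nat * nat * nat :=
  nth (0, 0, 0)%N (jet_index D) c.

(* Iterated derivative in the complex variable. *)
Definition cderivn (m : nat) (g : C -> C) (x : C) : C :=
  derive1n m (g : C -> C^o) x.

Definition spectral_jet (D : spectral_data) (N : nat) (f : C -> 'M[C]_p) :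
    'M[C]_(p, N * p) :=
  \matrix_(i, c) let: (a, j, m) := jet_nth D c in
    cderivn m (fun z => (f z *m mxev (sd_r D a j) z) i ord0) (sd_x D a)
      / m`!%:R.

Definition spectral_W W (D : spectral_data) (N : nat) : 'M[C]_(N * p) :=
  \matrix_(t, t') let: (a, i, m) := jet_nth D t in
    let: (b, j, c) := jet_nth D t' in
    if a == b then
      mxderivn (sd_l D a i *m W *m sd_r D a j) (m + c + 1) (sd_x D a)
        ord0 ord0 / ((m + c + 1)`!)%:R
    else 0.

Definition bezoutian W (N : nat) (x y : C) : 'M[C]_p :=
  \sum_(1 <= j < N.+1) \sum_(i < j) (x ^+ i * y ^+ (j.-1 - i)) *: mxcoef W j.

(* Columns xi^{[a]}_{j,m} of p elements of the algebraic dual of C[x]. *)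
Definition masses := nat -> nat -> nat -> 'I_p -> {scalar {poly C}}.

Definition mass_pair (P : 'M[{poly C}]_p) (xi : 'I_p -> {scalar {poly C}}) :
    'cV[C]_p :=
  \col_i \sum_k xi k (P i k).

Definition mass_row (D : spectral_data) (N : nat) (xi : masses)
    (P : 'M[{poly C}]_p) : 'M[C]_(p, N * p) :=
  \matrix_(i, c) let: (a, j, m) := jet_nth D c in
    mass_pair P (xi a j m) i ord0.

End MatrixPolynomials.

Section Biorthogonality.
Variables (R : realType) (p : nat).
Local Notation C := R[i].
Local Notation mxpoly := 'M[{poly C}]_p.

Definition gram (B : mxpoly -> mxpoly -> 'M[C]_p) (k l : nat) : 'M[C]_p :=
  B ('X^k)%:M ('X^l)%:M.

Definition truncation (G : nat -> nat -> 'M[C]_p) (k : nat) :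
    'M[C]_(\sum_(i < k) p) :=
  \mxblock_(i < k, j < k) G i j.

Definition quasidefinite (B : mxpoly -> mxpoly -> 'M[C]_p) : Prop :=
  forall k, (0 < k)%N -> \det (truncation (gram B) k) != 0.

Definition block_lower_unitriangular (S : nat -> nat -> 'M[C]_p) : Prop :=
  forall i, S i i = 1%:M /\ forall j, (i < j)%N -> S i j = 0.

(* G = S1^{-1} H S2^{-T}.  Inverses and products of block lower triangular
   (resp. upper triangular on the right) semi-infinite matrices commute with
   truncation, so the identity is stated truncation by truncation. *)
Definition gauss_borel (B : mxpoly -> mxpoly -> 'M[C]_p)
    (S1 : nat -> nat -> 'M[C]_p) (H : nat -> 'M[C]_p)
    (S2 : nat -> nat -> 'M[C]_p) : Prop :=
  [/\ block_lower_unitriangular S1, block_lower_unitriangular S2 &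
      forall k, truncation (gram B) k =
        invmx (truncation S1 k) *m (\mxdiag_(i < k) H i)
          *m (invmx (truncation S2 k))^T].

(* The n-th block of S chi(x). *)
Definition bipoly (S : nat -> nat -> 'M[C]_p) (n : nat) : mxpoly :=
  \sum_(k < n.+1) 'X^k *: map_mx polyC (S n k).

(* For every n, this is the kernel K_{n-1}(x, y), as a polynomial in x. *)
Definition cd_kernel_pred (S1 : nat -> nat -> 'M[C]_p) (H : nat -> 'M[C]_p)
    (S2 : nat -> nat -> 'M[C]_p) (n : nat) (y : C) : mxpoly :=
  \sum_(k < n) map_mx polyC ((mxev (bipoly S2 k) y)^T *m invmx (H k))
    *m bipoly S1 k.

End Biorthogonality.

Section GeneralizedKernel.
Variables (R : realType) (p : nat).
Local Notation C := R[i].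
Local Notation mxpoly := 'M[{poly C}]_p.
Local Notation kernel := ('I_p -> 'I_p -> plane_distribution R).
Implicit Types u : kernel.

Definition ksupp u : set (R * R) :=
  [set z | exists k l, dsupp (u k l) z].

Definition ksupp_x u : set R := [set z.1 | z in ksupp u].
Definition ksupp_y u : set R := [set z.2 | z in ksupp u].

Definition kform u (P Q : R -> 'M[C]_p) : 'M[C]_p :=
  \matrix_(i, j) \sum_k \sum_l
    dpair (u k l) (fun z => P z.1 i k * Q z.2 j l).

Definition pform u (P Q : mxpoly) : 'M[C]_p :=
  kform u (fun x => mxev P x%:C) (fun y => mxev Q y%:C).

(* The form of the transformed kernel. *)
Definition hat_form u (WC WG : mxpoly) (D : spectral_data R p)
    (xi : masses R p) (P Q : mxpoly) : 'M[C]_p :=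
  kform u (fun x => mxev (P *m WC) x%:C)
          (fun y => mxev Q y%:C *m (invmx (mxev WG y%:C))^T)
  + \sum_(a < sd_q D) \sum_(j < sd_s D a) \sum_(m < sd_kap D a j)
      mass_pair (P *m WC) (xi a j m)
        *m ((m`!)%:R^-1 *: mxderivn (sd_l D a j *m Q^T) m (sd_x D a)).

Definition second_kind u (P : mxpoly) (z : C) : 'M[C]_p :=
  kform u (fun x => mxev P x%:C) (fun y => ((z - y%:C)^-1)%:M).

(* For every n, this is the mixed kernel K^{(pc)}_{n-1}(x, y). *)
Definition mixed_kernel_pred u (S1 : nat -> nat -> 'M[C]_p)
    (H : nat -> 'M[C]_p) (S2 : nat -> nat -> 'M[C]_p) (n : nat) (x y : C) :
    'M[C]_p :=
  \sum_(k < n) (mxev (bipoly S2 k) y)^T *m invmx (H k)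
    *m second_kind u (bipoly S1 k) x.

End GeneralizedKernel.

Section Quasideterminants.
Variables (R : realType) (p : nat).
Local Notation C := R[i].

Definition last_quasidet m (A : 'M[C]_m) (B : 'M[C]_(m, p))
    (L : 'M[C]_(p, m)) (D : 'M[C]_p) : 'M[C]_p :=
  D - L *m invmx A *m B.

Lemma block_rowsE (NC NG : nat) :
  (\sum_(k < NG + NC) p = NC * p + NG * p)%N.
Proof. by rewrite sum_nat_const card_ord mulnDl addnC. Qed.

(* The NC + NG blocks B 0, B 1, ... stacked on top of each other. *)
Definition block_rows (NC NG q : nat) (B : nat -> 'M[C]_(p, q)) :
    'M[C]_(NC * p + NG * p, q) :=
  castmx (block_rowsE NC NG, erefl q) (\mxcol_(k < NG + NC) B k).

End Quasideterminants.

(* Main.v *)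
Require Import Defs.
From HB Require Import structures.
From mathcomp Require Import all_boot all_order all_algebra.
From mathcomp Require Import complex.
From mathcomp Require Import all_classical all_reals all_analysis.
From mathcomp Require Import ring lra zify perm.

Set Implicit Arguments.
Unset Strict Implicit.
Unset Printing Implicit Defensive.

Import Order.TTheory GRing.Theory Num.Theory.
Import numFieldNormedType.Exports.

Local Open Scope classical_set_scope.
Local Open Scope ring_scope.
Local Open Scope complex_scope.

(** Write <P, Q> for the form of u, <P, Q>^ for that of the transformed kernel, P_k, Q_k for the
    biorthogonal polynomials of u and P^_k, Q^_k for those of the transformed kernel. Everything
    rests on <P, Q W_G^T>^ = <P W_C, Q>: the factor W_G^T cancels the inverse of W_G, and it kills
    the masses because l W_G vanishes at each node to the order of the jets (hat_form_mulWG).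
    So <P^_n W_C, Q_k> = <P^_n, Q_k W_G^T>^ is 0 for k < n - N_G, and the expansion of P^_n W_C in
    the P_k only has terms with n - N_G <= k <= n + N_C. The top coefficient is the identity, and
    the bottom one times H_{n-N_G} is H^_n (connection_coef).

    The other N_G + N_C coefficients solve a linear system. Let J f be the block row
    [J_{C,f}, J_{G,C_f} - <f, xi> W], with C_f the second kind function of f and W the matrix of the
    l W_G r (jet_map); the rows of the matrix in the theorem are the J P_k. For every g,
    J (g W_C) = [0, - the jets of z -> <g, V_G(z, .)^T>^] (second_kind_jets). Indeed V_G is the
    difference quotient of W_G, so that I/(z - y) equals
    W_G(y)^{-1} W_G(z) / (z - y) - W_G(y)^{-1} V_G(z, y) and the second kind function of g W_C is the
    sum of three terms (second_kind_hat): a holomorphic function times W_G(z), whose jets are 0; a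
    combination of the masses, whose jets are <g W_C, xi> W because the Taylor coefficients of
    l V_G r are those of l W_G r shifted by one order (bezoutian_jet_spectral_W); and
    - <g, V_G(z, .)^T>^. The last term is a polynomial in z of degree less than N_G, whose
    coefficients are a unitriangular transform of the <g, y^k>^ with k < N_G; as only 0 is a
    multiple of W_G of such a degree, its jets vanish only if it does. Hence J (g W_C) = 0
    exactly when g is orthogonal to the y^k with k < N_G. This holds for g = P^_n when n >= N_G, and
    solving J (P^_n W_C) = 0 gives the first two quasideterminants.

    The matrix of the system is invertible. A row in its left kernel is a combination f of the P_k,
    n - N_G <= k < n + N_C, such that J f = 0. The vanishing of J_{C,f} gives f = g W_C, because the
    jets along the right root polynomials detect divisibility by W_C (left_divisible); then g has
    degree less than n and is orthogonal to the y^k with k < N_G, and also to the y^k W_G^T with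
    k < n - N_G, since f is orthogonal to y^k. These polynomials span those of degree less than n,
    so g = 0 (connection_combo_eq0).

    For the last formula the same system is solved with a right-hand side: by the reproducing
    properties of the two Christoffel-Darboux kernels, the difference of the transformed kernel
    times W_C and of W_G(y) times the original one has, as a polynomial in x, an expansion with
    n - N_G <= k < n + N_C, and its bottom coefficient times H_{n-N_G} is - Q^_n(y)^T
    (christoffel_P2).

    The analysis is used for two facts. A distribution vanishes on the test functions that vanish
    near its support (dapp_eq0), so it can be paired with functions that are smooth only there. And
    the pairing with 1/(z - y) is holomorphic in z away from the support: near the support this
    function agrees with a family of smooth functions whose derivatives are bounded uniformly in z,
    so the continuity of the distribution controls the remainder of the expansion in z to second
    order (has_cderiv_resolvent_power). *)

(** * Families of smooth functions with locally uniform bounds *)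

Section SmoothFamilies.
Variable R : realType.
Local Notation plane := (R * R)%type.

Definition cont_loc_bounded (I : Type) (F : I -> plane -> R) : Prop :=
  (forall i (z : plane), {for z, continuous (F i)}) /\
  forall r : R, exists B : R, forall i (z : plane), `|z| <= r -> `|F i z| <= B.

Definition pderiv (b : bool) (f : plane -> R) (z : plane) (d : R) : Prop :=
  is_derive z (direction R b) f d.

(** Bounds uniform in the index are carried along with differentiability, so
    that one induction on the way a family is built gives both the smoothness
    of its members and a common bound on their seminorms. *)
Inductive Cm (I : Type) : nat -> (I -> plane -> R) -> Prop :=
| Cm0I F : cont_loc_bounded F -> Cm 0 F
| CmSI m F (G : bool -> I -> plane -> R) : cont_loc_bounded F ->
    (forall b i (z : plane), pderiv b (F i) z (G b i z)) ->
    (forall b, Cm m (G b)) -> Cm m.+1 F.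

Definition smooth_family (I : Type) (F : I -> plane -> R) := forall m, Cm m F.

Lemma Cm_cont_loc_bounded m I (F : I -> plane -> R) : Cm m F -> cont_loc_bounded F.
Proof. by case. Qed.

Lemma CmS_inv m I (F : I -> plane -> R) : Cm m.+1 F ->
  exists2 G : bool -> I -> plane -> R,
    forall b i (z : plane), pderiv b (F i) z (G b i z) &
    forall b, Cm m (G b).
Proof. by move=> H; inversion_clear H; exists G. Qed.

Lemma CmW m I (F : I -> plane -> R) : Cm m.+1 F -> Cm m F.
Proof.
elim: m F => [|m IH] F sF; first exact: Cm0I (Cm_cont_loc_bounded sF).
have [G dG sG] := CmS_inv sF.
by apply: (CmSI (Cm_cont_loc_bounded sF) dG) => b; exact: IH.
Qed.

Lemma Cm_ext m I (F G : I -> plane -> R) :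
  (forall i z, F i z = G i z) -> Cm m F -> Cm m G.
Proof.
by move=> FG; have -> : G = F by apply/funext => i; apply/funext.
Qed.

Lemma Cm_cst m I (c : R) : Cm m (fun (_ : I) (_ : plane) => c).
Proof.
have lb (d : R) : cont_loc_bounded (fun (_ : I) (_ : plane) => d).
  by split=> [i z|r]; [exact: cst_continuous|exists `|d|].
elim: m c => [|m IH] c; first exact: Cm0I.
apply: (@CmSI _ _ _ (fun _ _ _ => 0)) => // b i z.
exact: is_derive_cst.
Qed.

(** The parameter z of a resolvent enters a family through constants of this
    kind. *)
Lemma Cm_indexed_cst m I (a : I -> R) : (exists B : R, forall i, `|a i| <= B) ->
  Cm m (fun i (_ : plane) => a i).
Proof.
move=> [B HB].
have lb : cont_loc_bounded (fun i (_ : plane) => a i).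
  by split=> [i z|r]; [exact: cst_continuous|exists B].
case: m => [|m]; first exact: Cm0I.
apply: (@CmSI _ _ _ (fun _ _ _ => 0)) => // [b i z|b]; last exact: Cm_cst.
exact: is_derive_cst.
Qed.

Lemma CmD m I (F G : I -> plane -> R) :
  Cm m F -> Cm m G -> Cm m (fun i z => F i z + G i z).
Proof.
have lb (F' G' : I -> plane -> R) : cont_loc_bounded F' -> cont_loc_bounded G' ->
    cont_loc_bounded (fun i z => F' i z + G' i z).
  move=> [cF bF] [cG bG]; split=> [i z|r].
    by apply: cvgD; [exact: cF|exact: cG].
  have [B HB] := bF r; have [C HC] := bG r.
  exists (B + C) => i z zr.
  by apply: (le_trans (ler_normD _ _)); rewrite lerD ?HB ?HC.
elim: m F G => [|m IH] F G sF sG.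
  by apply: Cm0I; apply: lb; [exact: Cm_cont_loc_bounded sF|exact: Cm_cont_loc_bounded sG].
have [F' dF sF'] := CmS_inv sF; have [G' dG sG'] := CmS_inv sG.
apply: (@CmSI _ _ _ (fun b i z => F' b i z + G' b i z)) => [|b i z|b].
- by apply: lb; [exact: Cm_cont_loc_bounded sF|exact: Cm_cont_loc_bounded sG].
- exact: (@is_deriveD R plane R _ _ _ _ _ _ (dF b i z) (dG b i z)).
- exact: IH.
Qed.

Lemma CmM m I (F G : I -> plane -> R) :
  Cm m F -> Cm m G -> Cm m (fun i z => F i z * G i z).
Proof.
have lb (F' G' : I -> plane -> R) : cont_loc_bounded F' -> cont_loc_bounded G' ->
    cont_loc_bounded (fun i z => F' i z * G' i z).
  move=> [cF bF] [cG bG]; split=> [i z|r].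
    by apply: cvgM; [exact: cF|exact: cG].
  have [B HB] := bF r; have [C HC] := bG r.
  exists (B * C) => i z zr.
  by rewrite normrM ler_pM ?HB ?HC.
elim: m F G => [|m IH] F G sF sG.
  by apply: Cm0I; apply: lb; [exact: Cm_cont_loc_bounded sF|exact: Cm_cont_loc_bounded sG].
have [F' dF sF'] := CmS_inv sF; have [G' dG sG'] := CmS_inv sG.
apply: (@CmSI _ _ _ (fun b i z => F i z * G' b i z + G i z * F' b i z))
  => [|b i z|b].
- by apply: lb; [exact: Cm_cont_loc_bounded sF|exact: Cm_cont_loc_bounded sG].
- exact: (@is_deriveM R plane (F i) (G i) _ _ _ _ (dF b i z) (dG b i z)).
- by apply: CmD; apply: IH => //; apply: CmW.
Qed.

Lemma CmN m I (F : I -> plane -> R) : Cm m F -> Cm m (fun i z => - F i z).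
Proof.
move=> sF; apply: (@Cm_ext _ _ (fun i z => -1 * F i z)) => [i z|].
  by rewrite mulN1r.
by apply: CmM => //; exact: Cm_cst.
Qed.

Lemma CmB m I (F G : I -> plane -> R) :
  Cm m F -> Cm m G -> Cm m (fun i z => F i z - G i z).
Proof. by move=> sF sG; apply: CmD => //; exact: CmN. Qed.

(** The lower bound c keeps the reciprocals bounded uniformly in the index,
    and through (1/F)' = - F'/F^2 all their derivatives as well. *)
Lemma CmV m I (F : I -> plane -> R) (c : R) : 0 < c ->
  (forall i z, c <= F i z) -> Cm m F -> Cm m (fun i z => (F i z)^-1).
Proof.
move=> c0 cF.
have F0 i z : F i z != 0 by rewrite gt_eqF// (lt_le_trans c0).
have lb : cont_loc_bounded F -> cont_loc_bounded (fun i z => (F i z)^-1).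
  move=> [contF _]; split=> [i z|r]; first by apply: cvgV => //; exact: contF.
  exists c^-1 => i z _; rewrite ger0_norm ?invr_ge0 ?(le_trans (ltW c0))//.
  by rewrite lef_pV2// posrE (lt_le_trans c0).
elim: m => [|m IH] sF; first exact: Cm0I (lb (Cm_cont_loc_bounded sF)).
have sF1 := CmW sF; have [G dG sG] := CmS_inv sF.
apply: (@CmSI _ _ _ (fun b i z => - ((F i z)^-1 * (F i z)^-1) * G b i z))
  => [|b i z|b].
- exact: lb (Cm_cont_loc_bounded sF).
- split; first by apply: derivableV => //; have [] := dG b i z.
  rewrite deriveV//; last by have [] := dG b i z.
  have [_ ->] := dG b i z.
  by rewrite /GRing.scale/= -exprVn expr2.
- by apply: CmM => //; apply: CmN; apply: CmM; apply: IH.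
Qed.

Lemma Cm_affine m I (f : plane -> R) (a : bool -> R) :
  (forall z, {for z, continuous f}) ->
  (forall h b z, f (h *: direction R b + z) = h * a b + f z) ->
  (forall r : R, exists B : R, forall z : plane, `|z| <= r -> `|f z| <= B) ->
  Cm m (fun _ : I => f).
Proof.
move=> cf af bf.
have lb : cont_loc_bounded (fun _ : I => f).
  by split=> // r; have [B HB] := bf r; exists B.
case: m => [|m]; first exact: Cm0I lb.
apply: (@CmSI _ _ _ (fun b _ _ => a b)) => // [b i z|b]; last exact: Cm_cst.
have E : (fun h : R => h^-1 *: ((f \o shift z) (h *: direction R b) - f z)) @ 0^' --> a b.
  apply: (@cvg_trans _ ((fun=> a b) @ 0^')); last exact: cvg_cst.
  apply: near_eq_cvg; near=> h.
  rewrite /= af addrK /GRing.scale/= mulKf//.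
  by near: h; exact: nbhs_dnbhs_neq.
split; first by apply/cvg_ex; exists (a b).
exact: cvg_lim E.
Unshelve. all: end_near. Qed.

Lemma Cm_fst m I : Cm m (fun (_ : I) (z : plane) => z.1).
Proof.
apply: (@Cm_affine m I _ (fun b => if b then 0 else 1)).
- by move=> z; exact: cvg_fst.
- by move=> h [] z; rewrite /= /GRing.scale/=.
- move=> r; exists r => z; apply: le_trans.
  by rewrite prod_normE le_max lexx.
Qed.

Lemma Cm_snd m I : Cm m (fun (_ : I) (z : plane) => z.2).
Proof.
apply: (@Cm_affine m I _ (fun b => if b then 1 else 0)).
- by move=> z; exact: cvg_snd.
- by move=> h [] z; rewrite /= /GRing.scale/=.
- move=> r; exists r => z; apply: le_trans.
  by rewrite prod_normE le_max lexx orbT.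
Qed.

Lemma Cm_rpartial m I (F : I -> plane -> R) s : Cm (m + size s) F ->
  exists2 G : I -> plane -> R, forall i, rpartial s (F i) = G i & Cm m G.
Proof.
elim: s m => [|b s IH] m /=; first by rewrite addn0; exists F.
rewrite -addSnnS => /IH [G E] /CmS_inv[G' dG sG].
exists (G' b) => // i; apply/funext => z; rewrite E.
by have [] := dG b i z.
Qed.

Lemma smooth_family_rsmooth I (F : I -> plane -> R) i : smooth_family F -> rsmooth (F i).
Proof.
move=> sF s z; have [G -> sG] := Cm_rpartial (sF (1 + size s)%N).
have [cG _] := Cm_cont_loc_bounded sG; have [G' dG _] := CmS_inv sG.
by split=> [|b]; [exact: cG|have [] := dG b i z].
Qed.

Lemma compact_square (r : R) : compact [set z : plane | `|z| <= r].
Proof.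
have -> : [set z : plane | `|z| <= r] = `[-r, r]%classic `*` `[-r, r]%classic.
  apply/seteqP; split=> -[x y] /=; rewrite prod_normE/= !in_itv/= -!ler_norml.
    by rewrite ge_max => /andP[].
  by case=> ? ?; rewrite ge_max; apply/andP.
by apply: compact_setX; exact: segment_compact.
Qed.

Lemma continuous_loc_bounded I (f : plane -> R) :
  (forall z : plane, {for z, continuous f}) -> cont_loc_bounded (fun _ : I => f).
Proof.
move=> cf; split=> // r.
have : compact (f @` [set z : plane | `|z| <= r]).
  apply: continuous_compact; last exact: compact_square.
  by apply: continuous_subspaceT.
move=> /compact_bounded [M [_ HM]].
exists (M + 1) => i z zr; apply: HM; first by rewrite ltrDl.
by exists z.
Qed.

Lemma rsmooth_partial (f : plane -> R) b :
  rsmooth f -> rsmooth (fun z => 'D_(direction R b) f z).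
Proof.
move=> sf s z.
have -> : rpartial s (fun z => 'D_(direction R b) f z) = rpartial (rcons s b) f.
  by rewrite /rpartial foldr_rcons.
exact: sf.
Qed.

Lemma rsmooth_smooth_family I (f : plane -> R) : rsmooth f ->
  smooth_family (fun _ : I => f).
Proof.
move=> sf m; elim: m f sf => [|m IH] f sf;
  have lf : cont_loc_bounded (fun _ : I => f) by
    (apply: continuous_loc_bounded => z; have [] := sf [::] z).
  exact: Cm0I lf.
apply: (@CmSI _ _ _ (fun b _ => fun z => 'D_(direction R b) f z)) => // [b i z|b].
  by split=> //; have [_] := sf [::] z; apply.
by apply: IH; exact: rsmooth_partial.
Qed.

End SmoothFamilies.

(** * Flat functions and smooth cutoffs *)

Section FlatFunction.
Variable R : realType.
Local Notation plane := (R * R)%type.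

(** The functions t^-k exp(-1/t), extended by 0, span a space that is stable
    under differentiation and contains exp(-1/t). *)
Definition flat (k : nat) (t : R) : R :=
  if 0 < t then t^-1 ^+ k * expR (- t^-1) else 0.

Lemma flat_ge0 k t : 0 <= flat k t.
Proof.
rewrite /flat; case: ifP => // t0.
by rewrite mulr_ge0 ?expR_ge0 ?exprn_ge0 ?invr_ge0 ?ltW.
Qed.

(** This is s^k / k! <= exp s at s = 1/t. *)
Lemma flat_le k t : flat k t <= k`!%:R.
Proof.
rewrite /flat; case: ifP => // t0; have s0 : 0 <= t^-1 by rewrite invr_ge0 ltW.
rewrite expRN ler_pdivrMr ?expR_gt0//.
case: k => [|k]; first by rewrite expr0 mul1r -expR0 ler_expR.
have := expR_ge1Dxn k s0; move=> H.
have : t^-1 ^+ k.+1 / k.+1`!%:R <= expR t^-1 by apply: le_trans H; rewrite lerDr.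
by rewrite ler_pdivrMr ?ltr0n ?fact_gt0// mulrC.
Qed.

Lemma flat_le0 k t : t <= 0 -> flat k t = 0.
Proof. by rewrite /flat leNgt => /negbTE ->. Qed.

Lemma flatS k t : flat k t = t * flat k.+1 t.
Proof.
rewrite /flat; case: ifP => [t0|]; last by rewrite mulr0.
by rewrite exprS !mulrA mulfV ?gt_eqF// mul1r.
Qed.

(** Raising k twice frees a factor t^2, which gives the derivative 0 at the
    origin. *)
Lemma flat_small k t : `|flat k t| <= `|t| ^+ 2 * (k.+2)`!%:R.
Proof.
rewrite flatS flatS mulrA normrM -normrX expr2 ler_wpM2l//.
by rewrite ger0_norm ?flat_ge0 ?flat_le.
Qed.

Lemma is_derive_flat k (t : R) :
  is_derive t (1 : R) (flat k) (flat k.+2 t - k%:R * flat k.+1 t).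
Proof.
have [t0|t0|->] := ltgtP t 0.
- rewrite !flat_le0 ?ltW// mulr0 subr0.
  apply: (@near_eq_is_derive _ _ _ (cst 0)).
  near=> s; rewrite /cst flat_le0//; apply: ltW; near: s.
  exact: lt_nbhsl.
- apply: (@near_eq_is_derive _ _ _ ((fun s : R => s^-1 ^+ k * expR (- s^-1)))).
  + near=> s; rewrite /flat ifT//; near: s.
    exact: lt_nbhsr.
  + have dV : is_derive t (1 : R) (fun s : R => s^-1) (- t ^- 2).
      have := @is_deriveV R id t 1 1; rewrite gt_eqF//= => /(_ isT (is_derive_id _ _)).
      by rewrite scaler1.
    have dN : is_derive t (1 : R) (fun s : R => - s^-1) (t ^- 2).
      by have := is_deriveN dV; rewrite opprK.
    have dE : is_derive t (1 : R) (fun s : R => expR (- s^-1)) (t ^- 2 * expR (- t^-1)).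
      by have := @is_derive1_comp R expR (fun s => - s^-1) t _ _ (is_derive_expR _) dN;
        rewrite mulrC.
    have dX : is_derive t (1 : R) (fun s : R => s^-1 ^+ k) ((k%:R * t^-1 ^+ k.-1) *: - t ^- 2).
      by have := @is_deriveX R R (fun s => s^-1) k t 1 _ dV; rewrite exprfctE.
    have := is_deriveM dX dE.
    suff -> : t^-1 ^+ k *: (t ^- 2 * expR (- t^-1)) +
       expR (- t^-1) *: ((k%:R * t^-1 ^+ k.-1) *: - t ^- 2) =
       flat k.+2 t - k%:R * flat k.+1 t by [].
    rewrite /flat t0 /GRing.scale/= -exprVn; set s := t^-1; set e := expR _.
    by clear dX; case: k => [|k]; rewrite /= ?exprS ?expr0; ring.
- rewrite !flat_le0// mulr0 subr0.
  have E : (fun h : R => h^-1 *: ((flat k \o shift 0) (h *: 1) - flat k 0)) @ 0^' --> (0 : R).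
    apply/cvgrPdist_le => e e0.
    near=> h.
    rewrite sub0r normrN /= addr0 [h *: 1]mulr1 (flat_le0 k (lexx 0)) subr0.
    rewrite /GRing.scale/= normrM normfV.
    have h0 : h != 0 by near: h; exact: nbhs_dnbhs_neq.
    have := flat_small k h; rewrite expr2 -mulrA => H.
    rewrite ler_pdivrMl ?normr_gt0//; apply: (le_trans H).
    rewrite ler_wpM2l//.
    have F0 : 0 < (k.+2)`!%:R :> R by rewrite ltr0n fact_gt0.
    rewrite -ler_pdivlMr//.
    near: h.
    apply: dnbhs0_le; by rewrite divr_gt0.
  by split; [apply/cvg_ex; exists 0|exact: cvg_lim E].
Unshelve. all: end_near. Qed.

Definition plane_coord (b : bool) (z : plane) : R := if b then z.2 else z.1.

Lemma Cm_coord b m I : Cm m (fun (_ : I) => plane_coord b).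
Proof. by case: b; [exact: Cm_snd|exact: Cm_fst]. Qed.

Lemma plane_coord_shift b' b h (z : plane) :
  plane_coord b' (h *: direction R b + z) = h * (b' == b)%:R + plane_coord b' z.
Proof. by case: b; case: b'; rewrite /= /GRing.scale/=. Qed.

Lemma pderiv_line b (f : plane -> R) z d :
  is_derive (0 : R) (1 : R) (fun h : R => f (h *: direction R b + z)) d ->
  pderiv b f z d.
Proof.
move=> [D1 D2]; split; first exact: ((derivable1P _ _ _).2 D1).
rewrite -D2 /derive; set g1 := fun h => h^-1 *: _; set g2 := fun h => h^-1 *: _.
suff -> : g1 = g2 by [].
by apply/funext => h; rewrite /g1 /g2 /= addr0 scale0r add0r [_%:A]mulr1.
Qed.

Lemma Cm_flat_affine m I k b a c :
  Cm m (fun (_ : I) (z : plane) => flat k (a * plane_coord b z + c)).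
Proof.
have lb k' : cont_loc_bounded (fun (_ : I) (z : plane) => flat k' (a * plane_coord b z + c)).
  apply: continuous_loc_bounded => z;
    apply: (@continuous_comp _ _ _ (fun z => a * plane_coord b z + c)).
    apply: cvgD; last exact: cvg_cst.
    apply: cvgM; first exact: cvg_cst.
    by have [] := Cm_cont_loc_bounded (Cm_coord b 0 unit) => /(_ tt z).
  by have [H _] := is_derive_flat k' (a * plane_coord b z + c);
    apply/differentiable_continuous/derivable1_diffP.
elim: m k => [|m IH] k; first exact: Cm0I.
apply: (@CmSI _ _ _ _ (fun b' _ z => (a * (b == b')%:R) *
   (flat k.+2 (a * plane_coord b z + c) - k%:R * flat k.+1 (a * plane_coord b z + c)))) => //
  [b' i z|b'].
  apply: pderiv_line.
  have dl : is_derive (0 : R) (1 : R) (fun h : R => a * plane_coord b (h *: direction R b' + z) +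
    c)
      (a * (b == b')%:R).
    have -> : (fun h : R => a * plane_coord b (h *: direction R b' + z) + c) =
       (fun h => (a * (b == b')%:R) *: id h + (a * plane_coord b z + c)).
      by apply/funext => h; rewrite plane_coord_shift /GRing.scale/=; ring.
    have := @is_deriveD _ _ _ _ (cst (a * plane_coord b z + c)) (0:R) 1 _ _ (@is_deriveZ R R R id
      (a * (b == b')%:R) 0 1 1 (is_derive_id _ _)) (is_derive_cst _ _ _).
    by rewrite addr0 /GRing.scale/= mulr1.
  have := @is_derive1_comp R (flat k) _ 0 _ _ (is_derive_flat k _) dl.
  rewrite scale0r add0r /= mulrC => H.
  exact: H.
apply: CmM; first exact: Cm_cst.
by apply: CmB => //; apply: CmM => //; exact: Cm_cst.
Qed.

Definition smooth_step (t : R) : R := flat 0 t / (flat 0 t + flat 0 (1 - t)).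

(** Either t or 1 - t is at least 1/2, and on this half-line exp(-1/t) is at
    least exp(-2). *)
Lemma smooth_step_denom t : expR (- 2) <= flat 0 t + flat 0 (1 - t).
Proof.
have key s : 2^-1 <= s -> expR (- 2) <= flat 0 s.
  move=> s2; have s0 : 0 < s by apply: lt_le_trans s2; rewrite invr_gt0.
  rewrite /flat s0 expr0 mul1r ler_expR lerN2 -[leRHS]invrK lef_pV2// posrE.
  by rewrite invr_gt0.
have [t2|t2] := leP 2^-1 t.
  by rewrite -[leLHS]addr0 lerD ?flat_ge0// key.
rewrite -[leLHS]add0r lerD ?flat_ge0// key//.
lra.
Qed.

Lemma smooth_step_le0 t : t <= 0 -> smooth_step t = 0.
Proof. by move=> t0; rewrite /smooth_step flat_le0// mul0r. Qed.

Lemma smooth_step_ge1 t : 1 <= t -> smooth_step t = 1.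
Proof.
move=> t1; rewrite /smooth_step [flat 0 (1 - t)]flat_le0 ?subr_le0// addr0 divff//.
have := smooth_step_denom t; rewrite [flat 0 (1 - t)]flat_le0 ?subr_le0// addr0.
by move=> /(lt_le_trans (expR_gt0 _)) /gt_eqF ->.
Qed.

Lemma smooth_step_ge0 t : 0 <= smooth_step t.
Proof. by rewrite divr_ge0 ?addr_ge0 ?flat_ge0. Qed.

Lemma Cm_smooth_step_affine m I b a c :
  Cm m (fun (_ : I) (z : plane) => smooth_step (a * plane_coord b z + c)).
Proof.
apply: CmM; first exact: Cm_flat_affine.
apply: (@CmV R m I (fun _ z => flat 0 (a * plane_coord b z + c) + flat 0 (1 - (a * plane_coord b
  z + c)))
  (expR (- 2)) (expR_gt0 _)).
  by move=> i z; exact: smooth_step_denom.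
apply: CmD; first exact: Cm_flat_affine.
apply: (@Cm_ext _ _ _ (fun _ z => flat 0 ((- a) * plane_coord b z + (1 - c)))).
  by move=> i z; congr flat; ring.
exact: Cm_flat_affine.
Qed.

Definition plateau (b : bool) (c rho : R) (z : plane) : R :=
  smooth_step (- rho^-1 * plane_coord b z + (2 + c / rho)) *
  smooth_step (rho^-1 * plane_coord b z + (2 - c / rho)).

Lemma Cm_plateau m I b c rho : Cm m (fun _ : I => plateau b c rho).
Proof. by apply: CmM; exact: Cm_smooth_step_affine. Qed.

Lemma plateau_ge0 b c rho z : 0 <= plateau b c rho z.
Proof. by rewrite mulr_ge0 ?smooth_step_ge0. Qed.

Lemma plateau1 b c rho z : 0 < rho -> `|plane_coord b z - c| <= rho ->
  plateau b c rho z = 1.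
Proof.
move=> r0; rewrite ler_norml => /andP[H1 H2].
have E : rho^-1 * (plane_coord b z - c) <= 1 by rewrite ler_pdivrMl// mulr1.
have E' : - 1 <= rho^-1 * (plane_coord b z - c) by rewrite ler_pdivlMl// mulrN1.
by rewrite /plateau !smooth_step_ge1 ?mulr1//; rewrite mulrBr [rho^-1 * c]mulrC in E E'; lra.
Qed.

Lemma plateau0 b c rho z : 0 < rho -> 2 * rho <= `|plane_coord b z - c| ->
  plateau b c rho z = 0.
Proof.
move=> r0; rewrite ler_normr => /orP[] H; rewrite /plateau.
  rewrite smooth_step_le0 ?mul0r//.
  have : 2 <= rho^-1 * (plane_coord b z - c) by rewrite ler_pdivlMl// mulrC.
  by rewrite mulrBr [rho^-1 * c]mulrC; lra.
rewrite mulrC smooth_step_le0 ?mul0r//.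
have : 2 <= rho^-1 * - (plane_coord b z - c) by rewrite ler_pdivlMl// mulrC.
by rewrite mulrN mulrBr [rho^-1 * c]mulrC; lra.
Qed.

Definition cutoff (c : plane) (rho : R) (z : plane) : R :=
  plateau false c.1 rho z * plateau true c.2 rho z.

Lemma Cm_cutoff m I c rho : Cm m (fun _ : I => cutoff c rho).
Proof. by apply: CmM; exact: Cm_plateau. Qed.

Lemma cutoff1 c rho (z : plane) : 0 < rho -> `|z - c| <= rho -> cutoff c rho z = 1.
Proof.
move=> r0; rewrite prod_normE ge_max/= => /andP[H1 H2].
by rewrite /cutoff !plateau1 ?mulr1.
Qed.

Lemma cutoff0 c rho (z : plane) : 0 < rho -> 2 * rho <= `|z - c| -> cutoff c rho z = 0.
Proof.
move=> r0; rewrite prod_normE le_max/= => /orP[] H.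
  by rewrite /cutoff plateau0 ?mul0r.
by rewrite /cutoff [X in _ * X]plateau0 ?mulr0.
Qed.

End FlatFunction.

(** * Complex families and test functions *)

Section ComplexFamilies.
Variable R : realType.
Local Notation C := R[i].
Local Notation plane := (R * R)%type.

Definition csmooth_family (I : Type) (F : I -> plane -> C) : Prop :=
  smooth_family (fun i z => complex.Re (F i z)) /\
  smooth_family (fun i z => complex.Im (F i z)).

Lemma csmooth_family_ext I (F G : I -> plane -> C) :
  (forall i z, F i z = G i z) -> csmooth_family F -> csmooth_family G.
Proof.
by move=> FG; have -> : G = F by apply/funext => i; apply/funext.
Qed.

Lemma csmooth_family_cst I (c : C) : csmooth_family (fun (_ : I) (_ : plane) => c).
Proof. by split=> m; exact: Cm_cst. Qed.

Lemma csmooth_family_real I (F : I -> plane -> R) : smooth_family F ->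
  csmooth_family (fun i z => (F i z)%:C).
Proof. by move=> sF; split=> m; [exact: (sF m)|exact: Cm_cst]. Qed.

Lemma csmooth_familyD I (F G : I -> plane -> C) :
  csmooth_family F -> csmooth_family G -> csmooth_family (fun i z => F i z + G i z).
Proof.
move=> [F1 F2] [G1 G2]; split=> m.
  by apply: Cm_ext (CmD (F1 m) (G1 m)) => i z; case: (F i z); case: (G i z).
by apply: Cm_ext (CmD (F2 m) (G2 m)) => i z; case: (F i z); case: (G i z).
Qed.

Lemma csmooth_familyM I (F G : I -> plane -> C) :
  csmooth_family F -> csmooth_family G -> csmooth_family (fun i z => F i z * G i z).
Proof.
move=> [F1 F2] [G1 G2]; split=> m.
  apply: Cm_ext (CmB (CmM (F1 m) (G1 m)) (CmM (F2 m) (G2 m))) => i z.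
  by case: (F i z); case: (G i z).
apply: Cm_ext (CmD (CmM (F1 m) (G2 m)) (CmM (F2 m) (G1 m))) => i z.
by case: (F i z); case: (G i z) => a b c d /=.
Qed.

Lemma csmooth_family_csmooth I (F : I -> plane -> C) i : csmooth_family F ->
  csmooth (F i).
Proof.
case=> F1 F2; split; first exact: (smooth_family_rsmooth i F1).
exact: (smooth_family_rsmooth i F2).
Qed.

Lemma csmooth_csmooth_family I (f : plane -> C) : csmooth f ->
  csmooth_family (fun _ : I => f).
Proof. by case=> f1 f2; split; exact: rsmooth_smooth_family. Qed.

Lemma csmoothM (f g : plane -> C) :
  csmooth f -> csmooth g -> csmooth (fun z => f z * g z).
Proof.
move=> sf sg.
exact: (csmooth_family_csmooth tt (csmooth_familyM (csmooth_csmooth_family unit sf)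
  (csmooth_csmooth_family unit sg))).
Qed.

Lemma csmoothD (f g : plane -> C) :
  csmooth f -> csmooth g -> csmooth (fun z => f z + g z).
Proof.
move=> sf sg.
exact: (csmooth_family_csmooth tt (csmooth_familyD (csmooth_csmooth_family unit sf)
  (csmooth_csmooth_family unit sg))).
Qed.

Lemma csmooth_cst (c : C) : csmooth (fun _ : plane => c).
Proof. exact: (csmooth_family_csmooth tt (csmooth_family_cst unit c)). Qed.

Lemma csmooth_cutoff (c : plane) (rho : R) : csmooth (fun z => (cutoff c rho z)%:C : C).
Proof.
exact: (csmooth_family_csmooth tt (@csmooth_family_real unit (fun _ => cutoff c rho)
  (fun m => Cm_cutoff m unit c rho))).
Qed.

Lemma csmooth_coord b : csmooth (fun z : plane => (plane_coord b z)%:C : C).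
Proof.
have sc : csmooth_family (fun (_ : unit) z => (plane_coord b z)%:C : C).
  by apply: csmooth_family_real => m; exact: Cm_coord.
exact: (csmooth_family_csmooth tt sc).
Qed.

Lemma csmooth_poly (q : {poly C}) b : csmooth (fun z : plane => q.[(plane_coord b z)%:C]).
Proof.
elim/poly_ind: q => [|q c IH].
  have -> : (fun z : plane => (0 : {poly C}).[(plane_coord b z)%:C]) = fun=> 0.
    by apply/funext => z; rewrite horner0.
  exact: csmooth_cst.
have -> : (fun z : plane => (q * 'X + c%:P).[(plane_coord b z)%:C]) =
    fun z => q.[(plane_coord b z)%:C] * (plane_coord b z)%:C + c.
  by apply/funext => z; rewrite hornerMXaddC.
apply: csmoothD; last exact: csmooth_cst.
exact: csmoothM IH (csmooth_coord b).
Qed.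

Lemma csmooth_neq0_open (f : plane -> C) : csmooth f -> open [set z : plane | f z != 0].
Proof.
move=> [sR sI].
have cR := (sR [::] _).1; have cI := (sI [::] _).1.
have -> : [set z : plane | f z != 0] =
    (fun z => complex.Re (f z) ^+ 2 + complex.Im (f z) ^+ 2) @^-1` [set x | x != 0].
  apply/seteqP; split=> z /=; case: (f z) => a b /=; rewrite eq_complex /=.
    by rewrite paddr_eq0 ?sqr_ge0// !sqrf_eq0.
  by rewrite paddr_eq0 ?sqr_ge0// !sqrf_eq0.
apply: open_comp => [z _|].
  by apply: cvgD; apply: cvgM; (try exact: cR); exact: cI.
exact: open_neq.
Qed.

Lemma test_functionD (f g : plane -> C) :
  test_function f -> test_function g -> test_function (fun z => f z + g z).
Proof.
move=> [sf [r fr]] [sg [r' gr]]; split; first exact: csmoothD.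
exists (Num.max r r') => z; rewrite gt_max => /andP[z1 z2].
by rewrite fr ?gr ?addr0.
Qed.

Lemma test_functionMl (f g : plane -> C) :
  csmooth f -> test_function g -> test_function (fun z => f z * g z).
Proof.
move=> sf [sg [r gr]]; split; first exact: csmoothM.
by exists r => z zr; rewrite gr ?mulr0.
Qed.

Lemma test_function0 : test_function (fun _ : plane => 0 : C).
Proof. by split; [exact: csmooth_cst|exists 0]. Qed.

Lemma test_functionZ (c : C) (f : plane -> C) :
  test_function f -> test_function (fun z => c * f z).
Proof. by apply: test_functionMl; exact: csmooth_cst. Qed.

Lemma Cm_partials_bound m I (F : I -> plane -> R) (r : R) : Cm m F ->
  exists B : R, forall i (z : plane) s, `|z| <= r -> (size s <= m)%N ->
    `|rpartial s (F i) z| <= B.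
Proof.
elim: m F => [|m IH] F sF; have [_ /(_ r) [B HB]] := Cm_cont_loc_bounded sF.
  by exists B => i z [|//] zr _; exact: HB.
have [G dG sG] := CmS_inv sF.
have [B1 H1] := IH _ (sG true); have [B2 H2] := IH _ (sG false).
exists (Num.max B (Num.max B1 B2)) => i z s zr.
case/lastP: s => [_|s b]; first by rewrite le_max HB.
rewrite size_rcons ltnS => ss.
have -> : rpartial (rcons s b) (F i) = rpartial s (G b i).
  rewrite /rpartial foldr_rcons; congr foldr; apply/funext => t.
  by have [_ ->] := dG b i t.
by case: b; rewrite !le_max ?H1 ?H2 ?orbT.
Qed.

Lemma rpartial_vanish (f : plane -> R) (r : R) s :
  (forall z : plane, r < `|z| -> f z = 0) ->
  forall z : plane, r < `|z| -> rpartial s f z = 0.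
Proof.
move=> fr; elim: s => [|b s IH] z zr /=; first exact: fr.
have -> : 'D_(direction R b) (rpartial s f) z = 'D_(direction R b) (cst 0) z.
  apply: near_eq_derive; near=> t; rewrite /cst IH//.
  near: t.
  have cn : {for z, continuous (fun t : plane => `|t|)} by apply: norm_continuous.
  exact: (cn _ (lt_nbhsr zr)).
by rewrite derive_cst.
Unshelve. all: end_near. Qed.

Lemma normc_le (x : C) : Normc.normc x <= `|complex.Re x| + `|complex.Im x|.
Proof.
case: x => a b /=.
rewrite -(ler_pXn2r (ltn0Sn 1)) ?nnegrE ?sqrtr_ge0 ?addr_ge0//.
rewrite sqr_sqrtr ?addr_ge0 ?sqr_ge0// sqrrD !real_normK ?num_real//.
by rewrite -addrA lerD2l lerDr mulrn_wge0 ?mulr_ge0.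
Qed.

(** Outside the ball where its members may be nonzero a family has zero
    derivatives, so the bounds on that ball are bounds on the whole plane,
    which is the form in which the continuity of a distribution is stated. *)
Lemma csmooth_family_partials_bound (m : nat) I (F : I -> plane -> C) (r : R) :
  csmooth_family F ->
  (forall i, vanishes_beyond r (F i)) ->
  exists B : R, forall i s z, (size s <= m)%N ->
    Normc.normc (cpartial s (F i) z) <= B.
Proof.
move=> [F1 F2] Fr.
have [B1 H1] := Cm_partials_bound r (F1 m).
have [B2 H2] := Cm_partials_bound r (F2 m).
exists (Num.max 0 (B1 + B2)) => i s z Cm.
apply: (le_trans (normc_le _)); rewrite /cpartial /=.
have [zr|zr] := leP `|z| r; first by rewrite le_max lerD ?orbT ?H1 ?H2.
rewrite !(rpartial_vanish s _ zr) ?normr0 ?addr0 ?le_max ?lexx//.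
  by move=> t tr; rewrite Fr.
by move=> t tr; rewrite Fr.
Qed.

End ComplexFamilies.

(** * Pairing a distribution with functions smooth near its support *)

Section Localization.
Variable R : realType.
Local Notation C := R[i].
Local Notation plane := (R * R)%type.
Variable w : plane_distribution R.

Lemma dapp0 : w (fun _ => 0) = 0.
Proof.
have := Defs.dlin w (-1) (@test_function0 R) (@test_function0 R).
by rewrite !mulN1r !addNr.
Qed.

Lemma dappD f g : test_function f -> test_function g ->
  w (fun z => f z + g z) = w f + w g.
Proof.
move=> tf tg; have := Defs.dlin w 1 tf tg; rewrite mul1r => <-.
by congr (w _); apply/funext => z; rewrite mul1r.
Qed.

Lemma dappZ c f : test_function f -> w (fun z => c * f z) = c * w f.
Proof.
move=> tf; have := Defs.dlin w c tf (@test_function0 R); rewrite dapp0 addr0 => <-.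
by congr (w _); apply/funext => z; rewrite addr0.
Qed.

(** The radius is 2 rho because the cutoff that is 1 on the ball of radius rho
    has its support in the ball of radius 2 rho. *)
Lemma dsupp_local (t : plane) : ~ dsupp w t ->
  exists2 rho : R, 0 < rho & forall phi, test_function phi ->
    (forall z : plane, phi z != 0 -> `|z - t| <= 2 * rho) -> w phi = 0.
Proof.
move=> /contrapT [V [oV Vt HV]].
have /nbhs_normP [e /= e0 He] : nbhs t V by exact: open_nbhs_nbhs.
exists (e / 4); first by rewrite divr_gt0.
move=> phi tphi Hphi; apply: HV => //.
have e2 : 0 < e / 2 by rewrite divr_gt0.
apply: (@subset_trans _ (closed_ball t (e / 2))).
  have /closure_id -> : closed (closed_ball t (e / 2)) by exact: closed_ball_closed.
  apply: closureS => z /= /Hphi zt.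
  rewrite closed_ballE// /closed_ball_ /= distrC (le_trans zt)//; lra.
rewrite closed_ballE// => z /= zt; apply: He => /=.
by rewrite (le_lt_trans zt)// ltr_pdivrMr// ltr_pMr// ltr1n.
Qed.

(** The points outside U where phi may be nonzero form a compact set disjoint
    from the support of w, which is thus covered by finitely many balls on
    which w vanishes. Splitting off the product of phi with the cutoff of one
    ball after the other exhausts phi. *)
Lemma dapp_eq0 phi (U : set plane) : test_function phi -> open U ->
  dsupp w `<=` U -> (forall z, U z -> phi z = 0) -> w phi = 0.
Proof.
move=> tphi oU wU phi0.
have [sphi [r phir]] := tphi.
have loc (t : plane) : exists rho : R, 0 < rho /\ (~ U t -> forall psi, test_function psi ->
    (forall z : plane, psi z != 0 -> `|z - t| <= 2 * rho) -> w psi = 0).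
  have [Ut|Ut] := pselect (U t); first by exists 1.
  have [rho r0 H] : exists2 rho : R, 0 < rho & forall psi, test_function psi ->
    (forall z : plane, psi z != 0 -> `|z - t| <= 2 * rho) -> w psi = 0.
    by apply: dsupp_local => /wU.
  by exists rho.
have [rho Hrho] := choice loc.
(* w vanishes on cutoff * psi, and (1 - cutoff) * psi is nonzero only inside
   the remaining balls. *)
have fin (L : seq plane) psi : test_function psi ->
    (forall t, t \in L -> ~ U t) ->
    (forall z, psi z != 0 -> exists2 t, t \in L & `|z - t| < rho t) -> w psi = 0.
  elim: L psi => [|t L IH] psi tpsi LU cov.
    have -> : psi = fun _ => 0; last exact: dapp0.
    by apply/funext => z; apply/eqP; apply/negPn/negP => /cov [].
  have [r0 Ht] := Hrho t.
  have sc : csmooth (fun z => (cutoff t (rho t) z)%:C : C) by exact: csmooth_cutoff.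
  have sc' : csmooth (fun z => 1 + (-1) * (cutoff t (rho t) z)%:C : C).
    apply: csmoothD; first exact: csmooth_cst.
    exact: csmoothM (csmooth_cst _) sc.
  have -> : psi = fun z => (cutoff t (rho t) z)%:C * psi z +
      (1 + (-1) * (cutoff t (rho t) z)%:C) * psi z.
    by apply/funext => z; rewrite -mulrDl addrCA mulN1r subrr addr0 mul1r.
  rewrite dappD; [|exact: test_functionMl|exact: test_functionMl].
  rewrite [X in X + _]Ht ?add0r; first 1 last.
  - by apply: LU; rewrite mem_head.
  - exact: test_functionMl.
  - move=> z; apply: contraNT; rewrite -ltNge => zt.
    by rewrite cutoff0 ?mul0r ?ltW.
  apply: IH => [|t' t'L|z].
  - exact: test_functionMl.
  - by apply: LU; rewrite inE t'L orbT.
  - rewrite mulf_eq0 negb_or => /andP[c1 /cov [t']].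
    rewrite inE => /orP[/eqP->|t'L zt']; last by exists t'.
    move=> zt; case/negP: c1.
    by rewrite cutoff1 ?ltW// mulN1r subrr.
have cK : compact ([set z : plane | `|z| <= r] `&` ~` U).
  apply: compact_closedI; first exact: compact_square.
  exact: open_closedC.
(* For this filter, generated by the lists that contain a given one,
   compactness in terms of filters yields a finite subcover. *)
pose F : set_system (seq plane) :=
  [set A : set (seq plane) | exists L0 : seq plane, forall L : seq plane,
     {subset L0 <= L} -> A L].
have FF : Filter F.
  split=> [|A B [LA HA] [LB HB]|A B AB [LA HA]].
  - by exists [::].
  - exists (LA ++ LB) => L LL; split.
      by apply: HA => x xL; apply: LL; rewrite mem_cat xL.
    by apply: HB => x xL; apply: LL; rewrite mem_cat xL orbT.
  - by exists LA => L LL; apply: AB; exact: HA.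
pose P (L : seq plane) (z : plane) :=
  exists t, [/\ t \in L, ~ U t & `|z - t| < rho t].
have [] := (compact_near_coveringP _).1 cK _ F P FF.
  move=> t [_ Ut]; have [r0 _] := Hrho t.
  exists (ball t (rho t), [set L : seq plane | t \in L]).
    split; first exact: nbhsx_ballx.
    by exists [:: t] => L; apply; rewrite mem_head.
  move=> [z L] /= [zt tL]; exists t; split=> //.
  by move: zt; rewrite -ball_normE /= distrC.
move=> L0 /(_ L0 (fun _ x => x)) cov.
apply: (fin [seq t <- L0 | `[< ~ U t >]]) => // [t|z phiz].
  by rewrite mem_filter => /andP[/asboolP].
have [|t [tL Ut zt]] := cov z.
  split=> /=; first by rewrite leNgt; apply/negP => /phir/eqP; rewrite (negbTE phiz).
  by move=> /phi0/eqP; rewrite (negbTE phiz).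
by exists t => //; rewrite mem_filter tL andbT; apply/asboolP.
Qed.

(** The domain of the pairing, which has a default value elsewhere. *)
Definition near_smooth (f : plane -> C) : Prop := exists phi U,
  [/\ test_function phi, open U, dsupp w `<=` U & forall z, U z -> phi z = f z].

(** Two test functions that agree with f near the support differ by one that
    vanishes there, so they have the same image under w. *)
Lemma dpairE phi U f : test_function phi -> open U -> dsupp w `<=` U ->
  (forall z, U z -> phi z = f z) -> Defs.dpair w f = w phi.
Proof.
move=> tphi oU wU phif; apply: xget_unique; first by exists phi, U.
move=> v [psi [V [tpsi oV wV psif ->]]].
have : w (fun z => psi z + (-1) * phi z) = 0.
  apply: (@dapp_eq0 _ (U `&` V)) => //.
  - by apply: test_functionD => //; exact: test_functionZ.
  - exact: openI.
  - by move=> z wz; split; [exact: wU|exact: wV].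
  - by move=> z [Uz Vz]; rewrite psif// phif// mulN1r subrr.
rewrite dappD//; last exact: test_functionZ.
by rewrite dappZ// mulN1r => /eqP; rewrite subr_eq0 => /eqP.
Qed.

Lemma near_smooth_eq f g U : open U -> dsupp w `<=` U -> (forall z, U z -> f z = g z) ->
  near_smooth f -> near_smooth g.
Proof.
move=> oU wU fg [phi [V [tphi oV wV phif]]]; exists phi, (U `&` V); split=> //.
- exact: openI.
- by move=> z wz; split; [exact: wU|exact: wV].
- by move=> z [Uz Vz]; rewrite phif// fg.
Qed.

Lemma dpair_eq f g U : open U -> dsupp w `<=` U -> (forall z, U z -> f z = g z) ->
  near_smooth f -> Defs.dpair w f = Defs.dpair w g.
Proof.
move=> oU wU fg [phi [V [tphi oV wV phif]]].
rewrite (dpairE tphi oV wV phif).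
rewrite (@dpairE phi (U `&` V))//.
- exact: openI.
- by move=> z wz; split; [exact: wU|exact: wV].
- by move=> z [Uz Vz]; rewrite phif// fg.
Qed.

Lemma near_smoothD f g : near_smooth f -> near_smooth g ->
  near_smooth (fun z => f z + g z).
Proof.
move=> [phi [U [tphi oU wU phif]]] [psi [V [tpsi oV wV psig]]].
exists (fun z => phi z + psi z), (U `&` V); split.
- exact: test_functionD.
- exact: openI.
- by move=> z wz; split; [exact: wU|exact: wV].
- by move=> z [Uz Vz]; rewrite phif// psig.
Qed.

Lemma near_smoothM f g : near_smooth f -> near_smooth g ->
  near_smooth (fun z => f z * g z).
Proof.
move=> [phi [U [tphi oU wU phif]]] [psi [V [tpsi oV wV psig]]].
exists (fun z => phi z * psi z), (U `&` V); split.
- by apply: test_functionMl => //; case: tphi.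
- exact: openI.
- by move=> z wz; split; [exact: wU|exact: wV].
- by move=> z [Uz Vz]; rewrite phif// psig.
Qed.

Lemma near_smoothZ c f : near_smooth f -> near_smooth (fun z => c * f z).
Proof.
move=> [phi [U [tphi oU wU phif]]]; exists (fun z => c * phi z), U; split=> //.
  exact: test_functionZ.
by move=> z Uz; rewrite phif.
Qed.

Lemma near_smooth0 : near_smooth (fun _ => 0).
Proof.
exists (fun _ => 0), setT; split=> //; [exact: test_function0|exact: openT].
Qed.

Lemma near_smooth_sum J (r : seq J) (P : pred J) (F : J -> plane -> C) :
  (forall j, P j -> near_smooth (F j)) -> near_smooth (fun z => \sum_(j <- r | P j) F j z).
Proof.
move=> nF; elim: r => [|j r IH].
  have -> : (fun z => \sum_(j <- [::] | P j) F j z) = fun _ => 0; last exact: near_smooth0.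
  by apply/funext => z; rewrite big_nil.
case Pj : (P j).
  have -> : (fun z => \sum_(j <- j :: r | P j) F j z) =
      (fun z => F j z + \sum_(j <- r | P j) F j z).
    by apply/funext => z; rewrite big_cons Pj.
  by apply: near_smoothD => //; exact: nF.
have -> : (fun z => \sum_(j <- j :: r | P j) F j z) =
    (fun z => \sum_(j <- r | P j) F j z) => //.
by apply/funext => z; rewrite big_cons Pj.
Qed.

Lemma dpairD f g : near_smooth f -> near_smooth g ->
  Defs.dpair w (fun z => f z + g z) = Defs.dpair w f + Defs.dpair w g.
Proof.
move=> [phi [U [tphi oU wU phif]]] [psi [V [tpsi oV wV psig]]].
rewrite (dpairE tphi oU wU phif) (dpairE tpsi oV wV psig) -dappD//.
apply: (@dpairE _ (U `&` V)).
- exact: test_functionD.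
- exact: openI.
- by move=> z wz; split; [exact: wU|exact: wV].
- by move=> z [Uz Vz]; rewrite phif// psig.
Qed.

Lemma dpairZ c f : near_smooth f -> Defs.dpair w (fun z => c * f z) = c * Defs.dpair w f.
Proof.
move=> [phi [U [tphi oU wU phif]]].
rewrite (dpairE tphi oU wU phif) -dappZ//.
apply: (@dpairE _ U) => //; first exact: test_functionZ.
by move=> z Uz; rewrite phif.
Qed.

Lemma dpair0 : Defs.dpair w (fun _ => 0) = 0.
Proof.
rewrite (@dpairE (fun _ => 0) setT) ?dapp0//; last exact: openT.
exact: test_function0.
Qed.

Lemma dpair_sum J (r : seq J) (P : pred J) (F : J -> plane -> C) :
  (forall j, P j -> near_smooth (F j)) ->
  Defs.dpair w (fun z => \sum_(j <- r | P j) F j z) = \sum_(j <- r | P j) Defs.dpair w (F j).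
Proof.
move=> nF; elim: r => [|j r IH].
  have -> : (fun z => \sum_(j <- [::] | P j) F j z) = fun _ => 0.
    by apply/funext => z; rewrite big_nil.
  by rewrite big_nil dpair0.
rewrite big_cons; case Pj : (P j).
  have -> : (fun z => \sum_(j <- j :: r | P j) F j z) =
      (fun z => F j z + \sum_(j <- r | P j) F j z).
    by apply/funext => z; rewrite big_cons Pj.
  by rewrite dpairD ?IH//; [exact: nF|exact: near_smooth_sum].
have -> : (fun z => \sum_(j <- j :: r | P j) F j z) =
    (fun z => \sum_(j <- r | P j) F j z) => //.
by apply/funext => z; rewrite big_cons Pj.
Qed.

End Localization.

(** * Iterated complex derivatives *)

Section Holomorphy.
Variable R : realType.
Local Notation C := R[i].
Implicit Types (U : set C) (f g : C -> C) (G : nat -> C -> C).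

Definition copen (U : set C) : Prop := @open C^o U.

Lemma normcR (x : C) : `|x| = (Normc.normc x)%:C.
Proof. by rewrite normc_def; case: x. Qed.

Definition has_cderiv (g : C -> C) (z d : C) : Prop :=
  is_derive (z : C^o) (1 : C^o) (g : C^o -> C^o) d.

(** Giving the whole sequence of derivatives makes the calculus of iterated
    derivatives one of explicit formulas. *)
Definition derivs_on U g G :=
  (forall z, U z -> g z = G 0%N z) /\
  (forall k z, U z -> has_cderiv (G k) z (G k.+1 z)).

Definition holo U g := exists G, derivs_on U g G.

(** As U is open, the k-th derivative agrees with G k near each point, so it
    can be differentiated once more. *)
Lemma cderivn_derivs U g G k x : copen U -> derivs_on U g G -> U x ->
  cderivn k g x = G k x.
Proof.
move=> oU [g0 dG]; elim: k x => [|k IH] x Ux; first by rewrite /cderivn derive1n0 g0.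
rewrite /cderivn derive1nS derive1E.
have [_ <-] := dG k x Ux.
apply: (@near_eq_derive C C^o C^o (derive1n k (g : C -> C^o)) (G k)).
have : nbhs (x : C^o) U by exact: open_nbhs_nbhs.
by apply: filterS => z Uz; exact: IH.
Qed.

Lemma derivs_eq U f g G : (forall z, U z -> f z = g z) ->
  derivs_on U f G -> derivs_on U g G.
Proof. by move=> fg [f0 dG]; split=> // z Uz; rewrite -fg// f0. Qed.

Lemma holo_eq U f g : (forall z, U z -> f z = g z) -> holo U f -> holo U g.
Proof. by move=> fg [G dG]; exists G; exact: derivs_eq dG. Qed.

Lemma cderivn_eq U f g k x : copen U -> (forall z, U z -> f z = g z) ->
  holo U f -> U x -> cderivn k f x = cderivn k g x.
Proof.
move=> oU fg [G dG] Ux.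
by rewrite (cderivn_derivs k oU dG Ux) (cderivn_derivs k oU (derivs_eq fg dG) Ux).
Qed.

Lemma derivsD U f g G G' : derivs_on U f G -> derivs_on U g G' ->
  derivs_on U (fun z => f z + g z) (fun k z => G k z + G' k z).
Proof.
move=> [f0 dG] [g0 dG']; split=> [z Uz|k z Uz]; first by rewrite f0 ?g0.
exact: (@is_deriveD _ _ _ _ _ _ _ _ _ (dG k z Uz) (dG' k z Uz)).
Qed.

Lemma derivsZ U c f G : derivs_on U f G ->
  derivs_on U (fun z => c * f z) (fun k z => c * G k z).
Proof.
move=> [f0 dG]; split=> [z Uz|k z Uz]; first by rewrite f0.
exact: (@is_deriveZ _ _ _ _ c _ _ _ (dG k z Uz)).
Qed.

Lemma has_cderiv_poly (q : {poly C}) z : has_cderiv (fun z => q.[z]) z q^`().[z].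
Proof.
elim/poly_ind: q => [|q c IH].
  rewrite deriv0 horner0.
  have -> : (fun z : C => (0 : {poly C}).[z]) = cst 0.
    by apply/funext => t; rewrite horner0.
  exact: is_derive_cst.
have -> : (fun z : C => (q * 'X + c%:P).[z]) =
  (fun z : C^o => q.[z]) * id + cst c.
  by apply/funext => t; rewrite !hornerE.
have := @is_deriveD _ _ _ _ _ _ _ _ _ (is_deriveM IH (is_derive_id (z : C^o) 1))
  (is_derive_cst (c : C^o) (z : C^o) (1 : C^o)).
rewrite /has_cderiv derivD derivM derivX derivC mulr1 addr0 !hornerE.
by rewrite /GRing.scale/= mulr1 [q.[z] + _]addrC [z * _]mulrC.
Qed.

Lemma derivs_poly U (q : {poly C}) :
  derivs_on U (fun z => q.[z]) (fun k z => q^`(k).[z]).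
Proof. by split=> // k z _; rewrite derivnS; exact: has_cderiv_poly. Qed.

Lemma cderivn_poly (q : {poly C}) k x : cderivn k (fun z => q.[z]) x = q^`(k).[x].
Proof. exact: (cderivn_derivs k (@openT C^o) (derivs_poly setT q)). Qed.

Lemma derivs_mulXsub U c f G : derivs_on U f G ->
  derivs_on U (fun z => (z - c) * f z)
    (fun k z => (z - c) * G k z + k%:R * G k.-1 z).
Proof.
move=> [f0 dG]; split=> [z Uz|k z Uz]; first by rewrite f0// mul0r addr0.
have dX : is_derive (z : C^o) (1 : C^o) (fun t : C^o => t - c : C^o) 1.
  exact: (@is_derive_shift C z 1 (- c)).
have := is_deriveM dX (dG k z Uz).
case: k => [|k] H.
  rewrite /has_cderiv mul1r.
  have -> : (fun z => (z - c) * G 0%N z + 0%:R * G 0%N.-1 z) =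
     (fun z => (z - c) * G 0%N z) by apply/funext => t; rewrite mul0r addr0.
  by move: H; rewrite /GRing.scale/= mulr1.
have := @is_deriveD _ _ _ _ _ _ _ _ _ H (@is_deriveZ _ _ _ _ k.+1%:R _ _ _ (dG k z Uz)).
rewrite /GRing.scale/= mulr1 -addrA -[X in _ + (X + _)]mul1r -mulrDl.
by rewrite -(natrD _ 1%N) add1n.
Qed.

Lemma derivs0 U : derivs_on U (fun=> 0) (fun _ _ => 0).
Proof. by split=> // k z _; exact: is_derive_cst. Qed.

Lemma holo0 U : holo U (fun=> 0).
Proof. by exists (fun _ _ => 0); exact: derivs0. Qed.

Lemma holoD U f g : holo U f -> holo U g -> holo U (fun z => f z + g z).
Proof. by move=> [G dG] [G' dG']; exists (fun k z => G k z + G' k z); exact: derivsD. Qed.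

Lemma holoZ U c f : holo U f -> holo U (fun z => c * f z).
Proof. by move=> [G dG]; exists (fun k z => c * G k z); exact: derivsZ. Qed.

Lemma holo_sum U J (r : seq J) (P : pred J) (F : J -> C -> C) :
  (forall j, P j -> holo U (F j)) -> holo U (fun z => \sum_(j <- r | P j) F j z).
Proof.
move=> hF; elim: r => [|j r IH].
  by apply: holo_eq (holo0 U) => z _; rewrite big_nil.
case Pj : (P j).
  by apply: holo_eq (holoD (hF j Pj) IH) => z _; rewrite big_cons Pj.
by apply: holo_eq IH => z _; rewrite big_cons Pj.
Qed.

Lemma holo_poly U (q : {poly C}) : holo U (fun z => q.[z]).
Proof. by exists (fun k z => q^`(k).[z]); exact: derivs_poly. Qed.

Lemma holo_polyM U (q : {poly C}) f : holo U f -> holo U (fun z => q.[z] * f z).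
Proof.
move=> hf; elim/poly_ind: q => [|q c IH].
  by apply: holo_eq (holo0 U) => z _; rewrite horner0 mul0r.
have [G dG] := IH.
have H : holo U (fun z => (z - 0) * (q.[z] * f z)).
  by eexists; exact: (derivs_mulXsub 0 dG).
apply: holo_eq (holoD H (holoZ c hf)).
by move=> z _; rewrite hornerMXaddC subr0 mulrDl mulrA [z * _]mulrC.
Qed.

Lemma cderivnD U f g k x : copen U -> holo U f -> holo U g -> U x ->
  cderivn k (fun z => f z + g z) x = cderivn k f x + cderivn k g x.
Proof.
move=> oU [G dG] [G' dG'] Ux.
by rewrite (cderivn_derivs k oU (derivsD dG dG') Ux) (cderivn_derivs k oU dG Ux)
  (cderivn_derivs k oU dG' Ux).
Qed.

Lemma cderivnZ U c f k x : copen U -> holo U f -> U x ->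
  cderivn k (fun z => c * f z) x = c * cderivn k f x.
Proof.
move=> oU [G dG] Ux.
by rewrite (cderivn_derivs k oU (derivsZ c dG) Ux) (cderivn_derivs k oU dG Ux).
Qed.

Lemma cderivn0 k x : cderivn k (fun=> 0 : C) x = 0.
Proof.
exact: (cderivn_derivs k (@openT C^o) (derivs0 setT)).
Qed.

Lemma cderivn_sum U J (r : seq J) (P : pred J) (F : J -> C -> C) k x : copen U ->
  (forall j, P j -> holo U (F j)) -> U x ->
  cderivn k (fun z => \sum_(j <- r | P j) F j z) x =
  \sum_(j <- r | P j) cderivn k (F j) x.
Proof.
move=> oU hF Ux; elim: r => [|j r IH].
  rewrite big_nil; transitivity (cderivn k (fun=> 0 : C) x); last exact: cderivn0.
  by congr (cderivn _ _ _); apply/funext => z; rewrite big_nil.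
rewrite big_cons; case Pj : (P j).
  rewrite -IH -(cderivnD k oU _ _ Ux); [|exact: hF|exact: holo_sum].
  by congr (cderivn _ _ _); apply/funext => z; rewrite big_cons Pj.
by rewrite -IH; congr (cderivn _ _ _); apply/funext => z; rewrite big_cons Pj.
Qed.

(** Multiplication by z - x turns the sequence G into (z - x) G_k + k G_{k-1},
    whose value at x is k G_{k-1}: each factor raises the order of vanishing
    by one. *)
Lemma cderivn_vanish U (q : {poly C}) f kap k x : copen U -> holo U f -> U x ->
  ('X - x%:P) ^+ kap %| q -> (k < kap)%N ->
  cderivn k (fun z => q.[z] * f z) x = 0.
Proof.
move=> oU hf Ux /Pdiv.Field.dvdpP[q' ->] kk.
have key n : exists2 G, derivs_on U (fun z => (z - x) ^+ n * (q'.[z] * f z)) G &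
    forall m, (m < n)%N -> G m x = 0.
  elim: n => [|n [G dG G0]].
    have [G dG] := holo_polyM q' hf; exists G => //.
    by apply: derivs_eq dG => z _; rewrite expr0 mul1r.
  exists (fun k z => (z - x) * G k z + k%:R * G k.-1 z).
    by apply: derivs_eq (derivs_mulXsub x dG) => z _; rewrite exprS mulrA.
  move=> [|m] mn; rewrite subrr mul0r add0r ?mul0r//.
  by rewrite G0 ?mulr0.
have [G dG G0] := key kap.
rewrite -(G0 k kk) -(cderivn_derivs k oU dG Ux).
congr (cderivn _ _ _); apply/funext => z.
by rewrite hornerM horner_exp hornerXsubC mulrCA mulrA.
Qed.

End Holomorphy.

(** * Regularizing the resolvent off the support *)

Section Resolvent.
Variable R : realType.
Local Notation C := R[i].
Local Notation plane := (R * R)%type.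
Variable w : plane_distribution R.
Hypothesis w_bounded : exists r : R, forall z, dsupp w z -> `|z| <= r.

Lemma near_smooth_csmooth f : csmooth f -> near_smooth w f.
Proof.
move=> sf; have [r wr] := w_bounded.
have r0 : 0 < `|r| + 1 by rewrite ltr_wpDl.
exists (fun z => (cutoff 0 (`|r| + 1) z)%:C * f z), [set z : plane | `|z| < `|r| + 1].
split.
- split; first exact: csmoothM (csmooth_cutoff _ _) sf.
  exists (2 * (`|r| + 1)) => z zr; rewrite cutoff0 ?mul0r//.
  by rewrite subr0 ltW.
- have -> : [set z : plane | `|z| < `|r| + 1] = ball (0 : plane) (`|r| + 1).
    by rewrite -ball_normE; apply/seteqP; split=> z /=; rewrite sub0r normrN.
  exact: ball_open.
- by move=> z /wr zr /=; rewrite (le_lt_trans zr)// (le_lt_trans (ler_norm _))// ltrDl.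
- by move=> z /= zr; rewrite cutoff1 ?mul1r// subr0 ltW.
Qed.

Lemma near_smooth_cst (c : C) : near_smooth w (fun _ => c).
Proof. by apply: near_smooth_csmooth; exact: csmooth_cst. Qed.

(** A positive distance to the projection of the support, so that the
    condition is open in z0. *)
Definition off_supp (z0 : C) := exists2 rho : R, 0 < rho &
  forall t, dsupp w t -> rho <= Normc.normc (z0 - t.2%:C).

Definition sqdist (z : C) (t : plane) : R :=
  (complex.Re z - t.2) ^+ 2 + complex.Im z ^+ 2.

Lemma sqdistE z t : sqdist z t = Normc.normc (z - t.2%:C) ^+ 2.
Proof.
by case: z => a b; rewrite /sqdist /= oppr0 addr0 sqr_sqrtr// addr_ge0 ?sqr_ge0.
Qed.

Lemma normc_Re (z : C) : `|complex.Re z| <= Normc.normc z.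
Proof. by have := normc_ge_Re z; rewrite normcR lecR. Qed.

Lemma normc_Im (z : C) : `|complex.Im z| <= Normc.normc z.
Proof.
case: z => a b /=; rewrite -sqrtr_sqr ler_sqrt ?addr_ge0 ?sqr_ge0//.
by rewrite lerDr sqr_ge0.
Qed.

Lemma sqr_ge_norm (a c : R) : 0 <= c -> c <= `|a| -> c ^+ 2 <= a ^+ 2.
Proof. by move=> c0 ca; rewrite -[a ^+ 2]real_normK ?num_real// ler_pXn2r// nnegrE. Qed.

(** The denominator of 1/(z - y) = conj(z - y) / |z - y|^2 is bounded below
    when |Im z0| is not small compared with the distance to the support.
    Otherwise Re z0 is away from the values of y on the support, and a bump
    around the line y = Re z0, zero near the support, is added to the
    denominator. *)
Lemma regularized_sqdist (z0 : C) : off_supp z0 ->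
  exists (beta : plane -> R) (V : set plane)
    (c delta : R),
  [/\ forall I, smooth_family (fun _ : I => beta), open V, dsupp w `<=` V &
   [/\ forall t, V t -> beta t = 0, 0 < c, 0 < delta &
     forall z, Normc.normc (z - z0) < delta -> forall t, c <= sqdist z t + beta t]].
Proof.
move=> [rho r0 Hrho]; case Ez : z0 => [a b].
have [rb|rb] := leP (rho / 2) `|b|.
  exists (fun _ => 0), setT, ((rho / 4) ^+ 2), (rho / 4); split=> //.
  - by move=> I m; exact: Cm_cst.
  - exact: openT.
  - split=> //; rewrite ?exprn_gt0 ?divr_gt0//.
    move=> z zz t; rewrite addr0 /sqdist; apply: ler_wpDl; first exact: sqr_ge0.
    apply: sqr_ge_norm; first by rewrite divr_ge0// ltW.
    have := le_lt_trans (normc_Im _) zz; case: z {zz} => c d /= H2.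
    by have := lerB_dist b d; rewrite [`|b - d|]distrC; lra.
have Hy t : dsupp w t -> rho / 2 < `|t.2 - a|.
  move=> /Hrho; rewrite Ez => H; have := le_trans H (normc_le _).
  by rewrite /= oppr0 addr0 [`|a - _|]distrC => H'; lra.
exists (plateau true a (rho / 8)), [set t : plane | rho / 4 < `|t.2 - a|],
  (Num.min 1 ((rho / 16) ^+ 2)), (rho / 16); split.
- by move=> I m; exact: Cm_plateau.
- apply: (@open_comp _ _ (fun t : plane => `|t.2 - a|) [set x | rho / 4 < x]);
    last exact: open_gt.
  move=> t _; apply: (@continuous_comp _ _ _ (fun t : plane => t.2 - a) (fun x => `|x|)).
    by apply: cvgB; [exact: cvg_snd|exact: cvg_cst].
  exact: norm_continuous.
- by move=> t /Hy /= H; lra.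
- split.
  + move=> t /= H; apply: plateau0; first by rewrite divr_gt0.
    rewrite /plane_coord; lra.
  + by rewrite lt_min ltr01 exprn_gt0 ?divr_gt0.
  + by rewrite divr_gt0.
  + move=> z zz t; rewrite ge_min; have [H|H] := leP `|t.2 - a| (rho / 8).
      by rewrite plateau1 ?divr_gt0// lerDr /sqdist addr_ge0 ?sqr_ge0.
    apply/orP; right; apply: ler_wpDr; first exact: plateau_ge0.
    rewrite /sqdist; apply: ler_wpDr; first exact: sqr_ge0.
    apply: sqr_ge_norm; first by rewrite divr_ge0// ltW.
    have := le_lt_trans (normc_Re _) zz; case: z {zz} => c d /= H2.
    have := ler_distD c t.2 a; rewrite [`|_ - c|]distrC; lra.
Qed.

End Resolvent.

(** * Complex derivatives of pairings with resolvents *)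

Section ResolventHolomorphic.
Variable R : realType.
Local Notation C := R[i].
Local Notation plane := (R * R)%type.
Variable w : plane_distribution R.
Hypothesis w_bounded : exists r : R, forall z, dsupp w z -> `|z| <= r.

Lemma csmooth_familyX I (F : I -> plane -> C) j : csmooth_family F ->
  csmooth_family (fun i z => F i z ^+ j).
Proof.
move=> sF; elim: j => [|j IH]; first exact: csmooth_family_cst.
by apply: csmooth_family_ext (csmooth_familyM sF IH) => i z; rewrite exprS.
Qed.

(** The quotient of conj(z - y) by the regularized denominator is smooth on
    the whole plane, with bounds uniform in z. *)
Lemma resolvent_family (z0 : C) : off_supp w z0 ->
  exists (delta : R) (V : set plane)
    (g : {z : C | Normc.normc (z - z0) < delta} -> plane -> C),
  [/\ 0 < delta, open V, dsupp w `<=` V, csmooth_family g &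
    forall i t, V t -> sval i - t.2%:C != 0 /\ g i t = (sval i - t.2%:C)^-1].
Proof.
move=> /regularized_sqdist [beta [V [c [delta [sb oV wV [b0 c0 d0 Hc]]]]]].
pose I := {z : C | Normc.normc (z - z0) < delta}.
pose q (i : I) (t : plane) := (sqdist (sval i) t + beta t)^-1.
have bI (i : I) : Normc.normc (sval i - z0) <= delta by case: i => z /= /ltW.
have sRe m : Cm m (fun (i : I) (_ : plane) => complex.Re (sval i)).
  apply: Cm_indexed_cst; exists (delta + `|complex.Re z0|) => i.
  have := le_trans (normc_Re _) (bI i); rewrite raddfB /= => H.
  have := lerB_dist (complex.Re (sval i)) (complex.Re z0); lra.
have sIm m : Cm m (fun (i : I) (_ : plane) => complex.Im (sval i)).
  apply: Cm_indexed_cst; exists (delta + `|complex.Im z0|) => i.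
  have := le_trans (normc_Im _) (bI i); rewrite raddfB /= => H.
  have := lerB_dist (complex.Im (sval i)) (complex.Im z0); lra.
have sX m : Cm m (fun (i : I) (t : plane) => complex.Re (sval i) - t.2).
  by apply: CmB => //; exact: Cm_snd.
have sq m : Cm m q.
  apply: (@CmV _ _ _ (fun i t => sqdist (sval i) t + beta t) c) => //.
    by move=> i z; apply: Hc; case: i.
  apply: CmD; last exact: sb.
  by apply: CmD; [apply: Cm_ext (CmM (sX m) (sX m))|apply: Cm_ext (CmM (sIm m) (sIm m))].
exists delta, V, (fun i t => (complex.Re (sval i) - t.2) * q i t
                     +i* (- complex.Im (sval i) * q i t)); split=> //.
  split=> m /=; first exact: CmM.
  by apply: CmM => //; apply: CmN.
move=> i t Vt; have H := Hc _ (svalP i) t; rewrite b0// addr0 in H.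
have n0 : sval i - t.2%:C != 0.
  apply: contraTneq H => E; rewrite -ltNge sqdistE E.
  by rewrite (_ : Normc.normc 0 = 0) ?expr0n//= expr0n /= addr0 sqrtr0.
split=> //; apply: (mulIf n0); rewrite mulVf// /q b0// addr0.
have q0 : sqdist (sval i) t != 0 by rewrite gt_eqF// (lt_le_trans c0).
case: (sval i) q0 => a b; rewrite /sqdist /= => q0.
apply/eqP; rewrite eq_complex /= oppr0 addr0; apply/andP; split; apply/eqP.
  by rewrite -(divff q0); ring.
by ring.
Qed.

Definition bounded_near (z0 : C) (E : C -> plane -> C) : Prop :=
  exists2 delta : R, 0 < delta & exists B : R,
    forall z, Normc.normc (z - z0) < delta -> near_smooth w (E z) /\
      Normc.normc (Defs.dpair w (E z)) <= B.

(** The functions paired with w are replaced by test functions forming one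
    family with common seminorm bounds, so the continuity of w gives a common
    bound. *)
Lemma bounded_near_power z0 F j : off_supp w z0 -> near_smooth w F ->
  bounded_near z0 (fun z t => F t * (z - t.2%:C)^-1 ^+ j).
Proof.
move=> /resolvent_family [delta [V [g [d0 oV wV sg gV]]]] [phi [U [tphi oU wU phiF]]].
exists delta => //.
have [sphi [r phir]] := tphi.
have sG := csmooth_familyM (csmooth_csmooth_family _ sphi) (csmooth_familyX j sg).
have [m [c Hmc]] := dcont w r.
have vG i : vanishes_beyond r (fun t => phi t * g i t ^+ j).
  by move=> t tr; rewrite phir ?mul0r.
have [B HB] := csmooth_family_partials_bound m sG vG.
exists (c * B) => z zz; pose i := exist (fun z => is_true (Normc.normc (z - z0) < delta)) z zz.
have tG : test_function (fun t => phi t * g i t ^+ j).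
  split; first exact: (csmooth_family_csmooth i sG).
  by exists r => t tr; rewrite phir ?mul0r.
have EG t : (U `&` V) t -> phi t * g i t ^+ j = F t * (z - t.2%:C)^-1 ^+ j.
  by case=> Ut Vt; rewrite (phiF t Ut) (gV i t Vt).2.
have wUV : dsupp w `<=` U `&` V by move=> t wt; split; [exact: wU|exact: wV].
split.
  by exists (fun t => phi t * g i t ^+ j), (U `&` V); split=> //; exact: openI.
rewrite (dpairE tG (openI oU oV) wUV EG).
apply: (Hmc _ tG (vG i)) => s t ss; exact: (HB i).
Qed.

Lemma bounded_near_sum z0 J (r : seq J) (E : J -> C -> plane -> C) :
  (forall j, bounded_near z0 (E j)) ->
  bounded_near z0 (fun z t => \sum_(j <- r) E j z t).
Proof.
move=> bE; elim: r => [|j r [d d0 [B HB]]].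
  exists 1 => //; exists 0 => z _.
  have -> : (fun t : plane => \sum_(j <- [::]) E j z t) = fun _ => 0.
    by apply/funext => t; rewrite big_nil.
  by split; [exact: near_smooth0|rewrite dpair0 /= expr0n /= addr0 sqrtr0].
have [d' d'0 [B' HB']] := bE j.
exists (Num.min d d'); first by rewrite lt_min d0.
exists (B' + B) => z; rewrite lt_min => /andP[/HB [n1 H1] /HB' [n2 H2]].
have -> : (fun t : plane => \sum_(j <- j :: r) E j z t) =
  fun t => E j z t + \sum_(j <- r) E j z t.
  by apply/funext => t; rewrite big_cons.
split; first exact: near_smoothD.
by rewrite dpairD// (le_trans (le_normcD _ _))// lerD.
Qed.

Lemma near_smooth_resolvent z0 j : off_supp w z0 ->
  near_smooth w (fun t => (z0 - t.2%:C)^-1 ^+ j).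
Proof.
move=> oz; have n1 := near_smooth_cst w_bounded 1.
have [d d0 [B /(_ z0)]] := bounded_near_power j oz n1.
rewrite subrr (_ : Normc.normc 0 = 0) ?d0; last by rewrite /= expr0n /= addr0 sqrtr0.
case=> // nz _; apply: (near_smooth_eq (@openT _) _ _ nz) => //.
by move=> t _; rewrite mul1r.
Qed.

(** With a = 1/(z0 - y) and b = 1/(z0 + h - y) the hypothesis is the resolvent
    identity. What matters on the right is that the exponents do not depend on
    a, b and h. *)
Lemma power_difference k : exists L : seq (nat * nat), forall a b h : C,
  b - a = - h * (a * b) ->
  b ^+ k - a ^+ k = - h * \sum_(ij <- L) a ^+ ij.1 * b ^+ ij.2.
Proof.
elim: k => [|k [L HL]]; first by exists [::] => a b h _; rewrite big_nil mulr0 subrr.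
exists ((1, k.+1) :: [seq (ij.1.+1, ij.2) | ij <- L]) => a b h ba.
rewrite big_cons big_map /= expr1.
have -> : \sum_(ij <- L) a ^+ ij.1.+1 * b ^+ ij.2 =
    a * \sum_(ij <- L) a ^+ ij.1 * b ^+ ij.2.
  by rewrite mulr_sumr; apply: eq_bigr => ij _; rewrite exprS mulrA.
rewrite mulrDr [- h * (a * \sum_(_ <- _) _)]mulrCA -(HL _ _ _ ba) mulrBr -!exprS.
have -> : - h * (a * b ^+ k.+1) = b ^+ k * (b - a).
  by rewrite ba exprS; ring.
by rewrite mulrBr -exprSr; ring.
Qed.

(** The expansion of (z - y)^-k in z to second order: inserting the first
    order one into itself produces the factor h^2. *)
Lemma power_remainder k : exists L : seq (nat * nat), forall a b h : C,
  b - a = - h * (a * b) ->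
  b ^+ k - a ^+ k + k%:R * h * a ^+ k.+1 =
  h ^+ 2 * \sum_(ij <- L) a ^+ ij.1 * b ^+ ij.2.
Proof.
elim: k => [|k [L HL]].
  by exists [::] => a b h _; rewrite big_nil mulr0 subrr !mul0r addr0.
have [M HM] := power_difference k.+1.
exists ([seq (ij.1.+1, ij.2) | ij <- L] ++ [seq (ij.1.+1, ij.2) | ij <- M]) => a b h ba.
have sh (N : seq (nat * nat)) : \sum_(ij <- [seq (ij.1.+1, ij.2) | ij <- N])
    a ^+ ij.1 * b ^+ ij.2 = a * \sum_(ij <- N) a ^+ ij.1 * b ^+ ij.2.
  by rewrite big_map mulr_sumr; apply: eq_bigr => ij _; rewrite exprS mulrA.
rewrite big_cat /= !sh mulrDr [h ^+ 2 * (a * \sum_(_ <- L) _)]mulrCA -(HL _ _ _ ba).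
have -> : h ^+ 2 * (a * \sum_(ij <- M) a ^+ ij.1 * b ^+ ij.2) =
    - h * a * (b ^+ k.+1 - a ^+ k.+1).
  by rewrite (HM _ _ _ ba); ring.
have -> : - h * a * (b ^+ k.+1 - a ^+ k.+1) = b ^+ k * (b - a) + h * a ^+ k.+2.
  by rewrite ba !exprS; ring.
by rewrite -natr1 !exprS; ring.
Qed.

(** The difference quotient differs from the claimed derivative by h times the
    pairing with the remainder of second order, which stays bounded as h tends
    to 0. *)
Lemma has_cderiv_resolvent_power z0 F k : off_supp w z0 -> near_smooth w F ->
  has_cderiv (fun z => Defs.dpair w (fun t => F t * (z - t.2%:C)^-1 ^+ k)) z0
    (- k%:R * Defs.dpair w (fun t => F t * (z0 - t.2%:C)^-1 ^+ k.+1)).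
Proof.
move=> oz nF; set g := fun z => Defs.dpair w _.
have [L HL] := power_remainder k.
pose E z t := \sum_(ij <- L) F t * (z0 - t.2%:C)^-1 ^+ ij.1 * (z - t.2%:C)^-1 ^+ ij.2.
have [d d0 [B HB]] : bounded_near z0 E.
  apply: bounded_near_sum => ij; apply: bounded_near_power => //.
  by apply: near_smoothM => //; exact: near_smooth_resolvent.
have [d' [V [r [d'0 oV wV _ rV]]]] := resolvent_family oz.
have [d2 d20 [B2 HB2]] := bounded_near_power k oz nF.
have nj j : near_smooth w (fun t => F t * (z0 - t.2%:C)^-1 ^+ j).
  by apply: near_smoothM => //; exact: near_smooth_resolvent.
set G1 := Defs.dpair w _.
have key h : Normc.normc h < Num.min d2 (Num.min d d') ->
    g (h + z0) - g z0 + k%:R * h * G1 = h ^+ 2 * Defs.dpair w (E (h + z0)).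
  rewrite !lt_min => /and3P[hd2 hd hd'].
  have hz : Normc.normc (h + z0 - z0) < d by rewrite addrK.
  have hz' : Normc.normc (h + z0 - z0) < d' by rewrite addrK.
  have h0 : Normc.normc (z0 - z0) < d' by rewrite subrr /= expr0n /= addr0 sqrtr0.
  have nh : near_smooth w (fun t => F t * (h + z0 - t.2%:C)^-1 ^+ k).
    by apply: (HB2 _ _).1; rewrite addrK.
  have nE := (HB _ hz).1.
  rewrite -(dpairZ _ nE) /g /G1 -(dpairZ (k%:R * h) (nj k.+1)) -mulN1r.
  have nk := near_smoothZ (-1) (nj k); have nk1 := near_smoothZ (k%:R * h) (nj k.+1).
  rewrite -(dpairZ (-1) (nj k)) -(dpairD nh nk) -(dpairD (near_smoothD nh nk) nk1).
  apply: (dpair_eq oV wV _ (near_smoothD (near_smoothD nh nk) nk1)) => t Vt.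
  have n0 := (rV (exist (fun z => is_true (Normc.normc (z - z0) < d')) _ h0) _ Vt).1.
  have n1 := (rV (exist (fun z => is_true (Normc.normc (z - z0) < d')) _ hz') _ Vt).1.
  rewrite /= in n0 n1.
  have H := HL (z0 - t.2%:C)^-1 (h + z0 - t.2%:C)^-1 h.
  transitivity (F t * (h ^+ 2 * \sum_(ij <- L)
      (z0 - t.2%:C)^-1 ^+ ij.1 * (h + z0 - t.2%:C)^-1 ^+ ij.2)).
    rewrite -H; first by ring.
    by field; rewrite n0 n1.
  rewrite /E mulrCA; congr (_ * _); rewrite mulr_sumr; apply: eq_bigr => ij _.
  by rewrite mulrA.
have lim : (fun h : C^o => h^-1 *: ((g \o shift z0) (h *: (1 : C^o)) - g z0) : C^o) @ 0^'
     --> (- k%:R * G1 : C^o).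
  apply/cvgrPdist_le => e e0.
  have m0 : 0 < Num.min d2 (Num.min d d') by rewrite !lt_min d0 d20.
  near=> h.
  have h0 : h != 0 by near: h; exact: nbhs_dnbhs_neq.
  have hm : Normc.normc h < Num.min d2 (Num.min d d').
    rewrite -ltcR -normcR; near: h; apply: dnbhs0_lt; by rewrite ltcR.
  have K := key h hm.
  rewrite /= [h *: 1]mulr1 /GRing.scale /=.
  have -> : - k%:R * G1 - h^-1 * (g (h + z0) - g z0) = - h * Defs.dpair w (E (h + z0)).
    have -> : g (h + z0) - g z0 = h ^+ 2 * Defs.dpair w (E (h + z0)) - k%:R * h * G1.
      by rewrite -K addrK.
    by field.
  rewrite normrM normrN normcR [`|Defs.dpair _ _|]normcR.
  have HB' : Normc.normc (Defs.dpair w (E (h + z0))) <= `|B| + 1.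
    have [|_ H] := HB (h + z0).
      by rewrite addrK; move: hm; rewrite !lt_min => /and3P[].
    by rewrite (le_trans H)// (le_trans (ler_norm _))// lerDl.
  apply: (@le_trans _ _ ((Normc.normc h)%:C * (`|B| + 1)%:C)).
    by rewrite ler_wpM2l ?lecR ?sqrtr_ge0//; case: (h) => ? ?; rewrite sqrtr_ge0.
  rewrite -normcR -ler_pdivlMr ?ltcR ?ltr_wpDl//.
  by near: h; apply: dnbhs0_le; rewrite divr_gt0// ltcR ltr_wpDl.
split; first by apply/cvg_ex; exists (- k%:R * G1).
exact: cvg_lim lim.
Unshelve. all: end_near. Qed.

End ResolventHolomorphic.

(** * Points off a compact support *)

Section Support.
Variable R : realType.
Local Notation C := R[i].
Local Notation plane := (R * R)%type.
Variable w : plane_distribution R.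

Lemma dsupp_closed : closed (dsupp w).
Proof.
rewrite -openC openE => t /= /contrapT[V [oV Vt HV]].
have : nbhs t V by exact: open_nbhs_nbhs.
by apply: filterS => s Vs; apply; exists V.
Qed.

Lemma off_supp_open : copen (off_supp w).
Proof.
rewrite /copen openE => z [rho r0 Hrho].
apply: (nbhs_normP (z : C^o) (off_supp w : set C^o)).2.
exists (rho / 2)%:C; first by rewrite /= ltcR divr_gt0.
move=> z' /= zz; exists (rho / 2); first by rewrite divr_gt0.
move=> t /Hrho H.
have {}zz : Normc.normc (z - z') < rho / 2 by rewrite -ltcR -normcR.
have := le_normcD (z - z') (z' - t.2%:C).
rewrite addrA subrK; lra.
Qed.

Hypothesis w_bounded : exists r : R, forall z, dsupp w z -> `|z| <= r.

(** The support is compact, so the distance to it is attained. *)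
Lemma off_supp_notin (z0 : C) : (forall t, dsupp w t -> z0 != t.2%:C) -> off_supp w z0.
Proof.
move=> Hz; have [r wr] := w_bounded.
have cK : compact (dsupp w).
  have -> : dsupp w = [set z : plane | `|z| <= r] `&` dsupp w.
    by apply/seteqP; split=> [z wz|z []//]; split=> //; exact: wr.
  by apply: compact_closedI; [exact: compact_square|exact: dsupp_closed].
have cf : continuous (sqdist z0).
  move=> t; rewrite /continuous_at /sqdist; apply: cvgD; last exact: cvg_cst.
  by apply: cvgM; apply: cvgB; (try exact: cvg_cst); exact: cvg_snd.
have cI : closed (sqdist z0 @` dsupp w).
  apply: compact_closed; first exact: norm_hausdorff.
  by apply: continuous_compact => //; apply: continuous_subspaceT.
have : open (~` (sqdist z0 @` dsupp w)) by exact: closed_openC.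
rewrite openE => /(_ 0) []; last move=> e /= e0 He.
  move=> [t wt E]; have /eqP := Hz t wt; apply.
  have /eqP := sqdistE z0 t; rewrite E eq_sym sqrf_eq0 => /eqP /Normc.eq0_normc/eqP.
  by rewrite subr_eq0 => /eqP.
exists (Num.sqrt e); first by rewrite sqrtr_gt0.
move=> t wt; rewrite leNgt; apply/negP => lt.
apply: (He (sqdist z0 t)); last by exists t.
have s0 : 0 <= sqdist z0 t by rewrite /sqdist addr_ge0 ?sqr_ge0.
rewrite /= sub0r normrN ger0_norm// sqdistE.
rewrite -[ltRHS]sqr_sqrtr ?ltW// ltrXn2r//.
by case: (z0 - _) => a b /=; rewrite sqrtr_ge0.
Qed.

Lemma holo_resolvent F : near_smooth w F ->
  holo (off_supp w) (fun z => Defs.dpair w (fun t => F t * (z - t.2%:C)^-1)).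
Proof.
move=> nF; exists (fun k z => (-1) ^+ k * k`!%:R *
  Defs.dpair w (fun t => F t * (z - t.2%:C)^-1 ^+ k.+1)).
split=> [z oz|k z oz]; first by rewrite expr0 fact0 !mul1r.
have := @is_deriveZ _ _ _ _ ((-1) ^+ k * k`!%:R) _ _ _ (has_cderiv_resolvent_power w_bounded k.+1
  oz nF).
suff -> : (-1) ^+ k.+1 * k.+1`!%:R *
    Defs.dpair w (fun t => F t * (z - t.2%:C)^-1 ^+ k.+2) =
    (-1) ^+ k * k`!%:R *
    (- k.+1%:R * Defs.dpair w (fun t => F t * (z - t.2%:C)^-1 ^+ k.+2)) by [].
by rewrite exprS factS natrM; ring.
Qed.

End Support.

(** * The sesquilinear form of a kernel *)

Section KernelForm.
Variables (R : realType) (p : nat).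
Local Notation C := R[i].
Local Notation plane := (R * R)%type.
Local Notation mxpoly := 'M[{poly C}]_p.
Local Notation cmx := (map_mx polyC).
Variable u : 'I_p -> 'I_p -> plane_distribution R.
Hypothesis u_suppx : bounded_set (ksupp_x u).
Hypothesis u_suppy : bounded_set (ksupp_y u).

Lemma ksupp_bounded k l : exists r : R, forall z, dsupp (u k l) z -> `|z| <= r.
Proof.
have [r1 [_ H1]] := u_suppx; have [r2 [_ H2]] := u_suppy.
exists (Num.max (r1 + 1) (r2 + 1)) => z wz.
have kz : ksupp u z by exists k, l.
have Hx : `|z.1| <= r1 + 1 by apply: (H1 (r1 + 1)); [rewrite ltrDl|exists z].
have Hy : `|z.2| <= r2 + 1 by apply: (H2 (r2 + 1)); [rewrite ltrDl|exists z].
by rewrite prod_normE ge_max !le_max Hx Hy orbT.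
Qed.

Definition kernel_smooth (f : plane -> C) := forall k l, near_smooth (u k l) f.

Lemma kernel_smooth_cst c : kernel_smooth (fun=> c).
Proof. by move=> k l; apply: near_smooth_cst; exact: ksupp_bounded. Qed.

Lemma kernel_smoothD f g : kernel_smooth f -> kernel_smooth g ->
  kernel_smooth (fun z => f z + g z).
Proof. by move=> nf ng k l; exact: near_smoothD. Qed.

Lemma kernel_smoothM f g : kernel_smooth f -> kernel_smooth g ->
  kernel_smooth (fun z => f z * g z).
Proof. by move=> nf ng k l; exact: near_smoothM. Qed.

Lemma kernel_smooth_sum J (r : seq J) (P : pred J) (F : J -> plane -> C) :
  (forall j, P j -> kernel_smooth (F j)) -> kernel_smooth (fun z => \sum_(j <- r | P j) F j z).
Proof. by move=> nF k l; apply: near_smooth_sum => j Pj; exact: nF. Qed.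

Lemma kernel_smooth_prod J (r : seq J) (P : pred J) (F : J -> plane -> C) :
  (forall j, P j -> kernel_smooth (F j)) -> kernel_smooth (fun z => \prod_(j <- r | P j) F j z).
Proof.
move=> nF; elim: r => [|j r IH].
  have -> : (fun z => \prod_(j <- [::] | P j) F j z) = fun=> 1.
    by apply/funext => z; rewrite big_nil.
  exact: kernel_smooth_cst.
case Pj : (P j).
  have -> : (fun z => \prod_(j <- j :: r | P j) F j z) =
      (fun z => F j z * \prod_(j <- r | P j) F j z).
    by apply/funext => z; rewrite big_cons Pj.
  by apply: kernel_smoothM => //; exact: nF.
have -> : (fun z => \prod_(j <- j :: r | P j) F j z) =
    (fun z => \prod_(j <- r | P j) F j z) => //.
by apply/funext => z; rewrite big_cons Pj.
Qed.

Lemma kernel_smooth_poly b (q : {poly C}) :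
  kernel_smooth (fun z => q.[(plane_coord b z)%:C]).
Proof.
by move=> k l; apply: near_smooth_csmooth (csmooth_poly q b); exact: ksupp_bounded.
Qed.

Definition kernel_smooth_x (P : R -> 'M[C]_p) :=
  forall i k, kernel_smooth (fun z => P z.1 i k).
Definition kernel_smooth_y (Q : R -> 'M[C]_p) :=
  forall i k, kernel_smooth (fun z => Q z.2 i k).

Lemma kernel_smooth_x_poly P : kernel_smooth_x (fun x => mxev P x%:C).
Proof.
move=> i k.
have -> : (fun z : plane => mxev P z.1%:C i k) = fun z => (P i k).[(plane_coord false z)%:C].
  by apply/funext => z; rewrite mxE.
exact: kernel_smooth_poly.
Qed.

Lemma kernel_smooth_y_poly P : kernel_smooth_y (fun x => mxev P x%:C).
Proof.
move=> i k.
have -> : (fun z : plane => mxev P z.2%:C i k) = fun z => (P i k).[(plane_coord true z)%:C].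
  by apply/funext => z; rewrite mxE.
exact: kernel_smooth_poly.
Qed.

Lemma kernel_smooth_yM P Q : kernel_smooth_y P -> kernel_smooth_y Q ->
  kernel_smooth_y (fun y => P y *m Q y).
Proof.
move=> nP nQ i k.
have -> : (fun z : plane => (P z.2 *m Q z.2) i k) =
  fun z => \sum_j P z.2 i j * Q z.2 j k by apply/funext => z; rewrite mxE.
by apply: kernel_smooth_sum => j _; apply: kernel_smoothM; [exact: nP|exact: nQ].
Qed.

Lemma kernel_smooth_yD P Q : kernel_smooth_y P -> kernel_smooth_y Q ->
  kernel_smooth_y (fun y => P y + Q y).
Proof.
move=> nP nQ i k.
have -> : (fun z : plane => (P z.2 + Q z.2) i k) =
  fun z => P z.2 i k + Q z.2 i k by apply/funext => z; rewrite mxE.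
by apply: kernel_smoothD; [exact: nP|exact: nQ].
Qed.

Lemma kernel_smooth_y_cst A : kernel_smooth_y (fun=> A).
Proof. by move=> i k; exact: kernel_smooth_cst. Qed.

Lemma kernel_smooth_yZ (f : R -> C) Q : kernel_smooth (fun z => f z.2) ->
  kernel_smooth_y Q ->
  kernel_smooth_y (fun y => f y *: Q y).
Proof.
move=> nf nQ i k.
have -> : (fun z : plane => (f z.2 *: Q z.2) i k) = fun z => f z.2 * Q z.2 i k.
  by apply/funext => z; rewrite mxE.
by apply: kernel_smoothM => //; exact: nQ.
Qed.

Lemma near_smooth_term P Q i j k l k' l' : kernel_smooth_x P -> kernel_smooth_y Q ->
  near_smooth (u k l) (fun z => P z.1 i k' * Q z.2 j l').
Proof. by move=> nP nQ; apply: near_smoothM; [exact: nP|exact: nQ]. Qed.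

Lemma kformDl P P' Q : kernel_smooth_x P -> kernel_smooth_x P' -> kernel_smooth_y Q ->
  kform u (fun x => P x + P' x) Q = kform u P Q + kform u P' Q.
Proof.
move=> nP nP' nQ; apply/matrixP => i j; rewrite !mxE -big_split /=.
apply: eq_bigr => k _; rewrite -big_split /=; apply: eq_bigr => l _.
rewrite -dpairD; [|exact: near_smooth_term|exact: near_smooth_term].
by congr (Defs.dpair _ _); apply/funext => z; rewrite mxE mulrDl.
Qed.

Lemma kformDr P Q Q' : kernel_smooth_x P -> kernel_smooth_y Q -> kernel_smooth_y Q' ->
  kform u P (fun y => Q y + Q' y) = kform u P Q + kform u P Q'.
Proof.
move=> nP nQ nQ'; apply/matrixP => i j; rewrite !mxE -big_split /=.
apply: eq_bigr => k _; rewrite -big_split /=; apply: eq_bigr => l _.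
rewrite -dpairD; [|exact: near_smooth_term|exact: near_smooth_term].
by congr (Defs.dpair _ _); apply/funext => z; rewrite mxE mulrDr.
Qed.

Lemma kformMl A P Q : kernel_smooth_x P -> kernel_smooth_y Q ->
  kform u (fun x => A *m P x) Q = A *m kform u P Q.
Proof.
move=> nP nQ; apply/matrixP => i j; rewrite !mxE.
transitivity (\sum_k \sum_l \sum_m A i m * Defs.dpair (u k l) (fun z => P z.1 m k * Q z.2 j l)).
  apply: eq_bigr => k _; apply: eq_bigr => l _.
  have -> : (fun z : plane => (A *m P z.1) i k * Q z.2 j l) =
      fun z => \sum_m A i m * (P z.1 m k * Q z.2 j l).
    by apply/funext => z; rewrite mxE mulr_suml; apply: eq_bigr => m _; rewrite mulrA.
  rewrite dpair_sum => [|m _]; last by apply: near_smoothZ; exact: near_smooth_term.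
  by apply: eq_bigr => m _; rewrite dpairZ//; exact: near_smooth_term.
transitivity (\sum_m \sum_k \sum_l A i m * Defs.dpair (u k l) (fun z => P z.1 m k * Q z.2 j l)).
  rewrite [RHS]exchange_big /=; apply: eq_bigr => k _.
  by rewrite exchange_big.
apply: eq_bigr => m _; rewrite mxE mulr_sumr; apply: eq_bigr => k _.
by rewrite mulr_sumr.
Qed.

Lemma kformMr A P Q : kernel_smooth_x P -> kernel_smooth_y Q ->
  kform u P (fun y => A *m Q y) = kform u P Q *m A^T.
Proof.
move=> nP nQ; apply/matrixP => i j; rewrite !mxE.
transitivity (\sum_k \sum_l \sum_m Defs.dpair (u k l) (fun z => P z.1 i k * Q z.2 m l) * A j m).
  apply: eq_bigr => k _; apply: eq_bigr => l _.
  have -> : (fun z : plane => P z.1 i k * (A *m Q z.2) j l) =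
      fun z => \sum_m A j m * (P z.1 i k * Q z.2 m l).
    by apply/funext => z; rewrite mxE mulr_sumr; apply: eq_bigr => m _; rewrite mulrCA.
  rewrite dpair_sum => [|m _]; last by apply: near_smoothZ; exact: near_smooth_term.
  by apply: eq_bigr => m _; rewrite dpairZ 1?mulrC//; exact: near_smooth_term.
transitivity (\sum_m \sum_k \sum_l Defs.dpair (u k l) (fun z => P z.1 i k * Q z.2 m l) * A j m).
  rewrite [RHS]exchange_big /=; apply: eq_bigr => k _.
  by rewrite exchange_big.
apply: eq_bigr => m _; rewrite !mxE mulr_suml; apply: eq_bigr => k _.
by rewrite mulr_suml.
Qed.

Lemma kform_eqr P Q Q' (V : set plane) : kernel_smooth_x P -> kernel_smooth_y Q ->
  open V ->
  ksupp u `<=` V -> (forall z, V z -> Q z.2 = Q' z.2) -> kform u P Q = kform u P Q'.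
Proof.
move=> nP nQ oV uV QQ; apply/matrixP => i j; rewrite !mxE.
apply: eq_bigr => k _; apply: eq_bigr => l _.
apply: (dpair_eq oV) => //.
- by move=> t wt; apply: uV; exists k, l.
- by move=> z Vz; rewrite QQ.
- exact: near_smooth_term.
Qed.

End KernelForm.

(** * Taylor coefficients of polynomials *)

Section TaylorCoefficients.
Variable R : realType.
Local Notation C := R[i].
Implicit Types (q r : {poly C}) (x : C).

Definition tcoef x (k : nat) q : C := q^`(k).[x] / k`!%:R.

Lemma factr_neq0 k : (k`!)%:R != 0 :> C.
Proof. by rewrite pnatr_eq0 -lt0n fact_gt0. Qed.

Lemma derivn_shift x k q :
  (q \Po ('X + x%:P))^`(k) = q^`(k) \Po ('X + x%:P).
Proof.
elim: k q => [//|k IH] q.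
by rewrite !derivSn deriv_comp derivD derivX derivC addr0 mulr1 IH.
Qed.

(** Translating the variable turns Taylor coefficients into coefficients, and
    the Leibniz rule into the product of polynomials. *)
Lemma tcoefE x k q : tcoef x k q = (q \Po ('X + x%:P))`_k.
Proof.
apply: (mulIf (factr_neq0 k)); rewrite /tcoef divfK ?factr_neq0//.
have -> : q^`(k).[x] = (q \Po ('X + x%:P))^`(k).[0].
  by rewrite derivn_shift horner_comp hornerD hornerX hornerC add0r.
by rewrite horner_coef0 coef_derivn addn0 ffactnn mulr_natr.
Qed.

Lemma tcoefD x k q r : tcoef x k (q + r) = tcoef x k q + tcoef x k r.
Proof. by rewrite !tcoefE linearD coefD. Qed.

Lemma tcoefZ x k c q : tcoef x k (c *: q) = c * tcoef x k q.
Proof. by rewrite !tcoefE linearZ coefZ. Qed.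

Lemma tcoef0 x k : tcoef x k 0 = 0.
Proof. by rewrite tcoefE linear0 coef0. Qed.

Lemma tcoef_sum x k J (s : seq J) (P : pred J) (F : J -> {poly C}) :
  tcoef x k (\sum_(j <- s | P j) F j) = \sum_(j <- s | P j) tcoef x k (F j).
Proof.
rewrite tcoefE linear_sum coef_sum; apply: eq_bigr => j _; by rewrite tcoefE.
Qed.

Lemma tcoefM x k q r : tcoef x k (q * r) = \sum_(i < k.+1) tcoef x i q * tcoef x (k - i)
  r.
Proof.
by rewrite tcoefE comp_polyM coefM; apply: eq_bigr => i _; rewrite !tcoefE.
Qed.

Lemma comp_XsubC x : ('X - x%:P) \Po ('X + x%:P) = 'X.
Proof. by rewrite comp_polyB comp_polyX comp_polyC addrK. Qed.

Lemma tcoef_XsubM x k q : tcoef x k.+1 (('X - x%:P) * q) = tcoef x k q.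
Proof. by rewrite !tcoefE comp_polyM comp_XsubC coefXM. Qed.

Lemma tcoef_XsubM0 x q : tcoef x 0 (('X - x%:P) * q) = 0.
Proof. by rewrite !tcoefE comp_polyM comp_XsubC coefXM. Qed.

Lemma tcoef_dvd x n q : reflect (forall k, (k < n)%N -> tcoef x k q = 0)
  (('X - x%:P) ^+ n %| q).
Proof.
apply: (iffP idP) => [/Pdiv.Field.dvdpP[r ->] k kn|].
  by rewrite tcoefE comp_polyM rmorphXn /= comp_XsubC coefMXn kn.
elim: n q => [|n IH] q H; first by rewrite expr0 dvd1p.
have /factor_theorem[r Er] : root q x.
  by have := H 0%N isT; rewrite /tcoef derivn0 fact0 divr1 rootE => ->.
rewrite Er exprSr dvdp_mul2r ?polyXsubC_eq0//; apply: IH => k kn.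
by rewrite -tcoef_XsubM mulrC -Er H.
Qed.

End TaylorCoefficients.

(** * Evaluation and Taylor coefficients of polynomial matrices *)

Section MatrixEvaluation.
Variable R : realType.
Local Notation C := R[i].
Local Notation cmx := (map_mx polyC).

Lemma mxevE m n (A : 'M[{poly C}]_(m, n)) x : mxev A x = map_mx (horner_eval x) A.
Proof. by apply/matrixP => i j; rewrite !mxE. Qed.

Lemma mxevM m n k (A : 'M[{poly C}]_(m, n)) (B : 'M[{poly C}]_(n, k)) x :
  mxev (A *m B) x = mxev A x *m mxev B x.
Proof. by rewrite !mxevE map_mxM. Qed.

Lemma mxevD m n (A B : 'M[{poly C}]_(m, n)) x : mxev (A + B) x = mxev A x + mxev B x.
Proof. by rewrite !mxevE map_mxD. Qed.

Lemma mxevT m n (A : 'M[{poly C}]_(m, n)) x : mxev A^T x = (mxev A x)^T.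
Proof. by apply/matrixP => i j; rewrite !mxE. Qed.

Lemma mxev_cst m n (A : 'M[C]_(m, n)) x : mxev (cmx A) x = A.
Proof. by apply/matrixP => i j; rewrite !mxE hornerC. Qed.

Lemma mxevZ m n q (A : 'M[{poly C}]_(m, n)) x : mxev (q *: A) x = q.[x] *: mxev A x.
Proof. by apply/matrixP => i j; rewrite !mxE hornerM. Qed.

Lemma mxev0 m n x : mxev (0 : 'M[{poly C}]_(m, n)) x = 0.
Proof. by apply/matrixP => i j; rewrite !mxE horner0. Qed.

Lemma mxev_sum m n J (s : seq J) (P : pred J) (F : J -> 'M[{poly C}]_(m, n)) x :
  mxev (\sum_(j <- s | P j) F j) x = \sum_(j <- s | P j) mxev (F j) x.
Proof. by apply: (big_morph (fun A => mxev A x)) => [A B|]; [exact: mxevD|exact: mxev0]. Qed.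

Lemma det_mxev n (A : 'M[{poly C}]_n) x : \det (mxev A x) = (\det A).[x].
Proof. by rewrite mxevE det_map_mx. Qed.

Definition mxtcoef m n (x : C) (k : nat) (A : 'M[{poly C}]_(m, n)) : 'M[C]_(m, n) :=
  (k`!)%:R^-1 *: mxderivn A k x.

Lemma mxtcoefE m n x k (A : 'M[{poly C}]_(m, n)) i j :
  mxtcoef x k A i j = tcoef x k (A i j).
Proof. by rewrite !mxE mulrC. Qed.

Lemma mxtcoefD m n x k (A B : 'M[{poly C}]_(m, n)) :
  mxtcoef x k (A + B) = mxtcoef x k A + mxtcoef x k B.
Proof. by apply/matrixP => i j; rewrite [RHS]mxE !mxtcoefE mxE tcoefD. Qed.

Lemma mxtcoef0 m n x k : mxtcoef x k (0 : 'M[{poly C}]_(m, n)) = 0.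
Proof. by apply/matrixP => i j; rewrite mxtcoefE !mxE tcoef0. Qed.

Lemma mxtcoef_sum m n x k J (s : seq J) (P : pred J) (F : J -> 'M[{poly C}]_(m, n)) :
  mxtcoef x k (\sum_(j <- s | P j) F j) = \sum_(j <- s | P j) mxtcoef x k (F j).
Proof. by apply: (big_morph (mxtcoef x k)) => [A B|]; [exact: mxtcoefD|exact: mxtcoef0]. Qed.

Lemma mxtcoefMr m n r x k (A : 'M[{poly C}]_(m, n)) (B : 'M[C]_(n, r)) :
  mxtcoef x k (A *m cmx B) = mxtcoef x k A *m B.
Proof.
apply/matrixP => i j; rewrite mxtcoefE !mxE tcoef_sum; apply: eq_bigr => l _.
by rewrite mxtcoefE mxE mulrC mul_polyC tcoefZ mulrC.
Qed.

Lemma mxtcoefZ m n x k c (A : 'M[{poly C}]_(m, n)) :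
  mxtcoef x k (c%:P *: A) = c *: mxtcoef x k A.
Proof. by apply/matrixP => i j; rewrite [RHS]mxE !mxtcoefE mxE mul_polyC tcoefZ. Qed.

End MatrixEvaluation.

(** * The difference quotient of a matrix polynomial *)

Section Bezoutian.
Variables (R : realType) (p : nat).
Local Notation C := R[i].
Local Notation mxpoly := 'M[{poly C}]_p.
Local Notation cmx := (map_mx polyC).
Implicit Types (W : mxpoly).

Lemma mxpoly_expand N W : mxpoly_monic N W ->
  W = \sum_(j < N.+1) 'X^j *: cmx (mxcoef W j).
Proof.
move=> [_ W0]; apply/matrixP => i k; rewrite summxE; apply/polyP => d.
rewrite coef_sum (eq_bigr (fun j : 'I_N.+1 => (d == j)%:R * (W i k)`_j)); last first.
  by move=> j _; rewrite !mxE coefMC coefXn.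
have [dN|dN] := ltnP d N.+1.
  rewrite (bigD1 (Ordinal dN)) //= eqxx mul1r big1 ?addr0// => j /negbTE jd.
  by rewrite -(inj_eq val_inj) /= eq_sym in jd; rewrite jd mul0r.
have := W0 d dN => /matrixP/(_ i k); rewrite !mxE => ->.
rewrite big1// => j _; rewrite gtn_eqF ?mul0r//.
exact: leq_trans (ltn_ord j) dN.
Qed.

(** The bezoutian at z as a polynomial in its other variable y; transposed,
    since this is how it occurs as a second argument of the forms. *)
Definition bezoutian_poly W (N : nat) (z : C) : mxpoly :=
  \sum_(1 <= j < N.+1) \sum_(i < j)
    (z ^+ i)%:P *: (cmx (mxcoef W j)^T *m ('X^(j.-1 - i))%:M).

Lemma mxev_bezoutian_poly W N z y : mxev (bezoutian_poly W N z) y = (bezoutian W N z y)^T.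
Proof.
rewrite /bezoutian_poly /bezoutian mxev_sum raddf_sum; apply: eq_bigr => j _.
rewrite mxev_sum raddf_sum; apply: eq_bigr => i _.
rewrite mxevZ hornerC mul_mx_scalar mxevZ mxev_cst hornerXn scalerA.
by rewrite [RHS]linearZ.
Qed.

Lemma bezoutianE N W z y : mxpoly_monic N W ->
  (z - y) *: bezoutian W N z y = mxev W z - mxev W y.
Proof.
move=> mW.
have E t : mxev W t = \sum_(0 <= j < N.+1) t ^+ j *: mxcoef W j.
  rewrite big_mkord {1}(mxpoly_expand mW) mxev_sum; apply: eq_bigr => j _.
  by rewrite mxevZ mxev_cst hornerXn.
rewrite !E -sumrB big_nat_recl// !expr0 subrr add0r /bezoutian scaler_sumr.
rewrite big_add1 /=; apply: eq_bigr => j _.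
rewrite -scalerBl subrXX -scaler_suml scalerA; congr (_ * _ *: _).
rewrite (reindex_inj rev_ord_inj) /=; apply: eq_bigr => i _.
by rewrite subSS subKn// -ltnS.
Qed.

Lemma mul_bezoutian_poly N W z : mxpoly_monic N W ->
  ('X - z%:P) *: (bezoutian_poly W N z)^T = W - cmx (mxev W z).
Proof.
move=> mW; apply/matrixP => i j; apply/eqP; rewrite -subr_eq0;
  apply/negPn/negP => /closed_nonrootP[y].
apply/negP; rewrite negbK rootE.
have := bezoutianE z y mW => /matrixP/(_ i j); rewrite -(trmxK (bezoutian _ _ _ _)).
rewrite -mxev_bezoutian_poly !mxE !hornerE => H.
by rewrite -[y - z]opprB mulNr H opprB subrr.
Qed.

End Bezoutian.

(** * The form of the transformed kernel *)

Section HatForm.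
Variables (R : realType) (p : nat).
Local Notation C := R[i].
Local Notation plane := (R * R)%type.
Local Notation mxpoly := 'M[{poly C}]_p.
Local Notation cmx := (map_mx polyC).
Variable u : 'I_p -> 'I_p -> plane_distribution R.
Hypothesis u_suppx : bounded_set (ksupp_x u).
Hypothesis u_suppy : bounded_set (ksupp_y u).
Variables (WC WG : mxpoly) (N : nat).
Hypothesis WG_monic : mxpoly_monic N WG.
Hypothesis detWG : \det WG != 0.
Variable (D : spectral_data R p).
Hypothesis hD : is_spectral_data WG D.
Hypothesis WG_supp : forall y : R, ksupp_y u y -> ~~ root (\det WG) y%:C.
Variable xi : masses R p.

Lemma off_supp_root k l z : root (\det WG) z -> off_supp (u k l) z.
Proof.
move=> rz; apply: off_supp_notin; first exact: ksupp_bounded.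
move=> t wt; apply: contraTneq rz => ->; apply: WG_supp.
by exists t => //; exists k, l.
Qed.

(** The points where the resolvent can be paired with the kernel; the roots of
    det W_G are among them. *)
Definition regular_set (z : C) : Prop := forall k l, off_supp (u k l) z.

Lemma regular_open : copen regular_set.
Proof.
rewrite /copen openE => z Uz.
change (nbhs (z : C^o) [set z | forall k l, off_supp (u k l) z]).
have : \forall z \near nbhs (z : C^o), forall k l, off_supp (u k l) z; last by [].
apply: filter_forall => k; apply: filter_forall => l.
by apply: open_nbhs_nbhs; split; [exact: off_supp_open|exact: Uz].
Qed.

Lemma kernel_smooth_resolvent z : regular_set z ->
  kernel_smooth u (fun t => (z - t.2%:C)^-1).
Proof.
move=> Uz k l.
by have := near_smooth_resolvent (ksupp_bounded u_suppx u_suppy k l) 1 (Uz k l).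
Qed.

(** det W_G is a product of linear factors, so its reciprocal is a product of
    resolvents at points off the support. *)
Lemma kernel_smooth_detV : kernel_smooth u (fun t => ((\det WG).[t.2%:C])^-1).
Proof.
have [r Er] := closed_field_poly_normal (\det WG).
have rr z : z \in r -> root (\det WG) z.
  by move=> zr; rewrite Er rootZ ?lead_coef_eq0// root_prod_XsubC.
have -> : (fun t : plane => ((\det WG).[t.2%:C])^-1) =
    fun t => (lead_coef (\det WG))^-1 * \prod_(z <- r | z \in r) (- 1 * (z - t.2%:C)^-1).
  apply/funext => t; rewrite {1}Er hornerZ invfM horner_prod -big_seq -prodfV.
  congr (_ * _); apply: eq_bigr => z _.
  by rewrite hornerXsubC mulN1r -invrN opprB.
apply: kernel_smoothM; first exact: kernel_smooth_cst.
apply: (kernel_smooth_prod u_suppx u_suppy) => z /rr rz; apply: kernel_smoothM;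
  first exact: kernel_smooth_cst.
by apply: kernel_smooth_resolvent => k l; exact: off_supp_root.
Qed.

Lemma WG_inv_eq (y : R) : (\det WG).[y%:C] != 0 ->
  invmx (mxev WG y%:C) = ((\det WG).[y%:C])^-1 *: mxev (\adj WG) y%:C.
Proof.
move=> d0; rewrite /invmx unitmxE det_mxev unitfE d0; congr (_ *: _).
by rewrite !mxevE map_mx_adj.
Qed.

Definition regular_strip : set plane := [set t : plane | (\det WG).[t.2%:C] != 0].

Lemma regular_strip_open : open regular_strip.
Proof. exact: csmooth_neq0_open (csmooth_poly (\det WG) true). Qed.

Lemma supp_regular_strip : ksupp u `<=` regular_strip.
Proof. by move=> t ut; rewrite /regular_strip /= -rootE; apply: WG_supp; exists t. Qed.

Lemma kernel_smooth_y_WG_inv : kernel_smooth_y u (fun y => (invmx (mxev WG y%:C))^T).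
Proof.
move=> i j k l.
apply: (@near_smooth_eq _ _ (fun t : plane => ((\det WG).[t.2%:C])^-1 * (\adj WG j i).[t.2%:C])
   _ regular_strip).
- exact: regular_strip_open.
- by move=> t wt; apply: supp_regular_strip; exists k, l.
- by move=> t Ht; rewrite mxE WG_inv_eq// !mxE.
- apply: near_smoothM; first exact: kernel_smooth_detV.
  exact: (kernel_smooth_poly u_suppx u_suppy true).
Qed.

Lemma pform_left A P P' Q :
  pform u (cmx A *m P + P') Q = A *m pform u P Q + pform u P' Q.
Proof.
rewrite /pform -kformMl; [|exact: kernel_smooth_x_poly|exact: kernel_smooth_y_poly].
have -> : (fun x : R => mxev (cmx A *m P + P') x%:C) =
  fun x : R => A *m mxev P x%:C + mxev P' x%:C.
  by apply/funext => x; rewrite mxevD mxevM mxev_cst.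
apply: kformDl; [|exact: kernel_smooth_x_poly|exact: kernel_smooth_y_poly].
have := kernel_smooth_x_poly u_suppx u_suppy (cmx A *m P).
by congr (kernel_smooth_x _ _); apply/funext => x; rewrite mxevM mxev_cst.
Qed.

Lemma pform_right A P Q Q' :
  pform u P (cmx A *m Q + Q') = pform u P Q *m A^T + pform u P Q'.
Proof.
rewrite /pform -kformMr; [|exact: kernel_smooth_x_poly|exact: kernel_smooth_y_poly].
have -> : (fun x : R => mxev (cmx A *m Q + Q') x%:C) =
  fun x : R => A *m mxev Q x%:C + mxev Q' x%:C.
  by apply/funext => x; rewrite mxevD mxevM mxev_cst.
apply: kformDr; [exact: kernel_smooth_x_poly| |exact: kernel_smooth_y_poly].
have := kernel_smooth_y_poly u_suppx u_suppy (cmx A *m Q).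
by congr (kernel_smooth_y _ _); apply/funext => x; rewrite mxevM mxev_cst.
Qed.

Lemma mass_pair_left A P P' (x : 'I_p -> {scalar {poly C}}) :
  mass_pair (cmx A *m P + P') x = A *m mass_pair P x + mass_pair P' x.
Proof.
apply/matrixP => i j; rewrite !mxE.
under eq_bigr do rewrite !mxE linearD.
rewrite big_split /=; congr (_ + _).
under [RHS]eq_bigr do rewrite mxE mulr_sumr.
rewrite [RHS]exchange_big; apply: eq_bigr => k _.
by rewrite linear_sum; apply: eq_bigr => m _; rewrite mxE mul_polyC linearZ.
Qed.

Definition mass_term (P Q : mxpoly) : 'M[C]_p :=
  \sum_(a < sd_q D) \sum_(j < sd_s D a) \sum_(m < sd_kap D a j)
      mass_pair P (xi a j m) *m mxtcoef (sd_x D a) m (sd_l D a j *m Q^T).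

Lemma hat_formE P Q : hat_form u WC WG D xi P Q =
  kform u (fun x => mxev (P *m WC) x%:C)
          (fun y => mxev Q y%:C *m (invmx (mxev WG y%:C))^T) +
  mass_term (P *m WC) Q.
Proof. by []. Qed.

Lemma mass_term_left A P P' Q :
  mass_term (cmx A *m P + P') Q = A *m mass_term P Q + mass_term P' Q.
Proof.
rewrite /mass_term mulmx_sumr -big_split; apply: eq_bigr => a _.
rewrite mulmx_sumr -big_split; apply: eq_bigr => j _.
rewrite mulmx_sumr -big_split; apply: eq_bigr => m _.
by rewrite mass_pair_left mulmxDl mulmxA.
Qed.

Lemma mass_term_right A P Q Q' :
  mass_term P (cmx A *m Q + Q') = mass_term P Q *m A^T + mass_term P Q'.
Proof.
rewrite /mass_term mulmx_suml -big_split; apply: eq_bigr => a _.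
rewrite mulmx_suml -big_split; apply: eq_bigr => j _.
rewrite mulmx_suml -big_split; apply: eq_bigr => m _.
rewrite linearD /= trmx_mul map_trmx mulmxDr mulmxA mxtcoefD mxtcoefMr mulmxDr.
by rewrite mulmxA.
Qed.

Let kernel_smooth_y_quot Q : kernel_smooth_y u (fun y : R => mxev Q y%:C *m (invmx (mxev
  WG y%:C))^T).
Proof. by apply: kernel_smooth_yM;
  [exact: kernel_smooth_y_poly|exact: kernel_smooth_y_WG_inv]. Qed.

Lemma hat_form_left A P P' Q :
  hat_form u WC WG D xi (cmx A *m P + P') Q =
  A *m hat_form u WC WG D xi P Q + hat_form u WC WG D xi P' Q.
Proof.
rewrite !hat_formE mulmxDl -mulmxA mass_term_left mulmxDr addrACA; congr (_ + _).
rewrite -kformMl; [|exact: kernel_smooth_x_poly|exact: kernel_smooth_y_quot].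
have -> : (fun x : R => mxev (cmx A *m (P *m WC) + P' *m WC) x%:C) =
  fun x : R => A *m mxev (P *m WC) x%:C + mxev (P' *m WC) x%:C.
  by apply/funext => x; rewrite mxevD mxevM mxev_cst.
apply: kformDl; [|exact: kernel_smooth_x_poly|exact: kernel_smooth_y_quot].
have := kernel_smooth_x_poly u_suppx u_suppy (cmx A *m (P *m WC)).
by congr (kernel_smooth_x _ _); apply/funext => x; rewrite mxevM mxev_cst.
Qed.

Lemma hat_form_right A P Q Q' :
  hat_form u WC WG D xi P (cmx A *m Q + Q') =
  hat_form u WC WG D xi P Q *m A^T + hat_form u WC WG D xi P Q'.
Proof.
rewrite !hat_formE mass_term_right mulmxDl addrACA; congr (_ + _).
rewrite -kformMr; [|exact: kernel_smooth_x_poly|exact: kernel_smooth_y_quot].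
have -> : (fun y : R => mxev (cmx A *m Q + Q') y%:C *m (invmx (mxev WG y%:C))^T) =
  fun y : R => A *m (mxev Q y%:C *m (invmx (mxev WG y%:C))^T) +
           mxev Q' y%:C *m (invmx (mxev WG y%:C))^T.
  by apply/funext => y; rewrite mxevD mxevM mxev_cst mulmxDl mulmxA.
apply: kformDr; [exact: kernel_smooth_x_poly| |exact: kernel_smooth_y_quot].
by apply: kernel_smooth_yM; [exact: kernel_smooth_y_cst|exact: kernel_smooth_y_quot].
Qed.

(** Near the support W_G^T cancels the inverse of W_G, and l W_G Q^T vanishes
    at each node to the order of the jets, so that the masses do not
    contribute. *)
Lemma hat_form_mulWG P Q :
  hat_form u WC WG D xi P (Q *m WG^T) = pform u (P *m WC) Q.
Proof.
rewrite hat_formE [X in _ + X]big1 ?addr0.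
  apply: (@kform_eqr _ _ u _ _ _ regular_strip);
    [exact: kernel_smooth_x_poly|exact: kernel_smooth_y_quot
    |exact: regular_strip_open|exact: supp_regular_strip|].
  move=> t Ht; rewrite mxevM mxevT -mulmxA -trmx_mul mulVmx ?trmx1 ?mulmx1//.
  by rewrite unitmxE det_mxev unitfE.
move=> a _; rewrite big1// => j _; rewrite big1// => m _.
rewrite trmx_mul trmxK mulmxA.
suff -> : mxtcoef (sd_x D a) m (sd_l D a j *m WG *m Q^T) = 0 by rewrite mulmx0.
apply/matrixP => i k; rewrite mxtcoefE !mxE.
apply: (elimT (tcoef_dvd (sd_x D a) (sd_kap D a j) _)) => //.
apply: (big_ind (fun q => dvdp _ q)) => [|f g|l _];
  [exact: dvdp0|exact: dvdp_add|].
by apply: dvdp_mulr; rewrite (ord1 i); apply: (sd_l_root hD).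
Qed.

Definition resolvent_form (P : mxpoly) (z : C) : 'M[C]_p :=
  kform u (fun x => mxev P x%:C)
     (fun y => (z - y%:C)^-1 *: (invmx (mxev WG y%:C))^T).

(** Multiplying (z - y) V(z, y) = W_G(z) - W_G(y) on the left by W_G(y)^{-1} /
    (z - y) expresses I/(z - y) through W_G(y)^{-1} W_G(z) / (z - y) and
    W_G(y)^{-1} V(z, y). The latter gives the transformed form without its
    masses, which are therefore added. *)
Lemma second_kind_hat P z : regular_set z ->
  second_kind u (P *m WC) z =
  resolvent_form (P *m WC) z *m mxev WG z
  + mass_term (P *m WC) (bezoutian_poly WG N z)
  - hat_form u WC WG D xi P (bezoutian_poly WG N z).
Proof.
move=> Uz; rewrite hat_formE opprD addrACA subrr addr0.
have nR : kernel_smooth_y u (fun y : R => (z - y%:C)^-1 *: (invmx (mxev WG y%:C))^T).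
  by apply: kernel_smooth_yZ; [exact: kernel_smooth_resolvent|exact: kernel_smooth_y_WG_inv].
rewrite -[mxev WG z]trmxK -kformMr; [|exact: kernel_smooth_x_poly|exact: nR].
set K2 := kform u _ (fun y => mxev (bezoutian_poly _ _ _) _ *m _).
have -> : - K2 = K2 *m (- 1%:M)^T by rewrite linearN /= trmx1 mulmxN mulmx1.
rewrite /K2 -kformMr; [|exact: kernel_smooth_x_poly|exact: kernel_smooth_y_quot].
rewrite -kformDr; [|exact: kernel_smooth_x_poly| |]; last 2 first.
- by apply: kernel_smooth_yM; [exact: kernel_smooth_y_cst|exact: nR].
- by apply: kernel_smooth_yM; [exact: kernel_smooth_y_cst|exact: kernel_smooth_y_quot].
apply/esym.
have cz : csmooth (fun t : plane => z + (-1) * (plane_coord true t)%:C).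
  apply: csmoothD; first exact: csmooth_cst.
  exact: csmoothM (csmooth_cst _) (csmooth_coord _ true).
apply: (@kform_eqr _ _ u _ _ _ (regular_strip `&` [set t : plane | z + (-1) * (plane_coord true
  t)%:C != 0])).
- exact: kernel_smooth_x_poly.
- by apply: kernel_smooth_yD; apply: kernel_smooth_yM; (try exact: kernel_smooth_y_cst);
  [exact: nR|exact: kernel_smooth_y_quot].
- apply: openI; first exact: regular_strip_open.
  exact: csmooth_neq0_open cz.
- move=> t ut; split; first exact: supp_regular_strip.
  have [k [l wt]] := ut; have [rho r0 /(_ t wt) H] := Uz k l.
  rewrite /= mulN1r; apply: contraTneq H => ->.
  by rewrite -ltNge /= expr0n /= addr0 sqrtr0.
move=> t [Ht]; rewrite /= mulN1r => nz.
rewrite mulNmx mul1mx mxev_bezoutian_poly -scalemxAr.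
apply: (scalerI nz); rewrite scalerBr !scalerA divff// scale1r.
rewrite scale_scalar_mx divff//.
rewrite scalemxAl -linearZ /= bezoutianE// linearB /= mulmxBl opprB addrCA subrr addr0.
rewrite -trmx_mul mulVmx ?trmx1//.
by rewrite unitmxE det_mxev unitfE.
Qed.

End HatForm.

(** * The degree of the determinant of a monic matrix polynomial *)

Section DetDegree.
Variables (R : realType) (p : nat).
Local Notation C := R[i].
Implicit Types (W : 'M[{poly C}]_p).

Lemma coefM_top (a b : nat) (f g : {poly C}) : (size f <= a.+1)%N -> (size g <= b.+1)%N ->
  (f * g)`_(a + b) = f`_a * g`_b.
Proof.
move=> fa gb; rewrite coefM.
have ab : (a < (a + b).+1)%N by rewrite ltnS leq_addr.
rewrite (bigD1 (Ordinal ab)) //= addKn big1 ?addr0// => j.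
rewrite -(inj_eq val_inj) /= => ja.
have [lt|lt|E] := ltngtP j a; last by rewrite E eqxx in ja.
  rewrite [g`__]nth_default ?mulr0// (leq_trans gb)// ltn_subRL.
  by rewrite ltn_add2r.
by rewrite nth_default ?mul0r// (leq_trans fa).
Qed.

Lemma prod_top_coef (N : nat) (J : Type) (r : seq J) (F : J -> {poly C}) :
  (forall j, (size (F j) <= N.+1)%N) ->
  (size (\prod_(j <- r) F j)%R <= (N * size r).+1)%N /\
  (\prod_(j <- r) F j)`_(N * size r)%N = \prod_(j <- r) (F j)`_N.
Proof.
move=> FN; elim: r => [|j r [IH1 IH2]].
  by rewrite !big_nil /= muln0 size_poly1 coef1.
rewrite !big_cons /= mulnS; split; last by rewrite coefM_top// IH2.
apply: (leq_trans (size_polyMleq _ _)).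
have := leq_add (FN j) IH1; rewrite addSn addnS => H.
by case: (size (F j) + _)%N H => // m; rewrite /= ltnS => /leq_trans; apply.
Qed.

Lemma mxpoly_monic_size N W : mxpoly_monic N W -> forall i j, (size (W i j) <= N.+1)%N.
Proof.
move=> [_ W0] i j; apply/leq_sizeP => k Nk.
by have /matrixP/(_ i j) := W0 k Nk; rewrite !mxE.
Qed.

Lemma size_index_ord n : size (index_enum 'I_n) = n.
Proof. by rewrite -[RHS](card_ord n) cardT enumT. Qed.

(** Only the coefficients of order N of the entries contribute to that of
    order N p of det W, which is thus the determinant of the leading
    coefficient. *)
Lemma size_det_monic N W : mxpoly_monic N W -> size (\det W) = (N * p).+1.
Proof.
move=> mW; have sW := mxpoly_monic_size mW.
have H (s : 'I_p -> 'I_p) : (size (\prod_i W i (s i))%R <= (N * p).+1)%N /\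
    (\prod_i W i (s i))`_(N * p)%N = \prod_i (W i (s i))`_N.
  have := @prod_top_coef N _ (index_enum 'I_p) (fun i => W i (s i)) (fun i => sW i (s i)).
  by rewrite size_index_ord.
have c1 : (\det W)`_(N * p)%N = 1.
  rewrite /determinant coef_sum -(det1 C p) -mW.1 /determinant.
  apply: eq_bigr => s _;
  have -> : (\prod_i mxcoef W N i (s i)) = (\prod_i W i (s i))`_(N * p)%N.
    by rewrite (H s).2; apply: eq_bigr => i _; rewrite mxE.
  by case: (odd_perm s); rewrite ?expr0 ?expr1 ?mul1r// !mulN1r coefN.
apply/eqP; rewrite eqn_leq; apply/andP; split; last first.
  by rewrite ltnNge; apply/negP => /leq_sizeP/(_ _ (leqnn _)) /eqP; rewrite c1 oner_eq0.
apply: (leq_trans (size_sum _ _ _)); apply/bigmax_leqP => s _.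
by case: (odd_perm s); rewrite ?expr1 ?expr0 ?mulN1r ?mul1r ?size_polyN (H s).1.
Qed.

End DetDegree.

(** * Counting the root spectral jets *)

Lemma sum_nth_padded (s : seq nat) n : (size s <= n)%N ->
  (\sum_(i < n) nth 0 s i)%N = sumn s.
Proof.
move=> sn; rewrite sumnE (big_nth 0%N) big_mkord -(subnKC sn) big_split_ord /=.
rewrite [X in (_ + X)%N]big1 ?addn0// => i _.
by rewrite nth_default// leq_addr.
Qed.

Section JetIndex.
Variables (R : realType) (p : nat).
Local Notation C := R[i].
Variables (N : nat) (W : 'M[{poly C}]_p) (D : spectral_data R p).
Hypothesis W_monic : mxpoly_monic N W.
Hypothesis hD : is_spectral_data W D.

Lemma detW_neq0 : \det W != 0.
Proof. by rewrite -size_poly_eq0 (size_det_monic W_monic). Qed.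

Lemma size_kappa a : (a < sd_q D)%N -> (size (sd_kappa D a) <= p)%N.
Proof.
by move=> aq; have [_ _ -> _] := sd_kappaP hD aq; rewrite rank_leq_row.
Qed.

Definition det_mult (a : nat) : nat := sumn (sd_kappa D a).

Lemma det_local a : (a < sd_q D)%N -> exists2 g : {poly C},
  g.[sd_x D a] != 0 & \det W = ('X - (sd_x D a)%:P) ^+ det_mult a * g.
Proof.
move=> aq; have [_ _ _ [E [F [E0 F0 EF]]]] := sd_kappaP hD aq.
exists (\det E * \det F); first by rewrite hornerM mulf_neq0.
rewrite EF !det_mulmx det_diag.
under eq_bigr do rewrite mxE.
rewrite -expr_sum.
suff -> : (\sum_(i < p) nth 0 (sd_kappa D a) i)%N = det_mult a by rewrite -mulrA mulrCA.
by rewrite sum_nth_padded// size_kappa.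
Qed.

Lemma size_jet_index_mult : size (jet_index D) = (\sum_(0 <= a < sd_q D) det_mult a)%N.
Proof.
have io n : iota 0 n = index_iota 0 n by rewrite /index_iota subn0.
rewrite /jet_index size_flatten /shape sumnE !big_map io; apply: eq_bigr => a _.
rewrite size_flatten /shape sumnE !big_map /det_mult sumnE [in RHS](big_nth 0%N) io.
by apply: eq_bigr => j _; rewrite size_map size_iota.
Qed.

Lemma prod_mult_dvd n : (n <= sd_q D)%N ->
  \prod_(0 <= a < n) ('X - (sd_x D a)%:P) ^+ det_mult a %| \det W.
Proof.
elim: n => [|n IH] nq; first by rewrite big_geq// dvd1p.
rewrite big_nat_recr//= Gauss_dvdp; last first.
  apply: coprimep_expr; rewrite coprimep_XsubC rootE horner_prod prodf_seq_neq0.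
  apply/allP => a; rewrite mem_index_iota => /andP[_ an] /=.
  rewrite horner_exp expf_neq0// hornerXsubC subr_eq0; apply/eqP => E.
  have := sd_x_inj hD nq (ltn_trans an nq) E => na.
  by rewrite na ltnn in an.
rewrite IH ?(ltnW nq)//=.
have [g _ ->] := det_local nq; exact: dvdp_mulr.
Qed.

Lemma size_prod_mult : size (\prod_(0 <= a < sd_q D) ('X - (sd_x D a)%:P) ^+ det_mult a) =
  (\sum_(0 <= a < sd_q D) det_mult a).+1.
Proof.
elim: (sd_q D) => [|n IH]; first by rewrite !big_geq// size_poly1.
rewrite !big_nat_recr//= size_mul ?IH ?size_exp_XsubC//; first last.
- by rewrite expf_neq0// polyXsubC_eq0.
- by rewrite -size_poly_eq0 IH.
by rewrite addSn addnS.
Qed.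

(** The nodes are all the roots of det W, and the local Smith forms give their
    multiplicities, so the sum is the degree of det W. *)
Lemma sum_det_mult : (\sum_(0 <= a < sd_q D) det_mult a = N * p)%N.
Proof.
apply/eqP; rewrite -eqSS -(size_det_monic W_monic) -size_prod_mult.
have /Pdiv.Field.dvdpP[h Eh] := prod_mult_dvd (leqnn _).
have h0 : h != 0 by apply: contraTneq detW_neq0 => h0; rewrite Eh h0 mul0r eqxx.
set P := \prod_(_ <= _ < _) _ in Eh *.
have P0 : P != 0 by rewrite -size_poly_eq0 /P size_prod_mult.
suff /eqP h1 : size h == 1%N by rewrite Eh size_mul// h1 add1n.
apply: contraT => /closed_rootP[z rz].
have [a aq za] := (sd_xE hD z).1 ltac:(by rewrite Eh rootM rz).
have [g g0 Eg] := det_local aq.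
have : ('X - (sd_x D a)%:P) ^+ (det_mult a).+1 %| \det W.
  rewrite Eh exprS; apply: dvdp_mul; first by rewrite dvdp_XsubCl -za.
  by rewrite /P big_mkord (bigD1 (Ordinal aq)) //= dvdp_mulIl.
rewrite Eg exprSr dvdp_mul2l ?expf_neq0 ?polyXsubC_eq0//.
by rewrite dvdp_XsubCl rootE (negbTE g0).
Qed.

Lemma size_jet_index : size (jet_index D) = (N * p)%N.
Proof. by rewrite size_jet_index_mult sum_det_mult. Qed.

Lemma sum_jet (V : nmodType) (F : nat * nat * nat -> V) :
  \sum_(c < N * p) F (jet_nth D c) =
  \sum_(a < sd_q D) \sum_(j < sd_s D a) \sum_(m < sd_kap D a j) F (a : nat, j : nat, m : nat).
Proof.
transitivity (\sum_(t <- jet_index D) F t).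
  by rewrite (big_nth (0, 0, 0)%N) big_mkord size_jet_index.
have io n : iota 0 n = index_iota 0 n by rewrite /index_iota subn0.
rewrite /jet_index big_flatten big_map io big_mkord; apply: eq_bigr => a _.
rewrite big_flatten big_map io big_mkord; apply: eq_bigr => j _.
by rewrite big_map io big_mkord.
Qed.

Lemma jet_nth_bounds (c : 'I_(N * p)) : let: (a, j, m) := jet_nth D c in
  [/\ (a < sd_q D)%N, (j < sd_s D a)%N & (m < sd_kap D a j)%N].
Proof.
have : jet_nth D c \in jet_index D by rewrite mem_nth// size_jet_index.
case: (jet_nth D c) => -[a j] m.
move=> /flattenP[s /mapP[a' + ->]]; rewrite mem_iota add0n => aq.
move=> /flattenP[s' /mapP[j' + ->]]; rewrite mem_iota add0n => js.
by move=> /mapP[m' + [-> -> ->]]; rewrite mem_iota add0n.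
Qed.

Lemma jet_nth_ex a j m : (a < sd_q D)%N -> (j < sd_s D a)%N -> (m < sd_kap D a j)%N ->
  exists c : 'I_(N * p), jet_nth D c = (a, j, m).
Proof.
move=> aq js mk.
have tin : (a, j, m) \in jet_index D.
  apply/flattenP; exists (flatten [seq [seq (a, j, m) | m <- iota 0 (sd_kap D a j)]
                       | j <- iota 0 (sd_s D a)]).
    by apply/mapP; exists a => //; rewrite mem_iota.
  apply/flattenP; exists [seq (a, j, m) | m <- iota 0 (sd_kap D a j)].
    by apply/mapP; exists j => //; rewrite mem_iota.
  by apply/mapP; exists m => //; rewrite mem_iota.
have lt : (index (a, j, m) (jet_index D) < N * p)%N by rewrite -size_jet_index index_mem.
by exists (Ordinal lt); rewrite /jet_nth /= nth_index.
Qed.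

End JetIndex.

(** * Degrees and coefficients of matrix polynomials *)

Section MatrixCoefficients.
Variables (R : realType) (p : nat).
Local Notation C := R[i].
Local Notation mxpoly := 'M[{poly C}]_p.
Local Notation cmx := (map_mx polyC).

Definition mxsize (n : nat) (f : mxpoly) : Prop := forall i j, (size (f i j) <= n)%N.

Lemma mxcoefD (A B : mxpoly) d : mxcoef (A + B) d = mxcoef A d + mxcoef B d.
Proof. by apply/matrixP => i j; rewrite !mxE coefD. Qed.

Lemma mxcoef0 d : mxcoef (0 : mxpoly) d = 0.
Proof. by apply/matrixP => i j; rewrite !mxE coef0. Qed.

Lemma mxcoef_sum d J (s : seq J) (pr : pred J) (F : J -> mxpoly) :
  mxcoef (\sum_(j <- s | pr j) F j) d = \sum_(j <- s | pr j) mxcoef (F j) d.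
Proof.
apply: (big_morph (fun A => mxcoef A d)) => [A B|]; [exact: mxcoefD|exact: mxcoef0].
Qed.

Lemma mxcoef_monomial k (A : 'M[C]_p) d :
  mxcoef ('X^k *: cmx A) d = if (d == k)%N then A else 0.
Proof.
apply/matrixP => i j; rewrite mxE.
have -> : ('X^k *: cmx A) i j = 'X^k * (A i j)%:P by rewrite mxE [X in _ * X]mxE.
by rewrite coefMC coefXn; case: eqP => _; rewrite ?mul1r ?mul0r ?mxE.
Qed.

Lemma mxcoef_poly (F : nat -> 'M[C]_p) k d :
  mxcoef (\sum_(i < k) 'X^i *: cmx (F i)) d = if (d < k)%N then F d else 0.
Proof.
rewrite mxcoef_sum; under eq_bigr do rewrite mxcoef_monomial.
case: ifP => [lt|/negbT]; last first.
  rewrite -leqNgt => le; rewrite big1// => i _; rewrite ifF//.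
  by apply/negbTE; rewrite neq_ltn (leq_trans (ltn_ord i) le) orbT.
rewrite (bigD1 (Ordinal lt)) //= eqxx big1 ?addr0// => i ii.
rewrite ifF//; apply/negbTE; apply: contra ii => /eqP di.
by apply/eqP; apply: val_inj.
Qed.

Lemma mxsizeW m n f : (m <= n)%N -> mxsize m f -> mxsize n (f : mxpoly).
Proof. by move=> mn sf i j; exact: leq_trans (sf i j) mn. Qed.

Lemma mxsizeD n (f g : mxpoly) : mxsize n f -> mxsize n g -> mxsize n (f + g).
Proof.
move=> sf sg i j; rewrite mxE (leq_trans (size_polyD _ _))// geq_max sf.
exact: sg.
Qed.

Lemma mxsize0 n : mxsize n (0 : mxpoly).
Proof. by move=> i j; rewrite mxE size_poly0. Qed.

Lemma mxsize_sum n J (s : seq J) (pr : pred J) (F : J -> mxpoly) :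
  (forall j, pr j -> mxsize n (F j)) -> mxsize n (\sum_(j <- s | pr j) F j).
Proof. by move=> sF; elim/big_ind: _ => //; [exact: mxsize0|exact: mxsizeD]. Qed.

Lemma mxsize_cM n (A : 'M[C]_p) (f : mxpoly) : mxsize n f -> mxsize n (cmx A *m f).
Proof.
move=> sf i j; rewrite mxE; elim/big_ind: _ => [|g h sg sh|k _].
- by rewrite size_poly0.
- by rewrite (leq_trans (size_polyD _ _))// geq_max sg.
by rewrite mxE mul_polyC (leq_trans (size_scale_leq _ _)).
Qed.

Lemma mxsizeN n (f : mxpoly) : mxsize n f -> mxsize n (- f).
Proof. by move=> sf i j; rewrite mxE size_polyN. Qed.

Lemma mxsizeM m n (f g : mxpoly) : mxsize m f -> mxsize n.+1 g -> mxsize (m + n) (f *m g).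
Proof.
move=> sf sg i j; rewrite mxE; elim/big_ind: _ => [|a b sa sb|k _].
- by rewrite size_poly0.
- by rewrite (leq_trans (size_polyD _ _))// geq_max sa.
rewrite (leq_trans (size_polyMleq _ _))//.
have := leq_add (sf i k) (sg k j); rewrite addnS.
by case: (_ + _)%N => //= a; rewrite ltnS.
Qed.

Lemma mxcoef_cM (A : 'M[C]_p) (f : mxpoly) k : mxcoef (cmx A *m f) k = A *m mxcoef f k.
Proof.
apply/matrixP => i j; rewrite !mxE coef_sum; apply: eq_bigr => l _.
by rewrite !mxE coefCM.
Qed.

Lemma mxcoef_opp (f : mxpoly) k : mxcoef (- f) k = - mxcoef f k.
Proof. by apply/matrixP => i j; rewrite !mxE coefN. Qed.

Lemma mxcoef_size n (f : mxpoly) k : mxsize n f -> (n <= k)%N -> mxcoef f k = 0.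
Proof. by move=> sf nk; apply/matrixP => i j;
  rewrite !mxE nth_default// (leq_trans (sf i j)). Qed.

Lemma mxsize_drop n (f : mxpoly) : mxsize n.+1 f -> mxcoef f n = 0 -> mxsize n f.
Proof.
move=> sf f0 i j; apply/leq_sizeP => k; rewrite leq_eqVlt => /orP[/eqP <-|lt].
  by have /matrixP/(_ i j) := f0; rewrite !mxE.
by rewrite nth_default// (leq_trans (sf i j)).
Qed.

Lemma mxcoefM_top m n (f g : mxpoly) : mxsize m.+1 f -> mxsize n.+1 g ->
  mxcoef (f *m g) (m + n) = mxcoef f m *m mxcoef g n.
Proof.
move=> sf sg; apply/matrixP => i j; rewrite !mxE coef_sum; apply: eq_bigr => k _.
by rewrite coefM_top// !mxE.
Qed.

Lemma mxsize_monomial k : mxsize k.+1 (('X^k)%:M : mxpoly).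
Proof.
move=> i j; rewrite mxE; case: eqP => _; rewrite ?mulr1n ?mulr0n ?size_poly0//.
by rewrite size_polyXn.
Qed.

Lemma mxcoef_monomial_top k : mxcoef (('X^k)%:M : mxpoly) k = 1%:M.
Proof.
by apply/matrixP => i j; rewrite !mxE coefMn coefXn eqxx.
Qed.

End MatrixCoefficients.

(** * Divisibility by a monic matrix polynomial from its root polynomials *)

Section RootDivisibility.
Variables (R : realType) (p : nat).
Local Notation C := R[i].
Local Notation mxpoly := 'M[{poly C}]_p.

Lemma mx_scalepI m n (d : {poly C}) (A B : 'M[{poly C}]_(m, n)) :
  d != 0 -> d *: A = d *: B -> A = B.
Proof.
move=> d0 /matrixP AB; apply/matrixP => i j.
by have := AB i j; rewrite !mxE => /(mulfI d0).
Qed.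

(** After division by the gcd of q and y, a root of q would be a root of the
    multiplier d that is given for it. *)
Lemma dvdp_local (q y : {poly C}) : q != 0 ->
  (forall z, root q z -> exists2 d : {poly C}, d.[z] != 0 & q %| d * y) -> q %| y.
Proof.
move=> q0 H.
have [e [q' [y' [Eq Ey cop e0]]]] : exists e q' y',
    [/\ q = q' * e, y = y' * e, coprimep q' y' & e != 0].
  exists (gcdp q y), (q %/ gcdp q y), (y %/ gcdp q y); split.
  - by rewrite divpK ?dvdp_gcdl.
  - by rewrite divpK ?dvdp_gcdr.
  - by rewrite coprimep_div_gcd ?q0.
  - by rewrite gcdp_eq0 (negbTE q0).
suff q1 : q' %| 1.
  by rewrite Eq Ey dvdp_mul2r// (dvdp_trans q1)// dvd1p.
rewrite dvdp1; apply: contraT => /closed_rootP[z rz].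
have [|d d0] := H z; first by rewrite Eq rootM rz.
rewrite Eq Ey mulrA dvdp_mul2r// Gauss_dvdpl// => dd.
by have := root_dvdp dd rz; rewrite rootE (negbTE d0).
Qed.

(** The leading coefficient of W is the identity, so the leading term of g
    cannot be cancelled in g W. *)
Lemma mxsize_quotient N n W (g : mxpoly) : mxpoly_monic N W ->
  mxsize (n + N) (g *m W) -> mxsize n g.
Proof.
move=> mW gW.
have [B HB] : exists B, mxsize (n + B) g.
  exists (\max_i \max_j size (g i j))%N => i j.
  rewrite (leq_trans _ (leq_addl _ _))//.
  apply: (leq_trans _ (leq_bigmax i)).
  exact: (leq_bigmax (F := fun j => size (g i j))).
elim: B HB => [|B IH] HB; first by move=> i j; rewrite -[n]addn0.
apply: IH => i j; apply/leq_sizeP => k; rewrite leq_eqVlt => /orP[/eqP <-|lt]; last first.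
  by move/leq_sizeP: (HB i j); apply; rewrite addnS.
suff -> : (g i j)`_(n + B)%N = ((g *m W) i j)`_(n + B + N)%N.
  by move/leq_sizeP: (gW i j); apply; rewrite leq_add2r leq_addr.
rewrite mxE coef_sum.
rewrite (eq_bigr (fun l => (g i l)`_(n + B)%N * mxcoef W N l j)) => [|l _]; last first.
  by rewrite coefM_top ?(mxpoly_monic_size mW)// -?addnS ?HB// mxE.
rewrite mW.1 (bigD1 j) //= big1 ?addr0 => [|l lj]; rewrite mxE.
  by rewrite eqxx mulr1.
by rewrite (negbTE lj) mulr0.
Qed.

Variables (N : nat) (W : mxpoly) (D : spectral_data R p).
Hypothesis W_monic : mxpoly_monic N W.
Hypothesis hD : is_spectral_data W D.

Definition jets_vanish (f : mxpoly) : Prop := forall a j m i,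
  (a < sd_q D)%N -> (j < sd_s D a)%N -> (m < sd_kap D a j)%N ->
  tcoef (sd_x D a) m ((f *m sd_r D a j) i ord0) = 0.

(** The values of the r_j at the node x_a are independent; completing them by
    constant columns gives X with X(x_a) invertible. Both W X and f X have
    their columns divisible by the powers (x - x_a)^kappa_j, so W X = Y D and
    f X = c D with D the diagonal of these powers. The exponents of D add up
    to the order of det W at x_a, hence det Y does not vanish there, and
    eliminating D gives det Y f = c adj(Y) W. *)
Lemma local_divisible a f : (a < sd_q D)%N -> jets_vanish f ->
  exists2 d : {poly C}, d.[sd_x D a] != 0 & exists g : mxpoly, d *: f = g *m W.
Proof.
move=> aq f0; set z := sd_x D a; set s := sd_s D a.
have sp : (s <= p)%N by rewrite /s /sd_s; exact: (size_kappa hD aq).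
(* B has the vectors r_j(x_a) as rows, and M completes it to an invertible
   matrix. *)
pose B : 'M[C]_(s, p) := \matrix_(j, i) (sd_r D a j i ord0).[z].
have fB : row_free B by rewrite /B /z /s; exact: (sd_r_free hD aq).
have pp : (pid_mx s : 'M[C]_(s, p)) *m (pid_mx s : 'M[C]_(p, s)) = 1%:M.
  by rewrite mul_pid_mx minnn (minn_idPr sp) pid_mx_1.
have [M uM EM] : {M : 'M[C]_p | M \in unitmx & B = pid_mx s *m M}.
  have [|M uM EM] := @complete_unitmx C s p (pid_mx s) (pid_mx s *m B).
    rewrite mulmxA pp mul1mx rank_pid_mx//; exact/eqP.
  by exists M => //; rewrite -EM mulmxA pp mul1mx.
have EB (j : 'I_s) i : B j i = M (widen_ord sp j) i.
  rewrite EM mxE (bigD1 (widen_ord sp j)) //= big1 ?addr0 => [|k kj].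
    by rewrite mxE eqxx ltn_ord mul1r.
  rewrite mxE; case: eqP => [E|]; last by rewrite mul0r.
  by case/eqP: kj; apply: val_inj.
pose kap (k : 'I_p) := nth 0%N (sd_kappa D a) k.
pose t := 'X - z%:P.
pose X : mxpoly := \matrix_(i, k) if (k < s)%N then sd_r D a k i ord0 else (M k i)%:P.
have EX : mxev X z = M^T.
  apply/matrixP => i k; rewrite !mxE; case: ifP => [ks|_]; last by rewrite hornerC.
  have := EB (Ordinal ks) i; rewrite mxE /= => ->; congr (M _ _); exact: val_inj.
have dX : (\det X).[z] != 0.
  by rewrite -det_mxev EX det_tr -unitfE -unitmxE.
pose Dg : mxpoly := diag_mx (\row_k t ^+ kap k).
have colX (A : mxpoly) i k : (A *m X) i k =
    if (k < s)%N then (A *m sd_r D a k) i ord0 else (A *m X) i k.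
  case: ifP => // ks; rewrite !mxE; apply: eq_bigr => l _; by rewrite mxE ks.
have factor (A : mxpoly) : (forall k i, (k < s)%N ->
    t ^+ sd_kap D a k %| (A *m sd_r D a k) i ord0) -> exists Y, A *m X = Y *m Dg.
  move=> HA; exists (\matrix_(i, k) ((A *m X) i k %/ t ^+ kap k)).
  apply/matrixP => i k; rewrite mul_mx_diag [RHS]mxE [X in _ = X * _]mxE [X in _ = _ * X]mxE
    divpK//.
  rewrite colX; case: ifP => [ks|/negbT]; first exact: HA.
  by rewrite -leqNgt => sk; rewrite /kap nth_default// expr0 dvd1p.
have [Y EY] : exists Y, W *m X = Y *m Dg.
  by apply: factor => k i ks; exact: (sd_r_root hD).
have [c Ec] : exists c, f *m X = c *m Dg.
  apply: factor => k i ks; apply/tcoef_dvd => m mk; exact: f0.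
have t0 : t != 0 by rewrite polyXsubC_eq0.
have detD : \det Dg = t ^+ det_mult D a.
  rewrite det_diag; under eq_bigr do rewrite mxE.
  by rewrite -expr_sum /kap sum_nth_padded.
have dY : (\det Y).[z] != 0.
  have [g g0 Eg] := det_local hD aq.
  have : \det Y * t ^+ det_mult D a = g * \det X * t ^+ det_mult D a.
    by rewrite -detD -det_mulmx -EY det_mulmx Eg -/z -/t detD; ring.
  move=> /(mulIf (expf_neq0 _ t0)) ->; by rewrite hornerM mulf_neq0.
exists (\det Y) => //; exists (c *m \adj Y).
have X0 : \det X != 0 by apply: contraNneq dX => ->; rewrite horner0.
have adjX (A A' : mxpoly) : A *m X = A' *m X -> A = A'.
  move=> AB; apply: (mx_scalepI X0).
  by rewrite -!mul_mx_scalar -mul_mx_adj !mulmxA AB.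
apply: adjX; rewrite -scalemxAl Ec -!mulmxA EY.
by rewrite [\adj Y *m _]mulmxA mul_adj_mx mul_scalar_mx scalemxAr.
Qed.

(** The local multipliers do not vanish at the roots of det W, so det W
    divides the entries of f adj(W), and the quotient is g. *)
Lemma left_divisible f : jets_vanish f -> exists g, f = g *m W.
Proof.
move=> f0; have d0 := detW_neq0 W_monic.
pose h := f *m \adj W.
have dv i j : \det W %| h i j.
  apply: dvdp_local => // z /(sd_xE hD) [a aq ->].
  have [d dz [g Eg]] := local_divisible aq f0; exists d => //.
  have -> : d * h i j = (g *m W *m \adj W) i j by rewrite -Eg -scalemxAl [RHS]mxE.
  by rewrite -mulmxA mul_mx_adj mul_mx_scalar mxE dvdp_mulIl.
exists (\matrix_(i, j) (h i j %/ \det W)).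
set g := \matrix_(i, j) _.
have Eh : h = \det W *: g.
  by apply/matrixP => i j; rewrite [RHS]mxE [X in _ = _ * X]mxE mulrC divpK.
apply: (mx_scalepI d0); rewrite scalemxAl -Eh /h -mulmxA mul_adj_mx mul_mx_scalar.
by [].
Qed.

End RootDivisibility.

(** * Root spectral jets *)

Section SpectralJets.
Variables (R : realType) (p : nat).
Local Notation C := R[i].
Local Notation mxpoly := 'M[{poly C}]_p.
Local Notation cmx := (map_mx polyC).

Lemma mxpoly_ext m n (A B : 'M[{poly C}]_(m, n)) :
  (forall z, mxev A z = mxev B z) -> A = B.
Proof.
move=> AB; apply/matrixP => i j; apply/eqP; rewrite -subr_eq0.
apply/negPn/negP => /closed_nonrootP[z]; rewrite rootE hornerD hornerN.
by have /matrixP/(_ i j) := AB z; rewrite !mxE => ->; rewrite subrr eqxx.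
Qed.

Definition mx_holo (U : set C) (f : C -> 'M[C]_p) : Prop :=
  forall i j, holo U (fun z => f z i j).

Lemma mx_holo_poly U P : mx_holo U (mxev P).
Proof. by move=> i j; apply: holo_eq (holo_poly U (P i j)) => z _; rewrite mxE. Qed.

Lemma holo_mul_poly U f (r : 'cV[{poly C}]_p) i : mx_holo U f ->
  holo U (fun z => (f z *m mxev r z) i ord0).
Proof.
move=> hf.
apply: holo_eq (holo_sum (index_enum 'I_p) (P := xpredT)
  (F := fun k z => (r k ord0).[z] * f z i k) _) => [z _|k _].
  by rewrite mxE; apply: eq_bigr => k _; rewrite mxE mulrC.
exact: holo_polyM.
Qed.

Variables (N : nat) (W : mxpoly) (D : spectral_data R p).
Hypothesis W_monic : mxpoly_monic N W.
Hypothesis hD : is_spectral_data W D.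

Lemma spectral_jetE f i (c : 'I_(N * p)) a j m : jet_nth D c = (a, j, m) ->
  spectral_jet D N f i c =
  cderivn m (fun z => (f z *m mxev (sd_r D a j) z) i ord0) (sd_x D a) / m`!%:R.
Proof. by move=> E; rewrite mxE E. Qed.

Lemma spectral_jet_poly P i (c : 'I_(N * p)) a j m : jet_nth D c = (a, j, m) ->
  spectral_jet D N (mxev P) i c = tcoef (sd_x D a) m ((P *m sd_r D a j) i ord0).
Proof.
move=> E; rewrite (spectral_jetE _ _ E) /tcoef -cderivn_poly; congr (cderivn _ _ _ / _).
by apply/funext => z; rewrite -mxevM mxE.
Qed.

Lemma jetP (c : 'I_(N * p)) : exists a j m, [/\ jet_nth D c = (a, j, m),
  (a < sd_q D)%N, (j < sd_s D a)%N & (m < sd_kap D a j)%N].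
Proof.
have := jet_nth_bounds W_monic hD c; case: (jet_nth D c) => -[a j] m [aq js mk].
by exists a, j, m.
Qed.

Lemma spectral_jet_linear U A f g : copen U ->
  (forall a, (a < sd_q D)%N -> U (sd_x D a)) ->
  mx_holo U f -> mx_holo U g ->
  spectral_jet D N (fun z => A *m f z + g z) =
  A *m spectral_jet D N f + spectral_jet D N g.
Proof.
move=> oU xU hf hg; apply/matrixP => i c.
have [a [j [m [E aq js mk]]]] := jetP c; have Ux := xU _ aq.
rewrite (spectral_jetE _ _ E) [RHS]mxE (spectral_jetE g _ E) [X in _ = X + _]mxE.
under eq_bigr do rewrite (spectral_jetE f _ E).
have -> : (fun z => ((A *m f z + g z) *m mxev (sd_r D a j) z) i ord0) =
  (fun z => \sum_k A i k * (f z *m mxev (sd_r D a j) z) k ord0 +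
            (g z *m mxev (sd_r D a j) z) i ord0).
  by apply/funext => z; rewrite mulmxDl -mulmxA mxE; congr (_ + _); rewrite mxE.
rewrite (cderivnD _ oU _ _ Ux); last 2 first.
- by apply: holo_sum => k _; apply: holoZ; exact: holo_mul_poly.
- exact: holo_mul_poly.
rewrite mulrDl; congr (_ + _); rewrite (cderivn_sum _ _ oU _ Ux) => [|k _]; last first.
  by apply: holoZ; exact: holo_mul_poly.
rewrite mulr_suml; apply: eq_bigr => k _.
by rewrite (cderivnZ _ _ oU _ Ux) ?mulrA//; exact: holo_mul_poly.
Qed.

Lemma spectral_jet_poly_linear A P Q :
  spectral_jet D N (mxev (cmx A *m P + Q)) =
  A *m spectral_jet D N (mxev P) + spectral_jet D N (mxev Q).
Proof.
have -> : mxev (cmx A *m P + Q) = (fun z => A *m mxev P z + mxev Q z).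
  by apply/funext => z; rewrite mxevD mxevM mxev_cst.
apply: (@spectral_jet_linear setT) => //.
- exact: (@openT C^o).
- exact: mx_holo_poly.
- exact: mx_holo_poly.
Qed.

Lemma spectral_jet_mulW g : spectral_jet D N (mxev (g *m W)) = 0.
Proof.
apply/matrixP => i c; have [a [j [m [E aq js mk]]]] := jetP c.
rewrite (spectral_jet_poly _ _ E) [RHS]mxE -mulmxA.
apply: (elimT (tcoef_dvd (sd_x D a) (sd_kap D a j) _)) => //.
rewrite mxE; apply: (big_ind (fun q => dvdp _ q)) => [|f h|l _];
  [exact: dvdp0|exact: dvdp_add|].
by apply: dvdp_mull; apply: (sd_r_root hD).
Qed.

Lemma spectral_jet_eq0 f : spectral_jet D N (mxev f) = 0 -> exists g, f = g *m W.
Proof.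
move=> J0; apply: (left_divisible W_monic hD) => a j m i aq js mk.
have [c E] := jet_nth_ex W_monic hD aq js mk.
by rewrite -(spectral_jet_poly f i E) J0 mxE.
Qed.

(** The Taylor coefficient of order m at y = x of l(y) V(z, y), where V is the
    bezoutian of W, expanded on the coefficients of W so as to be a polynomial
    in z. *)
Definition bezoutian_jet (l : 'rV[{poly C}]_p) (x : C) (m : nat) : 'rV[{poly C}]_p :=
  \sum_(1 <= k < N.+1) \sum_(i < k)
    'X^i *: cmx (mxtcoef x m (l *m (cmx (mxcoef W k)^T *m ('X^(k.-1 - i))%:M)^T)).

Lemma mxev_bezoutian_jet l x m z : mxev (bezoutian_jet l x m) z = mxtcoef x m (l *m
  (bezoutian_poly W N z)^T).
Proof.
rewrite /bezoutian_jet /bezoutian_poly mxev_sum raddf_sum /= mulmx_sumr mxtcoef_sum;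
  apply: eq_bigr => k _.
rewrite mxev_sum raddf_sum /= mulmx_sumr mxtcoef_sum; apply: eq_bigr => i _.
by rewrite mxevZ mxev_cst hornerXn [(_ *: _)^T]linearZ /= -scalemxAr mxtcoefZ.
Qed.

Lemma mxtcoef_XsubZ m n x z k (A : 'M[{poly C}]_(m, n)) :
  mxtcoef x k (('X - z%:P) *: A) =
  (if k is k'.+1 then mxtcoef x k' A else 0) + (x - z) *: mxtcoef x k A.
Proof.
apply/matrixP => i j; rewrite mxtcoefE [RHS]mxE [X in _ = _ + X]mxE [X in _ = _ + _ * X]mxtcoefE.
have -> : (('X - z%:P) *: A) i j = ('X - x%:P) * A i j + (x - z) *: A i j.
  rewrite mxE -mul_polyC -mulrDl; congr (_ * _); rewrite polyCB; ring.
rewrite tcoefD tcoefZ; congr (_ + _).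
by case: k => [|k]; rewrite ?tcoef_XsubM0 ?tcoef_XsubM ?mxtcoefE ?mxE.
Qed.

Variables (l : 'rV[{poly C}]_p) (x : C) (kap : nat).
Hypothesis l_root : forall i, ('X - x%:P) ^+ kap %| (l *m W) ord0 i.

(** The Taylor coefficient of order m at y = x of (y - z) l(y) V(z, y) = l(y)
    W(y) - l(y) W(z), in which l W does not contribute below the order kap. *)
Lemma bezoutian_jet_rec m : (m < kap)%N ->
  ('X - x%:P) *: bezoutian_jet l x m =
  (if m is m'.+1 then bezoutian_jet l x m' else 0) + cmx (mxtcoef x m l) *m W.
Proof.
move=> mk; apply: mxpoly_ext => z.
rewrite mxevZ hornerXsubC mxevD mxevM mxev_cst mxev_bezoutian_jet.
have -> : mxev (if m is m'.+1 then bezoutian_jet l x m' else 0) z =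
  if m is m'.+1 then mxtcoef x m' (l *m (bezoutian_poly W N z)^T) else 0.
  by case: (m) => [|m']; rewrite ?mxev0// mxev_bezoutian_jet.
have := mxtcoef_XsubZ x z m (l *m (bezoutian_poly W N z)^T).
rewrite scalemxAr (mul_bezoutian_poly z W_monic) mulmxBr.
rewrite -[- (l *m _)]mulmxN -map_mxN mxtcoefD mxtcoefMr.
have -> : mxtcoef x m (l *m W) = 0.
  apply/matrixP => i j; rewrite mxtcoefE [RHS]mxE (ord1 i).
  exact: (elimT (tcoef_dvd x kap _) (l_root j)) mk.
rewrite add0r mulmxN => H.
by rewrite -[_ *m mxev W z]opprK H opprD addrA subrr add0r -scaleNr opprB.
Qed.

Variables (r : 'cV[{poly C}]_p) (x' : C) (kap' : nat).
Hypothesis r_root : forall i, ('X - x'%:P) ^+ kap' %| (W *m r) i ord0.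

Let phi m : {poly C} := (bezoutian_jet l x m *m r) ord0 ord0.
Let psi m : {poly C} := (cmx (mxtcoef x m l) *m (W *m r)) ord0 ord0.

Lemma bezoutian_jet_mul_rec m : (m < kap)%N ->
  ('X - x%:P) * phi m = (if m is m'.+1 then phi m' else 0) + psi m.
Proof.
move=> mk; have /(congr1 (fun A => (A *m r) ord0 ord0)) := bezoutian_jet_rec mk.
rewrite -scalemxAl mxE -/(phi m) => ->; rewrite mulmxDl mxE -mulmxA; congr (_ + _).
by case: (m) => [|m'] //; rewrite mul0mx mxE.
Qed.

Lemma taylor_mul_root m : ('X - x'%:P) ^+ kap' %| psi m.
Proof.
rewrite /psi mxE; apply: (big_ind (fun q => dvdp _ q)) => [|f h|k _];
  [exact: dvdp0|exact: dvdp_add|].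
exact: dvdp_mull.
Qed.

(** For distinct nodes the factor X - x of the recursion is invertible modulo
    (X - x')^kap', so the divisibility of psi passes to phi. *)
Lemma bezoutian_jet_root_neq m : x != x' -> (m < kap)%N -> ('X - x'%:P) ^+ kap' %| phi m.
Proof.
move=> xx; have cop : coprimep (('X - x'%:P) ^+ kap') ('X - x%:P).
  by rewrite coprimep_expl// coprimep_XsubC2// subr_eq0.
elim: m => [|m IH] mk; rewrite -(Gauss_dvdpr _ cop) bezoutian_jet_mul_rec//.
  by rewrite add0r taylor_mul_root.
by rewrite dvdp_add ?taylor_mul_root ?IH ?(ltnW mk).
Qed.

Lemma tcoef_taylor_mul y m c :
  tcoef y c (psi m) = (mxtcoef x m l *m mxtcoef y c (W *m r)) ord0 ord0.
Proof.
rewrite /psi mxE tcoef_sum mxE; apply: eq_bigr => k _.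
by rewrite mxE mul_polyC tcoefZ [X in _ = _ * X]mxtcoefE.
Qed.

Lemma tcoef_bezoutian_jet m c : (m < kap)%N ->
  tcoef x c (phi m) = \sum_(i < m.+1)
    (mxtcoef x i l *m mxtcoef x (m + c + 1 - i) (W *m r)) ord0 ord0.
Proof.
elim: m c => [|m IH] c mk; rewrite -tcoef_XsubM bezoutian_jet_mul_rec// tcoefD tcoef_taylor_mul.
  by rewrite tcoef0 add0r big_ord_recl big_ord0 addr0 /= add0n addn1 subn0.
have top : (m.+1 + c + 1 - m.+1 = c.+1)%N by rewrite -addnA addKn addn1.
by rewrite IH ?(ltnW mk)// [RHS]big_ord_recr /= top addSnnS.
Qed.

Lemma tcoef_lWr n : tcoef x n ((l *m W *m r) ord0 ord0) =
  \sum_(k < n.+1) (mxtcoef x k l *m mxtcoef x (n - k) (W *m r)) ord0 ord0.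
Proof.
rewrite -mulmxA mxE tcoef_sum; under eq_bigr do rewrite tcoefM.
rewrite exchange_big; apply: eq_bigr => k _; rewrite mxE.
by apply: eq_bigr => i _; rewrite !mxtcoefE.
Qed.

(** Unrolling the recursion gives the terms i <= m of the convolution that
    computes the coefficient of order m + c + 1 of l W r. In the other terms
    the coefficient of W r has order at most c, hence is 0. *)
Lemma bezoutian_jet_spectral_W m c : x = x' -> (m < kap)%N -> (c < kap')%N ->
  tcoef x c (phi m) = tcoef x (m + c + 1) ((l *m W *m r) ord0 ord0).
Proof.
move=> xx mk ck; rewrite tcoef_bezoutian_jet// tcoef_lWr.
rewrite (_ : (m + c + 1).+1 = m.+1 + c.+1)%N; last by rewrite addn1 addSn addnS.
rewrite big_split_ord /= [X in _ = _ + X]big1 ?addr0// => i _.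
suff -> : mxtcoef x (m + c + 1 - (m.+1 + i)) (W *m r) = 0 by rewrite mulmx0 mxE.
apply/matrixP => i0 j0; rewrite mxtcoefE [RHS]mxE (ord1 j0).
rewrite xx; apply: (elimT (tcoef_dvd x' kap' _) (r_root _)).
rewrite addn1 -addSn subnDl; exact: leq_ltn_trans (leq_subr _ _) ck.
Qed.

End SpectralJets.

(** * Jets of second kind functions *)

Section SecondKindJets.
Variables (R : realType) (p : nat).
Local Notation C := R[i].
Local Notation plane := (R * R)%type.
Local Notation mxpoly := 'M[{poly C}]_p.
Local Notation cmx := (map_mx polyC).
Variable u : 'I_p -> 'I_p -> plane_distribution R.
Hypothesis u_suppx : bounded_set (ksupp_x u).
Hypothesis u_suppy : bounded_set (ksupp_y u).
Variables (WC WG : mxpoly) (N : nat).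
Hypothesis WG_monic : mxpoly_monic N WG.
Variable (D : spectral_data R p).
Hypothesis hD : is_spectral_data WG D.
Hypothesis WG_supp : forall y : R, ksupp_y u y -> ~~ root (\det WG) y%:C.
Variable xi : masses R p.

Local Notation U := (regular_set u).
Local Notation hat := (hat_form u WC WG D xi).

Let detWG : \det WG != 0 := detW_neq0 WG_monic.

Lemma regular_node a : (a < sd_q D)%N -> U (sd_x D a).
Proof.
move=> aq k l; apply: (off_supp_root u_suppx u_suppy WG_supp).
by apply/(sd_xE hD); exists a.
Qed.

Lemma mx_holo_resolvent (P Q : R -> 'M[C]_p) : kernel_smooth_x u P ->
  kernel_smooth_y u Q ->
  mx_holo U (fun z => kform u P (fun y => (z - y%:C)^-1 *: Q y)).
Proof.
move=> nP nQ i j.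
pose F k l z := Defs.dpair (u k l) (fun t => (P t.1 i k * Q t.2 j l) * (z - t.2%:C)^-1).
apply: holo_eq (holo_sum (index_enum 'I_p) (P := xpredT)
  (F := fun k z => \sum_l F k l z) _) => [z _|k _].
  rewrite mxE; apply: eq_bigr => k _; apply: eq_bigr => l _.
  by congr (Defs.dpair _ _); apply/funext => t; rewrite mxE mulrCA mulrC.
apply: holo_sum => l _.
have [G [G0 dG]] := holo_resolvent (ksupp_bounded u_suppx u_suppy k l)
   (@near_smooth_term R p u P Q i j k l k l nP nQ).
by exists G; split=> [z Uz|n z Uz]; [apply: G0|apply: dG]; apply: Uz.
Qed.

Lemma mx_holo_second_kind P : mx_holo U (second_kind u P).
Proof.
have H := mx_holo_resolvent (kernel_smooth_x_poly u_suppx u_suppy P) (kernel_smooth_y_cst u_suppx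
  u_suppy 1%:M).
move=> i j; apply: holo_eq (H i j) => z _.
by congr (kform _ _ _ _ _); apply/funext => y; rewrite scalemx1.
Qed.

Lemma mxsize_bezoutian_poly (W : mxpoly) M z : mxsize M (bezoutian_poly W M z).
Proof.
rewrite /bezoutian_poly big_nat_cond; apply: mxsize_sum => k /andP[/andP[_ kN] _].
apply: mxsize_sum => i _; rewrite scalemxAl -map_mxZ.
apply: mxsize_cM; apply: (mxsizeW _ (@mxsize_monomial R p _)).
have k0 : (0 < k)%N := leq_ltn_trans (leq0n i) (ltn_ord i).
by rewrite (leq_ltn_trans (leq_subr _ _))// prednK.
Qed.

(** The value of the transformed form at P and the bezoutian of W_G at z, as a
    polynomial in z. *)
Definition hat_bezoutian (P : mxpoly) : mxpoly :=
  \sum_(1 <= k < N.+1) \sum_(i < k)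
    'X^i *: cmx (hat P ('X^(k.-1 - i))%:M *m mxcoef WG k).

Lemma hat_right0 P : hat P 0 = 0.
Proof.
have := hat_form_right u_suppx u_suppy WC detWG D WG_supp xi 0 P 0 0.
rewrite map_mx0 mul0mx addr0 trmx0 mulmx0 add0r => H.
have := hat_form_right u_suppx u_suppy WC detWG D WG_supp xi 1%:M P 0 0.
by rewrite mulmx0 addr0 trmx1 mulmx1 -[X in X = _]addr0 => /addrI.
Qed.

Lemma hat_rightD P Q Q' : hat P (Q + Q') = hat P Q + hat P Q'.
Proof.
have := hat_form_right u_suppx u_suppy WC detWG D WG_supp xi 1%:M P Q Q'.
by rewrite map_mx1 mul1mx trmx1 mulmx1.
Qed.

Lemma hat_rightM P A Q : hat P (cmx A *m Q) = hat P Q *m A^T.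
Proof.
have := hat_form_right u_suppx u_suppy WC detWG D WG_supp xi A P Q 0.
by rewrite !addr0 hat_right0 addr0.
Qed.

Lemma hat_right_sum P J (s : seq J) (pr : pred J) (F : J -> mxpoly) :
  hat P (\sum_(j <- s | pr j) F j) = \sum_(j <- s | pr j) hat P (F j).
Proof. by apply: (big_morph (hat P)) => [A B|]; [exact: hat_rightD|exact: hat_right0]. Qed.

Lemma mxev_hat_bezoutian P z : mxev (hat_bezoutian P) z = hat P (bezoutian_poly WG N z).
Proof.
rewrite /hat_bezoutian /bezoutian_poly mxev_sum hat_right_sum; apply: eq_bigr => k _.
rewrite mxev_sum hat_right_sum; apply: eq_bigr => i _.
rewrite mxevZ mxev_cst hornerXn.
have -> : (z ^+ i)%:P *: (cmx (mxcoef WG k)^T *m ('X^(k.-1 - i))%:M) =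
   cmx (z ^+ i *: (mxcoef WG k)^T) *m ('X^(k.-1 - i))%:M.
  by rewrite map_mxZ -scalemxAl.
by rewrite hat_rightM linearZ /= trmxK -scalemxAr.
Qed.

(** In second_kind_hat the resolvent term is a holomorphic function times W_G,
    so its jets along the root polynomials vanish. The jets of the mass term
    pair each mass with the jets of a row of l V r, which are the entries of
    the matrix spectral_W within a node and 0 between distinct nodes. *)
Lemma second_kind_jets P :
  spectral_jet D N (second_kind u (P *m WC))
    - mass_row D N xi (P *m WC) *m spectral_W WG D N =
  - spectral_jet D N (mxev (hat_bezoutian P)).
Proof.
have oU : copen U by exact: regular_open.
apply/matrixP => i c; have [a [j [m [E aq js mk]]]] := jetP WG_monic hD c.
have Ux := regular_node aq.
rewrite mxE [RHS]mxE (spectral_jetE _ _ E) (spectral_jetE (mxev _) _ E).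
set r := sd_r D a j; set x := sd_x D a.
pose lam b j' m' := bezoutian_jet N WG (sd_l D b j') (sd_x D b) m'.
pose mu : {poly C} := \sum_(b < sd_q D) \sum_(j' < sd_s D b) \sum_(m' < sd_kap D b j')
   mass_pair (P *m WC) (xi b j' m') i ord0 *: (lam b j' m' *m r) ord0 ord0.
have EU z : U z -> (second_kind u (P *m WC) z *m mxev r z) i ord0 =
   (\sum_k ((WG *m r) k ord0).[z] * resolvent_form u WG (P *m WC) z i k + mu.[z]) +
   (-1) * (mxev (hat_bezoutian P) z *m mxev r z) i ord0.
  move=> Uz; rewrite (second_kind_hat u_suppx u_suppy WC WG_monic detWG D WG_supp xi)//.
  rewrite mulmxBl mulmxDl -mxev_hat_bezoutian mulN1r mxE [X in _ + X]mxE mxE.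
  congr (_ + _ + _).
    by rewrite -mulmxA -mxevM mxE; apply: eq_bigr => k _; rewrite [X in _ * X]mxE mulrC.
  rewrite /mass_term /mu mulmx_suml summxE horner_sum; apply: eq_bigr => b _.
  rewrite mulmx_suml summxE horner_sum; apply: eq_bigr => j' _.
  rewrite mulmx_suml summxE horner_sum; apply: eq_bigr => m' _.
  rewrite -mulmxA mxE big_ord1 hornerZ -mxev_bezoutian_jet -mxevM; congr (_ * _).
  by rewrite mxE.
have hE : mx_holo U (resolvent_form u WG (P *m WC)).
  apply: mx_holo_resolvent; first exact: kernel_smooth_x_poly.
  exact: kernel_smooth_y_WG_inv.
have hS : holo U (fun z => \sum_k ((WG *m r) k ord0).[z] * resolvent_form u WG (P *m WC) z i k).
  by apply: holo_sum => k _; apply: holo_polyM; exact: hE.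
have hB : holo U (fun z => (mxev (hat_bezoutian P) z *m mxev r z) i ord0).
  by apply: holo_mul_poly; exact: mx_holo_poly.
have hm : holo U (fun z => mu.[z]) by exact: holo_poly.
rewrite -(cderivn_eq m oU (fun z Uz => esym (EU z Uz)) _ Ux); last first.
  by apply: holoD; [exact: holoD|exact: holoZ].
rewrite (cderivnD _ oU _ _ Ux); [|exact: holoD|exact: holoZ].
rewrite (cderivnD _ oU _ _ Ux)// (cderivnZ _ _ oU _ Ux)//.
rewrite (cderivn_sum _ _ oU _ Ux) => [|k _]; last by apply: holo_polyM; exact: hE.
rewrite big1 ?add0r => [|k _]; last first.
  apply: (cderivn_vanish oU (hE i k) Ux (kap := sd_kap D a j)) => //.
  exact: (sd_r_root hD).
rewrite mulrDl mulN1r mulNr [X in _ + X = _]mxE addrAC; apply/eqP.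
rewrite -subr_eq0 opprK addrNK subr_eq0; apply/eqP.
rewrite cderivn_poly -/(tcoef x m mu) /mu tcoef_sum [RHS]mxE.
rewrite (eq_bigr (fun t : 'I_(N * p) => let: (b, j', m') := jet_nth D t in
    mass_pair (P *m WC) (xi b j' m') i ord0 *
    tcoef x m ((lam b j' m' *m r) ord0 ord0))) => [|t _].
  rewrite (sum_jet WG_monic hD (fun t => let: (b, j', m') := t in
    mass_pair (P *m WC) (xi b j' m') i ord0 *
    tcoef x m ((lam b j' m' *m r) ord0 ord0))).
  apply: eq_bigr => b _; rewrite tcoef_sum; apply: eq_bigr => j' _.
  by rewrite tcoef_sum; apply: eq_bigr => m' _; rewrite tcoefZ.
have [b [j' [m' [E' bq js' mk']]]] := jetP WG_monic hD t.
rewrite mxE [X in _ * X]mxE E' E; congr (_ * _).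
have rl i0 : ('X - (sd_x D b)%:P) ^+ sd_kap D b j' %| (sd_l D b j' *m WG) ord0 i0.
  exact: (sd_l_root hD).
have rr i0 : ('X - x%:P) ^+ sd_kap D a j %| (WG *m r) i0 ord0.
  exact: (sd_r_root hD).
case: eqP => [ba|/eqP ba].
  subst b.
  by rewrite mxE /lam (bezoutian_jet_spectral_W WG_monic rl rr).
apply/esym; apply: (elimT (tcoef_dvd x (sd_kap D a j) _)) => //.
apply: (bezoutian_jet_root_neq WG_monic rl rr) => //.
by apply: contra ba => /eqP/(sd_x_inj hD bq aq) ->.
Qed.

Lemma mxsize_hat_bezoutian P : mxsize N (hat_bezoutian P).
Proof.
rewrite /hat_bezoutian big_nat_cond; apply: mxsize_sum => k /andP[/andP[_ kN] _].
apply: mxsize_sum => i _ a b.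
rewrite mxE [X in 'X^_ * X]mxE mulrC mul_polyC.
apply: (leq_trans (size_scale_leq _ _)).
by rewrite size_polyXn (leq_trans (ltn_ord i)).
Qed.

(** The coefficient of z^(N-1-e) is the moment of order e plus moments of
    lower order times coefficients of W_G, since W_G is monic. *)
Lemma hat_bezoutian_eq0 P : hat_bezoutian P = 0 -> forall k, (k < N)%N ->
  hat P ('X^k)%:M = 0.
Proof.
move=> B0 e; elim/ltn_ind: e => e IH eN.
pose d := (N.-1 - e)%N.
have := mxcoef0 R p d; rewrite -B0 /hat_bezoutian mxcoef_sum.
under eq_bigr do rewrite (mxcoef_poly (fun i => hat P ('X^(_ - i))%:M *m mxcoef WG _)).
have N1 : (1 <= N)%N by lia.
rewrite big_nat_recr //= big_nat_cond big1 ?add0r => [|k /andP[/andP[k1 kN] _]].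
  have -> : (d < N)%N by rewrite /d; lia.
  have -> : (N.-1 - d)%N = e by rewrite /d; lia.
  by rewrite WG_monic.1 mulmx1.
case: ifP => // lt; rewrite IH ?mul0mx//; rewrite /d in lt *; lia.
Qed.

End SecondKindJets.

(** * Block rows *)

Section BlockRows.
Variables (R : realType) (p NC NG : nat).
Local Notation C := R[i].

Definition block_row m (x : nat -> 'M[C]_(m, p)) : 'M[C]_(m, NC * p + NG * p) :=
  castmx (erefl m, block_rowsE p NC NG) (\mxrow_(k < NG + NC) x k).

Lemma block_row_mul m q (x : nat -> 'M[C]_(m, p)) (B : nat -> 'M[C]_(p, q)) :
  block_row x *m block_rows NC NG B = \sum_(k < NG + NC) x k *m B k.
Proof.
rewrite /block_row /block_rows -mul_mxrow_mxcol.
by case: _ / (block_rowsE p NC NG).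
Qed.

Lemma block_row_surj m (X : 'M[C]_(m, NC * p + NG * p)) :
  exists x, X = block_row x.
Proof.
pose Y := castmx (erefl m, esym (block_rowsE p NC NG)) X.
pose x (k : nat) : 'M[C]_(m, p) := if insub k is Some i then submxrow Y i else 0.
exists x; rewrite /block_row.
have -> : \mxrow_(k < NG + NC) x k = Y.
  by rewrite -[RHS]submxrowK; apply: eq_mxrow => k; rewrite /x valK.
by rewrite castmxKV.
Qed.

Lemma block_row0 m (x : nat -> 'M[C]_(m, p)) :
  (forall k, (k < NG + NC)%N -> x k = 0) -> block_row x = 0.
Proof.
move=> x0; rewrite /block_row.
have -> : \mxrow_(k < NG + NC) x k = 0.
  by apply/matrixP => i j; rewrite mxE x0 ?ltn_ord// !mxE.
by apply/matrixP => i j; rewrite castmxE !mxE.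
Qed.

End BlockRows.

(** * Biorthogonal families of matrix polynomials *)

Section Biorthogonal.
Variables (R : realType) (p : nat).
Local Notation C := R[i].
Local Notation mxpoly := 'M[{poly C}]_p.
Local Notation cmx := (map_mx polyC).

Record sesquilinear (B : mxpoly -> mxpoly -> 'M[C]_p) : Prop := {
  sesq_left : forall A P P' Q, B (cmx A *m P + P') Q = A *m B P Q + B P' Q;
  sesq_right : forall A P Q Q', B P (cmx A *m Q + Q') = B P Q *m A^T + B P Q' }.

Definition monic_family (P : nat -> mxpoly) : Prop :=
  forall k, mxsize k.+1 (P k) /\ mxcoef (P k) k = 1%:M.

Record biorthogonal (B : mxpoly -> mxpoly -> 'M[C]_p) (P Q : nat -> mxpoly)
    (H : nat -> 'M[C]_p) : Prop := {
  bio_monicl : monic_family P;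
  bio_monicr : monic_family Q;
  bio_unit : forall k, H k \in unitmx;
  bio_eq : forall m n, B (P m) (Q n) = if m == n then H m else 0 }.

Lemma left_linear_sum (p' : nat) (L : mxpoly -> 'M[C]_(p, p')) :
  (forall A P Q, L (cmx A *m P + Q) = A *m L P + L Q) ->
  forall J (s : seq J) (c : J -> 'M[C]_p) (P : J -> mxpoly),
    L (\sum_(j <- s) cmx (c j) *m P j) = \sum_(j <- s) c j *m L (P j).
Proof.
move=> Llin J s c P.
have L0 : L 0 = 0.
  have := Llin 1%:M 0 0; rewrite mulmx0 addr0 mul1mx -[X in X = _]addr0.
  by move/addrI.
elim: s => [|j s IH]; first by rewrite !big_nil.
by rewrite !big_cons Llin IH.
Qed.

Lemma monic_family_expand P n f : monic_family P -> mxsize n f ->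
  exists c : nat -> 'M[C]_p, f = \sum_(k < n) cmx (c k) *m P k /\
    (forall m, n = m.+1 -> c m = mxcoef f m).
Proof.
move=> mP; elim: n f => [|n IH] f sf.
  exists (fun=> 0); rewrite big_ord0; split=> //.
  apply/matrixP => i j; apply/eqP; rewrite mxE -size_poly_leq0; exact: sf.
have [sP cP] := mP n.
have [|c [Ec _]] := IH (f - cmx (mxcoef f n) *m P n).
  apply: mxsize_drop.
    by apply: mxsizeD => //; apply: mxsizeN; exact: mxsize_cM.
  by rewrite mxcoefD mxcoef_opp mxcoef_cM cP mulmx1 subrr.
exists (fun k => if k == n then mxcoef f n else c k); split; last first.
  by move=> m [->]; rewrite eqxx.
rewrite big_ord_recr /= eqxx -[LHS](subrK (cmx (mxcoef f n) *m P n)) Ec.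
congr (_ + _); apply: eq_bigr => k _; by rewrite ltn_eqF.
Qed.

Lemma monic_family_free P n (c : nat -> 'M[C]_p) : monic_family P ->
  \sum_(k < n) cmx (c k) *m P k = 0 -> forall k, (k < n)%N -> c k = 0.
Proof.
move=> mP; elim: n => [//|n IH] E0.
have cn : c n = 0.
  have /(congr1 (fun f => mxcoef f n)) := E0.
  rewrite big_ord_recr /= mxcoefD (mxcoef_size (n := n)) ?add0r//; last first.
    apply: mxsize_sum => k _; apply: mxsize_cM; apply: mxsizeW (mP k).1; exact: ltn_ord.
  rewrite mxcoef_cM (mP n).2 mulmx1 => ->.
  exact: mxcoef0.
move=> k; rewrite ltnS leq_eqVlt => /orP[/eqP ->//|kn].
apply: IH => //; move: E0; rewrite big_ord_recr /= cn map_mx0 mul0mx addr0.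
by [].
Qed.

Section Form.
Variables (B : mxpoly -> mxpoly -> 'M[C]_p) (P Q : nat -> mxpoly) (H : nat -> 'M[C]_p).
Hypotheses (sB : sesquilinear B) (bio : biorthogonal B P Q H).

Lemma sesq_suml J (s : seq J) (c : J -> 'M[C]_p) (F : J -> mxpoly) g :
  B (\sum_(j <- s) cmx (c j) *m F j) g = \sum_(j <- s) c j *m B (F j) g.
Proof. by apply: (@left_linear_sum p (fun f => B f g)) => A f f'; exact: sesq_left. Qed.

Lemma sesq0r f : B f 0 = 0.
Proof.
have := sesq_right sB 1%:M f 0 0; rewrite mulmx0 addr0 trmx1 mulmx1 -[X in X = _]addr0.
by move/addrI.
Qed.

Lemma sesqDr f g h : B f (g + h) = B f g + B f h.
Proof. by have := sesq_right sB 1%:M f g h; rewrite map_mx1 mul1mx trmx1 mulmx1. Qed.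

Lemma sesq_sumr J (s : seq J) (c : J -> 'M[C]_p) (F : J -> mxpoly) f :
  B f (\sum_(j <- s) cmx (c j) *m F j) = \sum_(j <- s) B f (F j) *m (c j)^T.
Proof.
elim: s => [|j s IH]; first by rewrite !big_nil sesq0r.
by rewrite !big_cons (sesq_right sB) IH.
Qed.

Lemma biorth_low m f : mxsize m f -> B (P m) f = 0.
Proof.
move=> sf; have [c [-> _]] := monic_family_expand (bio_monicr bio) sf.
rewrite sesq_sumr big1// => k _.
by rewrite (bio_eq bio) gtn_eqF ?ltn_ord// mul0mx.
Qed.

Lemma biorth_monic m f : mxsize m.+1 f -> mxcoef f m = 1%:M -> B (P m) f = H m.
Proof.
move=> sf cf; have [sQ cQ] := bio_monicr bio m.
have -> : f = (f - Q m) + Q m by rewrite subrK.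
rewrite sesqDr (bio_eq bio) eqxx biorth_low ?add0r//.
apply: mxsize_drop; first by apply: mxsizeD => //; exact: mxsizeN.
by rewrite mxcoefD mxcoef_opp cf cQ subrr.
Qed.

Lemma biorth_coef n (c : nat -> 'M[C]_p) k : (k < n)%N ->
  B (\sum_(j < n) cmx (c j) *m P j) (Q k) = c k *m H k.
Proof.
move=> kn; rewrite sesq_suml (bigD1 (Ordinal kn)) //= (bio_eq bio) eqxx.
rewrite big1 ?addr0// => j jk; rewrite (bio_eq bio) ifF ?mulmx0//.
by apply: contraNF jk => /eqP jk; apply/eqP; exact: val_inj.
Qed.

Lemma biorth_nondeg n f : mxsize n f ->
  (forall k, (k < n)%N -> B f (Q k) = 0) -> f = 0.
Proof.
move=> sf f0; have [c [Ef _]] := monic_family_expand (bio_monicl bio) sf.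
rewrite Ef big1// => k _.
have := f0 k (ltn_ord k); rewrite Ef biorth_coef// => /(congr1 (mulmx^~ (invmx (H k)))).
by rewrite mulmxK ?mul0mx ?(bio_unit bio)// => ->; rewrite map_mx0 mul0mx.
Qed.

(** The Christoffel-Darboux kernel at y, as a polynomial in x. *)
Definition reproducing_kernel (n : nat) (y : C) : mxpoly :=
  \sum_(k < n) cmx ((mxev (Q k) y)^T *m invmx (H k)) *m P k.

(** Biorthogonality gives the claim for Q k with k < n, and these span the
    polynomials of degree less than n. *)
Lemma reproducing_kernel_low n y f : mxsize n f ->
  B (reproducing_kernel n y) f = (mxev f y)^T.
Proof.
move=> sf; have [c [Ef _]] := monic_family_expand (bio_monicr bio) sf.
rewrite Ef sesq_sumr mxev_sum raddf_sum; apply: eq_bigr => k _ /=.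
rewrite (biorth_coef (fun j => (mxev (Q j) y)^T *m invmx (H j))) ?ltn_ord//.
by rewrite mulmxKV ?(bio_unit bio)// mxevM mxev_cst trmx_mul.
Qed.

Lemma reproducing_kernel_high n y m : (n <= m)%N -> B (reproducing_kernel n y) (Q m) = 0.
Proof.
move=> nm; rewrite sesq_suml big1// => k _.
by rewrite (bio_eq bio) ltn_eqF ?mulmx0// (leq_trans (ltn_ord k)).
Qed.

Lemma mxsize_reproducing_kernel n y : mxsize n (reproducing_kernel n y).
Proof.
apply: mxsize_sum => k _; apply: mxsize_cM; apply: mxsizeW (bio_monicl bio k).1.
exact: ltn_ord.
Qed.

End Form.

(** The factorization says that S1 G S2^T = H, whose (m, n) entry is the form
    at the polynomials m and n; the truncation has to contain both indices. *)
Lemma gauss_borel_biorthogonal (B : mxpoly -> mxpoly -> 'M[C]_p) S1 H S2 :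
  sesquilinear B -> quasidefinite B -> gauss_borel B S1 H S2 ->
  biorthogonal B (bipoly S1) (bipoly S2) H.
Proof.
move=> sB qB [tS1 tS2 GB].
have mon S : block_lower_unitriangular S -> monic_family (bipoly S).
  move=> tS k.
  have E d : mxcoef (bipoly S k) d = if (d < k.+1)%N then S k d else 0.
    exact: mxcoef_poly.
  split; last by rewrite E ltnSn (tS k).1.
  move=> i j; apply/leq_sizeP => d kd.
  by have /matrixP/(_ i j) := E d; rewrite ltnNge kd /= !mxE.
have U k : (0 < k)%N -> [/\ truncation S1 k \in unitmx, truncation S2 k \in unitmx,
    (\mxdiag_(i < k) H i) \in unitmx & truncation S1 k *m truncation (gram B) k *m
       (truncation S2 k)^T = \mxdiag_(i < k) H i].
  move=> k0; have := qB k k0; rewrite -unitfE -[_ \is a _]unitmxE.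
  rewrite GB !unitmx_mul unitmx_tr !unitmx_inv => /andP[/andP[u1 u2] u3].
  split; [exact: u1|exact: u3|exact: u2|].
  rewrite !mulmxA mulmxV// mul1mx -mulmxA -trmx_mul.
  by rewrite mulmxV// trmx1 mulmx1.
have E k (i j : 'I_k) : \sum_(l < k) (\sum_(l' < k) S1 i l' *m gram B l' l) *m (S2 j l)^T =
   if i == j then H i else 0.
  have k0 : (0 < k)%N by case: k i j => // -[].
  have [_ _ _] := U k k0; rewrite /truncation tr_mxblock !mul_mxblock /mxdiag.
  move=> /eq_mxblockP/(_ i j) ->.
  by case: eqP => // _; rewrite conform_mx_id.
split; [exact: mon|exact: mon| |].
  move=> k; have [_ _ uD _] := U k.+1 isT.
  have : (\mxdiag_(i < k.+1) H i) *m invmx (\mxdiag_(i < k.+1) H i) = 1%:M.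
    by rewrite mulmxV.
  rewrite -[invmx _]submxblockK mul_mxdiag_mxblock.
  rewrite (_ : 1%:M = \mxdiag_(i < k.+1) 1%:M); last by rewrite mxdiagZ.
  rewrite {2}/mxdiag => /eq_mxblockP/(_ ord_max ord_max);
    rewrite eqxx conform_mx_id => /mulmx1_unit.
  by case.
move=> m n; pose k := (maxn m n).+1.
have mk : (m < k)%N by rewrite ltnS leq_maxl.
have nk : (n < k)%N by rewrite ltnS leq_maxr.
have := E k (Ordinal mk) (Ordinal nk); rewrite /= -[in RHS](inj_eq val_inj) /= => <-.
have bw (S : nat -> nat -> 'M[C]_p) d : block_lower_unitriangular S -> (d < k)%N ->
    bipoly S d = \sum_(l <- index_enum 'I_k) cmx (S d l) *m ('X^l)%:M.
  move=> tS dk; rewrite /bipoly (big_ord_widen k (fun l => 'X^l *: cmx (S d l))) //.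
  rewrite big_mkcond; apply: eq_bigr => l _; rewrite mul_mx_scalar.
  by case: ifP => // /negbT; rewrite -leqNgt => dl; rewrite (tS d).2// map_mx0 scaler0.
rewrite (bw S1)// (bw S2)// (sesq_sumr sB); apply: eq_bigr => l _.
by rewrite (sesq_suml sB).
Qed.

End Biorthogonal.

(** * Connection formulas *)

Section Connection.
Variables (R : realType) (p NC NG : nat).
Local Notation C := R[i].
Local Notation mxpoly := 'M[{poly C}]_p.
Local Notation cmx := (map_mx polyC).
Hypothesis p_gt0 : (0 < p)%N.
Variables (WC WG : mxpoly).
Hypotheses (WC_monic : mxpoly_monic NC WC) (WG_monic : mxpoly_monic NG WG).
Variables (B Bh : mxpoly -> mxpoly -> 'M[C]_p).
Variables (P1 P2 Q1 Q2 : nat -> mxpoly) (H Hh : nat -> 'M[C]_p).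
Hypotheses (sB : sesquilinear B) (sBh : sesquilinear Bh).
Hypotheses (bio : biorthogonal B P1 P2 H) (bioh : biorthogonal Bh Q1 Q2 Hh).
Hypothesis transform : forall f g, Bh f (g *m WG^T) = B (f *m WC) g.
Variable J : mxpoly -> 'M[C]_(p, NC * p + NG * p).
Hypothesis J_linear : forall A f g, J (cmx A *m f + g) = A *m J f + J g.
Hypothesis J_range : forall f, (forall k, (k < NG)%N -> Bh f ('X^k)%:M = 0) ->
  J (f *m WC) = 0.
Hypothesis J_kernel : forall f, J f = 0 -> exists2 g, f = g *m WC &
  forall k, (k < NG)%N -> Bh g ('X^k)%:M = 0.
Variable n : nat.
Hypothesis NGn : (NG <= n)%N.

Let A : 'M[C]_(NC * p + NG * p) := block_rows NC NG (fun k => J (P1 (n - NG + k)%N)).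
Let combo (x : nat -> 'M[C]_p) : mxpoly :=
  \sum_(k < NG + NC) cmx (x k) *m P1 (n - NG + k)%N.

Lemma mxpoly_monic_mxsize N W : mxpoly_monic N W -> mxsize N.+1 (W : mxpoly).
Proof. exact: mxpoly_monic_size. Qed.

Lemma mxpoly_monic_tr N W : mxpoly_monic N W -> mxpoly_monic N (W^T : mxpoly).
Proof.
move=> [W1 W0]; split=> [|k kN].
  have := congr1 trmx W1; rewrite trmx1 => <-.
  by apply/matrixP => i j; rewrite !mxE.
have := congr1 trmx (W0 k kN); rewrite trmx0 => <-.
by apply/matrixP => i j; rewrite !mxE.
Qed.

Lemma monomial_family : monic_family (fun k => ('X^k)%:M : mxpoly).
Proof. by move=> k; split; [exact: mxsize_monomial|exact: mxcoef_monomial_top]. Qed.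

Lemma mulWG_family P k : monic_family P ->
  mxsize (k + NG).+1 (P k *m WG^T) /\ mxcoef (P k *m WG^T) (k + NG) = 1%:M.
Proof.
move=> mP; have [sP cP] := mP k; have mW := mxpoly_monic_tr WG_monic; split.
  by have := mxsizeM sP (mxpoly_monic_mxsize mW); rewrite addSn.
by rewrite mxcoefM_top ?cP ?mW.1 ?mulmx1//; exact: mxpoly_monic_mxsize.
Qed.

Let division_basis k : mxpoly :=
  if (k < NG)%N then ('X^k)%:M else ('X^(k - NG))%:M *m WG^T.

Lemma division_basis_monic : monic_family division_basis.
Proof.
move=> k; rewrite /division_basis; case: ltnP => kN; first exact: monomial_family.
by have := mulWG_family (k - NG) monomial_family; rewrite subnK.
Qed.

Lemma J_combo x : J (combo x) = block_row NC NG x *m A.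
Proof. by rewrite block_row_mul (left_linear_sum J_linear). Qed.

Lemma B_combo_low x k f : (k < n - NG)%N -> mxsize k.+1 f -> B (combo x) f = 0.
Proof.
move=> kn sf; rewrite (sesq_suml sB) big1// => i _.
rewrite (biorth_low sB bio) ?mulmx0//; apply: mxsizeW sf.
by rewrite (leq_trans kn)// leq_addr.
Qed.

Lemma mxsize_combo x : mxsize (n + NC) (combo x).
Proof.
apply: mxsize_sum => k _; apply: mxsize_cM; apply: mxsizeW (bio_monicl bio _).1.
rewrite -ltnS -(subnK NGn) addnK -addnA ltnS ltn_add2l; exact: ltn_ord.
Qed.

(** The kernel condition on J makes the combination a multiple g W_C, with g
    of degree less than n and orthogonal to division_basis below n: to y^k by
    the condition itself, and to y^(k - N_G) W_G^T because the combination has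
    no term P_j with j < n - N_G. *)
Lemma connection_combo_eq0 x : J (combo x) = 0 -> forall k, (k < NG + NC)%N -> x k = 0.
Proof.
move=> /J_kernel [g Eg g0].
have sg : mxsize n g by apply: (mxsize_quotient WC_monic); rewrite -Eg; exact: mxsize_combo.
have gperp k : (k < n)%N -> Bh g (division_basis k) = 0.
  rewrite /division_basis => kn; case: ltnP => kN; first exact: g0.
  rewrite transform -Eg; apply: (@B_combo_low _ (k - NG)); last exact: mxsize_monomial.
  by rewrite ltn_sub2r// (leq_ltn_trans kN).
have gz : g = 0.
  apply: (biorth_nondeg sBh bioh sg) => k kn.
  have [c [-> _]] := monic_family_expand division_basis_monic (bio_monicr bioh k).1.
  rewrite (sesq_sumr sBh) big1// => i _.
  by rewrite gperp ?mul0mx// (leq_trans (ltn_ord i)).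
move: Eg; rewrite gz mul0mx => c0 k kN.
have sh : monic_family (fun k => P1 k) by exact: bio_monicl bio.
have E : \sum_(j < (n - NG) + (NG + NC))
    cmx (if (j < n - NG)%N then 0 else x (j - (n - NG))%N) *m P1 j = 0.
  rewrite big_split_ord /= big1 ?add0r => [|i _]; last first.
    by rewrite ltn_ord map_mx0 mul0mx.
  rewrite -[RHS]c0; apply: eq_bigr => i _.
  by rewrite ltnNge leq_addr /= addKn.
have := monic_family_free (c := fun j => if (j < n - NG)%N then 0 else x (j - (n - NG))%N) sh E
  (k := (n - NG + k)%N).
by rewrite ltn_add2l kN ltnNge leq_addr /= addKn; apply.
Qed.

Lemma connection_matrix_unit : A \in unitmx.
Proof.
rewrite -row_free_unit; apply: inj_row_free => v vA.
(* Repeating v on p rows gives square blocks. *)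
have [x Ex] := block_row_surj (const_mx 1 *m v : 'M[C]_(p, NC * p + NG * p)).
have : const_mx 1 *m v = 0 :> 'M[C]_(p, NC * p + NG * p).
  rewrite Ex; apply: block_row0; apply: connection_combo_eq0.
  by rewrite J_combo -Ex -mulmxA vA mulmx0.
move=> /matrixP v0; apply/rowP => j; have := v0 (Ordinal p_gt0) j.
by rewrite !mxE big_ord1 mxE mul1r.
Qed.

(** The coefficient c_k of Q1 n W_C satisfies c_k H_k = Bh (Q1 n) (P2 k
    W_G^T). The degree k + N_G of the second argument is less than n when k <
    n - N_G, and equal to n, with leading coefficient 1, when k = n - N_G. If
    N_G = N_C = 0, the bottom coefficient is also the top one. *)
Lemma connection_coef : exists x : nat -> 'M[C]_p,
  [/\ Q1 n *m WC = combo x + P1 (n + NC)%N,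
      J (combo x) + J (P1 (n + NC)%N) = 0 &
      Hh n = if (NG + NC == 0)%N then H (n - NG)%N else x 0%N *m H (n - NG)%N].
Proof.
have sF : mxsize (n + NC).+1 (Q1 n *m WC).
  by have := mxsizeM (bio_monicl bioh n).1 (mxpoly_monic_mxsize WC_monic); rewrite addSn.
have cF : mxcoef (Q1 n *m WC) (n + NC) = 1%:M.
  by rewrite mxcoefM_top ?WC_monic.1 ?(bio_monicl bioh n).2 ?mulmx1//;
    [exact: (bio_monicl bioh n).1|exact: mxpoly_monic_mxsize].
have [c [Ec lc]] := monic_family_expand (bio_monicl bio) sF.
have c1 : c (n + NC)%N = 1%:M by rewrite (lc _ erefl).
have cH k : (k <= n + NC)%N -> c k *m H k = Bh (Q1 n) (P2 k *m WG^T).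
  by move=> kn; rewrite transform Ec (biorth_coef sB bio).
have low k : (k < n - NG)%N -> c k = 0.
  move=> kn; have : c k *m H k = 0.
    rewrite cH; last by rewrite (leq_trans (ltnW kn))// (leq_trans (leq_subr _ _))// leq_addr.
    apply: (biorth_low sBh bioh); apply: mxsizeW (mulWG_family k (bio_monicr bio)).1.
    by rewrite addnC -ltn_subRL.
  move=> /(congr1 (mulmx^~ (invmx (H k)))).
  by rewrite mulmxK ?(bio_unit bio)// mul0mx.
have first : c (n - NG)%N *m H (n - NG)%N = Hh n.
  rewrite cH; last by rewrite (leq_trans (leq_subr _ _))// leq_addr.
  have [] := mulWG_family (n - NG) (bio_monicr bio); rewrite subnK// => s1 s2.
  exact: (biorth_monic sBh bioh).
exists (fun k => c (n - NG + k)%N).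
have EF : Q1 n *m WC = combo (fun k => c (n - NG + k)%N) + P1 (n + NC)%N.
  rewrite Ec big_ord_recr /= c1 map_mx1 mul1mx; congr (_ + _).
  have -> : (n + NC = (n - NG) + (NG + NC))%N by rewrite addnA subnK.
  rewrite big_split_ord /= big1 ?add0r// => i _.
  by rewrite low ?map_mx0 ?mul0mx// ltn_ord.
split=> //.
  rewrite -[X in X + _]mul1mx -J_linear map_mx1 mul1mx -EF.
  apply: J_range => k kN; apply: (biorth_low sBh bioh).
  by apply: (mxsizeW (leq_trans kN NGn)); exact: mxsize_monomial.
rewrite -first addn0; case: eqP => // E0.
suff -> : c (n - NG)%N = 1%:M by rewrite mul1mx.
rewrite -c1; congr c; move: E0 NGn; case: (NG) => //; case: (NC) => // _ _.
by rewrite subn0 addn0.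
Qed.

Lemma block_row_mul_Hcol (x : nat -> 'M[C]_p) (Hc : nat -> 'M[C]_p) :
  (forall k, Hc k = if k == 0%N then H (n - NG)%N else 0) -> (0 < NG + NC)%N ->
  block_row NC NG x *m block_rows NC NG Hc = x 0%N *m H (n - NG)%N.
Proof.
move=> HcE N0; rewrite block_row_mul (bigD1 (Ordinal N0)) //= HcE eqxx big1 ?addr0// => i i0.
rewrite HcE ifF ?mulmx0//; apply: contraNF i0 => /eqP E; apply/eqP; exact: val_inj.
Qed.

(** The relation J (combo x) = - J (P1 (n + N_C)) determines the coefficients
    x, the matrix A being invertible; substituting them gives a Schur
    complement. *)
Lemma christoffel_P1 x : mxev (Q1 n *m WC) x =
  last_quasidet A (block_rows NC NG (fun k => mxev (P1 (n - NG + k)%N) x))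
    (J (P1 (n + NC)%N)) (mxev (P1 (n + NC)%N) x).
Proof.
have [c [-> /eqP JE _]] := connection_coef.
move: JE; rewrite addr_eq0 J_combo => /eqP E.
have Ec : block_row NC NG c = - (J (P1 (n + NC)%N) *m invmx A).
  by rewrite -mulNmx -[- J _]opprK -E opprK mulmxK ?connection_matrix_unit.
rewrite /last_quasidet mxevD addrC; congr (_ + _).
rewrite -mulNmx -Ec block_row_mul mxev_sum; apply: eq_bigr => k _.
by rewrite mxevM mxev_cst.
Qed.

Lemma christoffel_H (Hc : nat -> 'M[C]_p) :
  (forall k, Hc k = if k == 0%N then H (n - NG)%N else 0) ->
  Hh n = last_quasidet A (block_rows NC NG Hc) (J (P1 (n + NC)%N)) (Hc (NG + NC)%N).
Proof.
move=> HcE; have [c [_ /eqP JE ->]] := connection_coef.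
move: JE; rewrite addr_eq0 J_combo => /eqP E.
have Ec : block_row NC NG c = - (J (P1 (n + NC)%N) *m invmx A).
  by rewrite -mulNmx -[- J _]opprK -E opprK mulmxK ?connection_matrix_unit.
rewrite /last_quasidet HcE -mulNmx -Ec; case: eqP => N0.
  rewrite block_row_mul big1 ?addr0 ?N0// => i _.
  by have := ltn_ord i.
by rewrite add0r block_row_mul_Hcol// lt0n; apply/eqP.
Qed.

(** The coefficients now are those of the difference D of the transformed
    kernel times W_C and of W_G(y) times the original one. For k below n - N_G
    the transformed kernel reproduces P2 k W_G^T and the original one P2 k,
    and the two contributions cancel. At n - N_G the polynomial P2 k W_G^T is
    monic of degree n, and the transformed kernel reproduces it up to its
    component Q2 n. *)
Lemma christoffel_P2 y (Hc : nat -> 'M[C]_p) (L : 'M[C]_(p, NC * p + NG * p)) :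
  (0 < NG)%N ->
  (forall k, Hc k = if k == 0%N then H (n - NG)%N else 0) ->
  J (reproducing_kernel Q1 Q2 Hh n y *m WC) - mxev WG y *m J (reproducing_kernel P1 P2 H n y) = -
    L ->
  (mxev (Q2 n) y)^T = - last_quasidet A (block_rows NC NG Hc) L 0.
Proof.
move=> NG0 HcE JL.
pose Kh := reproducing_kernel Q1 Q2 Hh n y; pose K := reproducing_kernel P1 P2 H n y.
pose D := Kh *m WC - cmx (mxev WG y) *m K.
have sKh : mxsize n Kh by exact: mxsize_reproducing_kernel bioh _ _.
have sD : mxsize (n + NC) D.
  apply: mxsizeD; first by apply: mxsizeM => //; exact: mxpoly_monic_mxsize.
  apply: mxsizeN; apply: mxsize_cM; apply: mxsizeW (mxsize_reproducing_kernel bio n y);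
    exact: leq_addr.
have [c [Ec _]] := monic_family_expand (bio_monicl bio) sD.
have DE f : B D f = Bh Kh (f *m WG^T) - mxev WG y *m B K f.
  rewrite transform /D addrC -mulNmx -map_mxN (sesq_left sB) mulNmx addrC.
  by [].
have cH k : (k < n + NC)%N -> c k *m H k = Bh Kh (P2 k *m WG^T) - mxev WG y *m B K (P2 k).
  by move=> kn; rewrite -DE Ec (biorth_coef sB bio).
have low k : (k < n - NG)%N -> c k = 0.
  move=> kn; have kn' : (k < n)%N by rewrite (leq_trans kn)// leq_subr.
  have : c k *m H k = 0.
    rewrite cH; last by rewrite (leq_trans kn')// leq_addr.
    rewrite (reproducing_kernel_low sBh bioh); last first.
      apply: mxsizeW (mulWG_family k (bio_monicr bio)).1.
      by rewrite addnC -ltn_subRL.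
    rewrite (reproducing_kernel_low sB bio); last exact: mxsizeW (bio_monicr bio k).1.
    by rewrite mxevM mxevT trmx_mul trmxK subrr.
  move=> /(congr1 (mulmx^~ (invmx (H k)))).
  by rewrite mulmxK ?(bio_unit bio)// mul0mx.
have n0 : (n - NG < n)%N by rewrite ltn_subrL NG0 (leq_trans NG0).
have first : c (n - NG)%N *m H (n - NG)%N = - (mxev (Q2 n) y)^T.
  rewrite cH; last by rewrite (leq_trans n0)// leq_addr.
  rewrite (reproducing_kernel_low sB bio); last exact: mxsizeW (bio_monicr bio _).1.
  have [] := mulWG_family (n - NG) (bio_monicr bio); rewrite subnK// => s1 s2.
  set F := P2 _ *m _ in s1 s2 *.
  (* F - Q2 n has degree less than n, and the kernel of the transformed form
     is orthogonal to Q2 n. *)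
  have -> : F = (F - Q2 n) + Q2 n by rewrite subrK.
  rewrite (sesqDr sBh) (reproducing_kernel_high sBh bioh)// addr0 (reproducing_kernel_low sBh
    bioh).
    rewrite mxevD linearD /= /F mxevM mxevT trmx_mul trmxK addrAC subrr add0r.
    by apply/matrixP => i j; rewrite !mxE hornerN.
  apply: mxsize_drop; first by apply: mxsizeD => //; apply: mxsizeN; exact: (bio_monicr bioh n).1.
  by rewrite mxcoefD mxcoef_opp s2 (bio_monicr bioh n).2 subrr.
pose x k := c (n - NG + k)%N.
have ED : D = combo x.
  rewrite Ec; have -> : (n + NC = (n - NG) + (NG + NC))%N by rewrite addnA subnK.
  rewrite big_split_ord /= big1 ?add0r// => i _.
  by rewrite low ?map_mx0 ?mul0mx// ltn_ord.
have JD : J D = - L.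
  rewrite -JL /D addrC -mulNmx -map_mxN J_linear mulNmx addrC.
  by [].
have Ex : block_row NC NG x = - (L *m invmx A).
  by rewrite -mulNmx -JD ED J_combo mulmxK ?connection_matrix_unit.
rewrite /last_quasidet sub0r opprK -[L *m _]opprK -Ex mulNmx block_row_mul_Hcol//; last first.
  by rewrite addn_gt0 NG0.
by rewrite /x addn0 first opprK.
Qed.

End Connection.

(** * The jet map and the Christoffel formulas *)

Section JetMap.
Variables (R : realType) (p : nat).
Local Notation C := R[i].
Local Notation mxpoly := 'M[{poly C}]_p.
Local Notation cmx := (map_mx polyC).
Variable u : 'I_p -> 'I_p -> plane_distribution R.
Hypothesis u_suppx : bounded_set (ksupp_x u).
Hypothesis u_suppy : bounded_set (ksupp_y u).
Variables (NC NG : nat) (WC WG : mxpoly).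
Hypotheses (WC_monic : mxpoly_monic NC WC) (WG_monic : mxpoly_monic NG WG).
Variables (DC DG : spectral_data R p).
Hypotheses (hDC : is_spectral_data WC DC) (hDG : is_spectral_data WG DG).
Hypothesis WG_supp : forall y : R, ksupp_y u y -> ~~ root (\det WG) y%:C.
Variable xi : masses R p.

Local Notation U := (regular_set u).
Local Notation hat := (hat_form u WC WG DG xi).
Let detWG : \det WG != 0 := detW_neq0 WG_monic.
Let Ux a : (a < sd_q DG)%N -> U (sd_x DG a).
Proof. exact: (regular_node u_suppx u_suppy hDG WG_supp). Qed.

Lemma spectral_jet_congr (f g : C -> 'M[C]_p) : mx_holo U f ->
  (forall z, U z -> f z = g z) ->
  spectral_jet DG NG f = spectral_jet DG NG g.
Proof.
move=> hf fg; apply/matrixP => i c.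
have [a [j [m [E aq _ _]]]] := jetP WG_monic hDG c.
rewrite !(spectral_jetE _ _ E); congr (_ / _).
apply: (cderivn_eq _ (@regular_open R p u) _ _ (Ux aq)).
  by move=> z Uz; rewrite fg.
exact: holo_mul_poly.
Qed.

Lemma second_kind_linear A f g z : U z ->
  second_kind u (cmx A *m f + g) z = A *m second_kind u f z + second_kind u g z.
Proof.
move=> Uz; have nr : kernel_smooth_y u (fun y : R => ((z - y%:C)^-1)%:M).
  have := @kernel_smooth_yZ _ _ u (fun y => (z - y%:C)^-1) _ (kernel_smooth_resolvent u_suppx
    u_suppy Uz) (kernel_smooth_y_cst u_suppx u_suppy 1%:M).
  by congr kernel_smooth_y; apply/funext => y; rewrite scalemx1.
rewrite /second_kind -kformMl; [|exact: kernel_smooth_x_poly|exact: nr].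
rewrite -kformDl; [| |exact: kernel_smooth_x_poly|exact: nr].
  by congr (kform _ _ _); apply/funext => x; rewrite mxevD mxevM mxev_cst.
have := kernel_smooth_x_poly u_suppx u_suppy (cmx A *m f).
by congr (kernel_smooth_x _ _); apply/funext => x; rewrite mxevM mxev_cst.
Qed.

Lemma mass_row_linear A f g :
  mass_row DG NG xi (cmx A *m f + g) = A *m mass_row DG NG xi f + mass_row DG NG xi g.
Proof.
apply/matrixP => i c; rewrite [RHS]mxE [X in _ = X + _]mxE mxE [X in _ = _ + X]mxE.
under eq_bigr do rewrite [X in _ * X]mxE.
case: (jet_nth DG c) => -[a j] m.
by rewrite mass_pair_left [LHS]mxE [X in X + _ = _]mxE.
Qed.

Definition jet_map (f : mxpoly) : 'M[C]_(p, NC * p + NG * p) :=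
  row_mx (spectral_jet DC NC (mxev f))
    (spectral_jet DG NG (second_kind u f) - mass_row DG NG xi f *m spectral_W WG DG NG).

Lemma jet_map_linear A f g :
  jet_map (cmx A *m f + g) = A *m jet_map f + jet_map g.
Proof.
rewrite /jet_map (spectral_jet_poly_linear WC_monic hDC) mul_mx_row add_row_mx.
congr row_mx; rewrite mass_row_linear mulmxDl -mulmxA mulmxBr addrACA -opprD.
congr (_ - _).
rewrite -(spectral_jet_linear WG_monic hDG _ (@regular_open R p u) Ux);
  [|exact: mx_holo_second_kind|exact: mx_holo_second_kind].
apply: spectral_jet_congr; first exact: mx_holo_second_kind.
by move=> z Uz; rewrite second_kind_linear.
Qed.

Lemma jet_map_mulWC g : jet_map (g *m WC) =
  row_mx 0 (- spectral_jet DG NG (mxev (hat_bezoutian u WC WG NG DG xi g))).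
Proof.
rewrite /jet_map (spectral_jet_mulW WC_monic hDC).
by rewrite (second_kind_jets u_suppx u_suppy WC WG_monic hDG WG_supp).
Qed.

Lemma jet_map_range f : (forall k, (k < NG)%N -> hat f ('X^k)%:M = 0) ->
  jet_map (f *m WC) = 0.
Proof.
move=> f0; rewrite jet_map_mulWC.
have -> : hat_bezoutian u WC WG NG DG xi f = 0.
  rewrite /hat_bezoutian big_nat_cond big1// => k /andP[/andP[k1 kN] _].
  rewrite big1// => i _; rewrite f0 ?mul0mx ?map_mx0 ?scaler0//.
  by rewrite (leq_ltn_trans (leq_subr _ _))// prednK.
have := spectral_jet_mulW WG_monic hDG 0; rewrite mul0mx => ->.
by rewrite oppr0 row_mx0.
Qed.

(** The first block of the row gives divisibility by W_C. The second one then
    says that a polynomial of degree less than N_G has zero jets for W_G; it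
    is a multiple of W_G, so it is 0. *)
Lemma jet_map_kernel f : jet_map f = 0 -> exists2 g, f = g *m WC &
  forall k, (k < NG)%N -> hat g ('X^k)%:M = 0.
Proof.
rewrite -row_mx0 => J0; have [JC0 _] := eq_row_mx J0.
have [g Eg] := spectral_jet_eq0 WC_monic hDC JC0; exists g => //.
move: J0; rewrite Eg jet_map_mulWC => /eq_row_mx[_ /eqP].
rewrite oppr_eq0 => /eqP /(spectral_jet_eq0 WG_monic hDG) [h Eh].
apply: (hat_bezoutian_eq0 WG_monic).
have sh : mxsize 0 h.
  apply: (mxsize_quotient WG_monic); rewrite add0n -Eh; exact: mxsize_hat_bezoutian.
rewrite Eh; have -> : h = 0; last by rewrite mul0mx.
by apply/matrixP => i j; apply/eqP; rewrite mxE -size_poly_leq0 sh.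
Qed.

Lemma pform_sesquilinear : sesquilinear (pform u).
Proof.
by split=> A *; [exact: pform_left|exact: pform_right].
Qed.

Lemma hat_sesquilinear : sesquilinear hat.
Proof.
split=> A *; first exact: (hat_form_left u_suppx u_suppy WC detWG).
exact: (hat_form_right u_suppx u_suppy WC detWG).
Qed.

Lemma second_kind_sum n (c : nat -> 'M[C]_p) (P : nat -> mxpoly) z : U z ->
  second_kind u (\sum_(k < n) cmx (c k) *m P k) z = \sum_(k < n) c k *m second_kind u (P k) z.
Proof.
move=> Uz; apply: (@left_linear_sum R p p (fun f => second_kind u f z)) => A f g.
exact: second_kind_linear.
Qed.

End JetMap.

Theorem theorem6 (R : realType) (p : nat) (hp : (0 < p)%N)
  (u : 'I_p -> 'I_p -> plane_distribution R)
  (u_fast : forall k l, fast_decreasing (u k l))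
  (u_suppx : bounded_set (ksupp_x u)) (u_suppy : bounded_set (ksupp_y u))
  (NC NG : nat) (WC WG : 'M[{poly R[i]}]_p)
  (WC_monic : mxpoly_monic NC WC) (WG_monic : mxpoly_monic NG WG)
  (DC DG : spectral_data R p)
  (hDC : is_spectral_data WC DC) (hDG : is_spectral_data WG DG)
  (WG_supp : forall y : R, ksupp_y u y -> ~~ root (\det WG) y%:C)
  (xi : masses R p)
  (u_qd : quasidefinite (pform u))
  (uhat_qd : quasidefinite (hat_form u WC WG DG xi))
  (S1 S2 : nat -> nat -> 'M[R[i]]_p) (H : nat -> 'M[R[i]]_p)
  (u_gb : gauss_borel (pform u) S1 H S2)
  (S1h S2h : nat -> nat -> 'M[R[i]]_p) (Hh : nat -> 'M[R[i]]_p)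
  (uhat_gb : gauss_borel (hat_form u WC WG DG xi) S1h Hh S2h)
  (n : nat) (hn : (NG <= n)%N) :
  let P1 := bipoly S1 in
  let JC := spectral_jet DC NC in
  let JG := spectral_jet DG NG in
  let M k := JG (second_kind u (P1 k))
             - mass_row DG NG xi (P1 k) *m spectral_W WG DG NG in
  let row k := row_mx (JC (mxev (P1 k))) (M k) in
  let A := block_rows NC NG (fun k => row (n - NG + k)%N) in
  let Hcol k := if k == 0%N then H (n - NG)%N else 0 in
  [/\ A \in unitmx,
      forall x : R[i],
        mxev (bipoly S1h n *m WC) x =
        last_quasidet A
          (block_rows NC NG (fun k => mxev (P1 (n - NG + k)%N) x))
          (row (n + NC)%N) (mxev (P1 (n + NC)%N) x),
      Hh n =
        last_quasidet A (block_rows NC NG Hcol)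
          (row (n + NC)%N) (Hcol (NG + NC)%N) &
      (0 < NG)%N -> forall y : R[i],
        let K := cd_kernel_pred S1 H S2 n y in
        let Kpc := mixed_kernel_pred u S1 H S2 n ^~ y in
        (mxev (bipoly S2h n) y)^T =
        - last_quasidet A (block_rows NC NG Hcol)
            (row_mx
              (mxev WG y *m JC (mxev K))
              (mxev WG y *m (JG Kpc - mass_row DG NG xi K
                                        *m spectral_W WG DG NG)
               + JG (bezoutian WG NG ^~ y)))
            0].
Proof.
have sB := pform_sesquilinear u_suppx u_suppy.
have sBh := hat_sesquilinear u_suppx u_suppy WC WG_monic DG WG_supp xi.
have bio := gauss_borel_biorthogonal sB u_qd u_gb.
have bioh := gauss_borel_biorthogonal sBh uhat_qd uhat_gb.
have tr := hat_form_mulWG u_suppx u_suppy WC (detW_neq0 WG_monic) hDG WG_supp xi.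
have Jl := jet_map_linear u_suppx u_suppy WC_monic WG_monic hDC hDG WG_supp xi.
have Jr := jet_map_range u_suppx u_suppy WC_monic WG_monic hDC hDG WG_supp (xi := xi).
have Jk := jet_map_kernel u_suppx u_suppy WC_monic WG_monic hDC hDG WG_supp (xi := xi).
move=> P1 JC JG M row A Hcol; split.
- exact: (connection_matrix_unit hp WC_monic WG_monic sB sBh bio bioh tr Jl Jk hn).
- exact: (christoffel_P1 hp WC_monic WG_monic sB sBh bio bioh tr Jl Jr Jk hn).
- exact: (christoffel_H hp WC_monic WG_monic sB sBh bio bioh tr Jl Jr Jk hn).
- move=> NG0 y K Kpc.
  apply: (christoffel_P2 hp WC_monic WG_monic sB sBh bio bioh tr Jl Jk hn NG0) => //.
  (* The bezoutian has degree less than n in y, so the transformed kernel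
     reproduces it. *)
  have EV : spectral_jet DG NG (mxev (hat_bezoutian u WC WG NG DG xi
      (reproducing_kernel (bipoly S1h) (bipoly S2h) Hh n y))) = JG (bezoutian WG NG ^~ y).
    congr (JG _); apply/funext => z.
    rewrite mxev_hat_bezoutian ?(detW_neq0 WG_monic)//.
    rewrite (reproducing_kernel_low sBh bioh); last by apply: (mxsizeW hn); exact: mxsize_bezoutian_poly.
    by rewrite mxev_bezoutian_poly trmxK.
  have EK : JG (second_kind u K) = JG Kpc.
    apply: (spectral_jet_congr u_suppx u_suppy WG_monic hDG WG_supp).
      exact: mx_holo_second_kind.
    move=> z Uz.
    exact: (second_kind_sum u_suppx u_suppy n
      (fun k => (mxev (bipoly S2 k) y)^T *m invmx (H k)) (bipoly S1) Uz).
  rewrite (jet_map_mulWC u_suppx u_suppy WC_monic WG_monic hDC hDG WG_supp) EV.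
  rewrite -[reproducing_kernel (bipoly S1) (bipoly S2) H n y]/K /jet_map -/JG -/JC EK.
  generalize (JG Kpc - mass_row DG NG xi K *m spectral_W WG DG NG).
  generalize (JC (mxev K)) (JG (bezoutian WG NG ^~ y)) => a b c.
  by rewrite mul_mx_row -[0]oppr0 -opp_row_mx -opprD add_row_mx add0r [b + _]addrC.
Qed.
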